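(* Let $\Omega(\mathcal{B}_\mathcal{P})$ be a tetrahedral, an octahedral or a cubical Apollonian (disk) packing. Then there exists an orthoplicial Apollonian (sphere) packing $\Omega(\mathcal{B}_{\mathcal{O}^4})$ containing an Apollonian section which is arithmetically equivalent to $\Omega(\mathcal{B}_\mathcal{P})$. Moreover, $\Omega(\mathcal{B}_\mathcal{P})$ is integral if and only if $\Omega(\mathcal{B}_{\mathcal{O}^4})$ is integral.
   Context: $\widehat{\mathbb{R}^d}=\mathbb{R}^d\cup\{\infty\}$, identified with the unit sphere $\mathbb{S}^d\subset\mathbb{E}^{d+1}$ by stereographic projection. A $d$-ball is a closed ball of $\mathbb{R}^d$, the closure of the complement of an open ball, or a closed half-space (the last two containing $\infty$); its curvature is $1/r$, $-1/r$, or $0$ respectively, $r$ being the radius. A $d$-ball packing is a collection of $d$-balls with pairwise disjoint interiors; its tangency graph has one vertex per ball and an edge for each tangent pair. For a $(d+1)$-polytope $\mathcal{P}\subset\mathbb{E}^{d+1}$ with all vertices outside $\mathbb{S}^d$, each vertex $v$ determines the spherical cap of points of $\mathbb{S}^d$ visible from $v$; its stereographic image is a $d$-ball $b_v$, and $\mathsf{B}(\mathcal{P})=\{b_v\}$ is the ball-arrangement projection of $\mathcal{P}$. $\mathcal{P}$ is edge-scribed if all its edges are tangent to $\mathbb{S}^d$; then $\mathsf{B}(\mathcal{P})$ is a $d$-ball packing whose tangency graph is the 1-skeleton of $\mathcal{P}$. A polytopal $d$-ball packing with tangency polytope $\mathcal{P}$ is a packing $\mathcal{B}_\mathcal{P}=\mu(\mathsf{B}(\mathcal{P}))$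 with $\mathcal{P}$ edge-scribed and $\mu$ a Möbius transformation of $\widehat{\mathbb{R}^d}$. Its dual is $\mathcal{B}_\mathcal{P}^*=\mu(\mathsf{B}(\mathcal{P}^* ))$, $\mathcal{P}^*$ the polar of $\mathcal{P}$ (again edge-scribed); its balls correspond to facets $f$ of $\mathcal{P}$ and the boundary of $b_f$ is orthogonal to $b_v$ for all vertices $v\in f$. The Apollonian group $\mathsf{A}(\mathcal{B}_\mathcal{P})$ is the group generated by the inversions in the boundary spheres of the balls of $\mathcal{B}_\mathcal{P}^*$, and the Apollonian packing (Apollonian cluster) is $\Omega(\mathcal{B}_\mathcal{P})=\{g(b): g\in\mathsf{A}(\mathcal{B}_\mathcal{P}),\ b\in\mathcal{B}_\mathcal{P}\}$. It is tetrahedral, octahedral, cubical (for $d=2$) if $\mathcal{P}$ is a tetrahedron, octahedron, cube respectively, and orthoplicial (for $d=3$) if $\mathcal{P}$ is a $4$-dimensional cross polytope (orthoplex). A packing is integral if all curvatures of its balls are integers. An Apollonian section of $\Omega(\mathcal{B}_\mathcal{P})$ is a set $\Sigma=\Gamma\cdot X=\{g(b):g\in\Gamma,b\in X\}$ for some subgroup $\Gamma<\mathsf{A}(\mathcal{B}_\mathcal{P})$ and subset $X\subseteq\mathcal{B}_\mathcal{P}$ (in particular $\Omega(\mathcal{B}_\mathcal{P})$ itself is one). Two Apollonian sections $\Sigma=\Gamma\cdot X$ and $\Sigma'=\Gamma'\cdot X'$ are algebraically equivalent if there are a group isomorphism $\phi:\Gamma\to\Gamma'$ and a bijection $\psi:\Sigma\to\Sigma'$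 with $\psi(g\cdot b)=\phi(g)\cdot\psi(b)$ for all $g\in\Gamma$, $b\in X$; they are arithmetically equivalent if moreover $\psi$ preserves curvatures. *)

(* Defs.v *)
From HB Require Import structures.
From mathcomp Require Import all_boot all_order all_algebra.
From mathcomp Require Import all_classical all_reals all_analysis.

Set Implicit Arguments.
Unset Strict Implicit.
Unset Printing Implicit Defensive.

Import Order.TTheory GRing.Theory Num.Theory.
Import numFieldNormedType.Exports.

Local Open Scope classical_set_scope.
Local Open Scope ring_scope.

Definition dot {R : realType} {n : nat} (u v : 'rV[R]_n) : R :=
  \sum_i u 0 i * v 0 i.

(* The library norm on matrices is the sup norm, hence this Euclidean norm. *)
Definition enorm {R : realType} {n : nat} (u : 'rV[R]_n) : R :=
  Num.sqrt (dot u u).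

(** * Balls of the one-point compactification *)

(* None is the point at infinity. *)
Definition hatR (R : realType) (d : nat) : Type := option 'rV[R]_d.

Definition inner_ball {R : realType} {d : nat} (c : 'rV[R]_d) (r : R) :
    set (hatR R d) :=
  [set Some x | x in [set x : 'rV[R]_d | enorm (x - c) <= r]].

Definition outer_ball {R : realType} {d : nat} (c : 'rV[R]_d) (r : R) :
    set (hatR R d) :=
  None |` [set Some x | x in [set x : 'rV[R]_d | r <= enorm (x - c)]].

Definition half_space {R : realType} {d : nat} (n : 'rV[R]_d) (a : R) :
    set (hatR R d) :=
  None |` [set Some x | x in [set x : 'rV[R]_d | dot n x <= a]].

(* has_curvature b k: the set b is a d-ball, and its curvature is k. *)
Inductive has_curvature {R : realType} {d : nat} (b : set (hatR R d)) :
    R -> Prop :=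
| InnerCurvature (c : 'rV[R]_d) (r : R) of
    0 < r & b = inner_ball c r : has_curvature b r^-1
| OuterCurvature (c : 'rV[R]_d) (r : R) of
    0 < r & b = outer_ball c r : has_curvature b (- r^-1)
| HalfSpaceCurvature (n : 'rV[R]_d) (a : R) of
    n != 0 & b = half_space n a : has_curvature b 0.

(** * Inversions and groups of transformations *)

Definition sphere_inversion {R : realType} {d : nat} (c : 'rV[R]_d) (r : R)
    (p : hatR R d) : hatR R d :=
  match p with
  | None => Some c
  | Some x => if x == c then None
              else Some (c + (r ^+ 2 / dot (x - c) (x - c)) *: (x - c))
  end.

Definition hyperplane_reflection {R : realType} {d : nat} (n : 'rV[R]_d)
    (a : R) (p : hatR R d) : hatR R d :=
  match p with
  | None => None
  | Some x => Some (x - (2 * (dot n x - a) / dot n n) *: n)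
  end.

(* boundary_inversion b s: b is a d-ball and s is the inversion in its
   boundary sphere. *)
Inductive boundary_inversion {R : realType} {d : nat} (b : set (hatR R d)) :
    (hatR R d -> hatR R d) -> Prop :=
| InnerInversion (c : 'rV[R]_d) (r : R) of
    0 < r & b = inner_ball c r : boundary_inversion b (sphere_inversion c r)
| OuterInversion (c : 'rV[R]_d) (r : R) of
    0 < r & b = outer_ball c r : boundary_inversion b (sphere_inversion c r)
| HalfSpaceInversion (n : 'rV[R]_d) (a : R) of
    n != 0 & b = half_space n a :
    boundary_inversion b (hyperplane_reflection n a).

Definition is_transformation_group {T : Type} (G : set (T -> T)) : Prop :=
  [/\ G id,
      forall g h, G g -> G h -> G (g \o h) &
      forall g, G g -> exists2 h, G h & cancel g h /\ cancel h g].

Definition generated_group {T : Type} (S : set (T -> T)) : set (T -> T) :=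
  [set g | forall G : set (T -> T),
     is_transformation_group G -> S `<=` G -> G g].

Definition moebius (R : realType) (d : nat) : set (hatR R d -> hatR R d) :=
  generated_group
    [set s | exists b : set (hatR R d), boundary_inversion b s].

(** * Polytopes *)

Definition convex_hull {R : realType} {n m : nat} (p : 'I_m -> 'rV[R]_n) :
    set 'rV[R]_n :=
  [set x | exists w : 'I_m -> R,
     [/\ forall i, 0 <= w i, \sum_i w i = 1 & x = \sum_i w i *: p i]].

(* The affine hull of F has dimension k: it is p + <rows of A>. *)
Definition has_dim {R : realType} {n : nat} (F : set 'rV[R]_n) (k : nat) :
    Prop :=
  exists (p : 'rV[R]_n) (A : 'M[R]_(k, n)),
    [/\ F p, row_free A, forall i, F (p + row i A) &
        forall x, F x -> (x - p <= A)%MS].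

Definition is_full_polytope {R : realType} {n : nat} (P : set 'rV[R]_n) :
    Prop :=
  (exists (m : nat) (p : 'I_m -> 'rV[R]_n), P = convex_hull p) /\ has_dim P n.

(* u = 0 yields the improper faces P and set0. *)
Definition face {R : realType} {n : nat} (P : set 'rV[R]_n) :
    set (set 'rV[R]_n) :=
  [set F | exists (u : 'rV[R]_n) (a : R),
     (forall x, P x -> dot u x <= a) /\ F = P `&` [set x | dot u x = a]].

Definition vertex {R : realType} {n : nat} (P : set 'rV[R]_n) : set 'rV[R]_n :=
  [set v | face P [set v]].

Definition edge {R : realType} {n : nat} (P : set 'rV[R]_n) :
    set (set 'rV[R]_n) :=
  [set e | face P e /\ has_dim e 1].

Definition polar {R : realType} {n : nat} (P : set 'rV[R]_n) : set 'rV[R]_n :=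
  [set y | forall x, P x -> dot x y <= 1].

(* e touches the unit sphere at x and lies in the tangent hyperplane at x. *)
Definition tangent_to_sphere {R : realType} {n : nat} (e : set 'rV[R]_n) :
    Prop :=
  exists x, [/\ e x, enorm x = 1 & forall y, e y -> dot x (y - x) = 0].

Definition edge_scribed {R : realType} {n : nat} (P : set 'rV[R]_n) : Prop :=
  forall e, edge P e -> tangent_to_sphere e.

Definition combinatorially_equivalent {R : realType} {n m : nat}
    (P : set 'rV[R]_n) (Q : set 'rV[R]_m) : Prop :=
  exists f : set 'rV[R]_n -> set 'rV[R]_m,
    set_bij (face P) (face Q) f /\
    forall F G, face P F -> face P G -> (F `<=` G <-> f F `<=` f G).

Definition simplex (R : realType) (n : nat) : set 'rV[R]_n :=
  [set x | (forall i, 0 <= x 0 i) /\ \sum_i x 0 i <= 1].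

Definition cross_polytope (R : realType) (n : nat) : set 'rV[R]_n :=
  [set x | \sum_i `|x 0 i| <= 1].

Definition cube (R : realType) (n : nat) : set 'rV[R]_n :=
  [set x | forall i, `|x 0 i| <= 1].

(** * Ball-arrangement projection *)

(* Projection from the north pole (0, ..., 0, 1). *)
Definition stereographic {R : realType} {d : nat} (x : 'rV[R]_(d + 1)) :
    hatR R d :=
  let t := rsubmx x 0 0 in
  if t == 1 then None else Some ((1 - t)^-1 *: lsubmx x).

(* x is visible from v when the half-open segment [v, x) avoids the closed
   unit ball. *)
Definition visible_cap {R : realType} {n : nat} (v : 'rV[R]_n) :
    set 'rV[R]_n :=
  [set x | enorm x = 1 /\
     forall t : R, 0 <= t < 1 -> 1 < enorm ((1 - t) *: v + t *: x)].

Definition ball_arrangement {R : realType} {d : nat}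
    (P : set 'rV[R]_(d + 1)) : set (set (hatR R d)) :=
  [set stereographic @` visible_cap v | v in vertex P].

(** * Polytopal packings *)

(* The condition that 0 is interior makes the polar a polytope.  It does not
   restrict the packings obtained, since a projective transformation preserving
   the sphere can be moved from the polytope to the Moebius map. *)
Record polytopal_packing (R : realType) (d : nat) : Type := PolytopalPacking {
  tangency_polytope : set 'rV[R]_(d + 1);
  moebius_map : hatR R d -> hatR R d;
  tangency_polytope_full : is_full_polytope tangency_polytope;
  tangency_polytope_origin : interior tangency_polytope 0;
  tangency_polytope_outside : forall v, vertex tangency_polytope v -> 1 < enorm v;
  tangency_polytope_edge_scribed : edge_scribed tangency_polytope;
  moebius_mapP : moebius moebius_map
}.

Definition balls {R : realType} {d : nat} (B : polytopal_packing R d) :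
    set (set (hatR R d)) :=
  [set moebius_map B @` b | b in ball_arrangement (tangency_polytope B)].

Definition dual_balls {R : realType} {d : nat} (B : polytopal_packing R d) :
    set (set (hatR R d)) :=
  [set moebius_map B @` b |
     b in ball_arrangement (polar (tangency_polytope B))].

Definition apollonian_group {R : realType} {d : nat}
    (B : polytopal_packing R d) : set (hatR R d -> hatR R d) :=
  generated_group [set s | exists2 b, dual_balls B b & boundary_inversion b s].

Definition ball_orbit {T : Type} (G : set (T -> T)) (X : set (set T)) :
    set (set T) :=
  [set b | exists g, G g /\ exists c, X c /\ b = g @` c].

Definition apollonian_packing {R : realType} {d : nat}
    (B : polytopal_packing R d) : set (set (hatR R d)) :=
  ball_orbit (apollonian_group B) (balls B).

Definition tetrahedral {R : realType} (B : polytopal_packing R 2) : Prop :=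
  combinatorially_equivalent (tangency_polytope B) (@simplex R 3).

Definition octahedral {R : realType} (B : polytopal_packing R 2) : Prop :=
  combinatorially_equivalent (tangency_polytope B) (@cross_polytope R 3).

Definition cubical {R : realType} (B : polytopal_packing R 2) : Prop :=
  combinatorially_equivalent (tangency_polytope B) (@cube R 3).

Definition orthoplicial {R : realType} (B : polytopal_packing R 3) : Prop :=
  combinatorially_equivalent (tangency_polytope B) (@cross_polytope R 4).

Definition integral_packing {R : realType} {d : nat}
    (S : set (set (hatR R d))) : Prop :=
  forall b, S b -> exists z : int, has_curvature b z%:~R.

(** * Apollonian sections *)

(* A section is the set [ball_orbit G X], presented by the pair (G, X). *)
Definition is_apollonian_section {R : realType} {d : nat}
    (B : polytopal_packing R d) (G : set (hatR R d -> hatR R d))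
    (X : set (set (hatR R d))) : Prop :=
  [/\ is_transformation_group G, G `<=` apollonian_group B & X `<=` balls B].

Definition is_group_isomorphism {T T' : Type} (G : set (T -> T))
    (G' : set (T' -> T')) (phi : (T -> T) -> (T' -> T')) : Prop :=
  set_bij G G' phi /\
  forall g h, G g -> G h -> phi (g \o h) = phi g \o phi h.

Definition is_algebraic_equivalence {T T' : Type}
    (G : set (T -> T)) (X : set (set T))
    (G' : set (T' -> T')) (X' : set (set T'))
    (phi : (T -> T) -> (T' -> T')) (psi : set T -> set T') : Prop :=
  [/\ is_group_isomorphism G G' phi,
      set_bij (ball_orbit G X) (ball_orbit G' X') psi &
      forall g b, G g -> X b -> psi (g @` b) = phi g @` psi b].

Definition arithmetically_equivalent {R : realType} {d d' : nat}
    (G : set (hatR R d -> hatR R d)) (X : set (set (hatR R d)))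
    (G' : set (hatR R d' -> hatR R d')) (X' : set (set (hatR R d'))) : Prop :=
  exists (phi : (hatR R d -> hatR R d) -> (hatR R d' -> hatR R d'))
         (psi : set (hatR R d) -> set (hatR R d')),
    is_algebraic_equivalence G X G' X' phi psi /\
    forall b, ball_orbit G X b ->
      forall k : R, has_curvature b k <-> has_curvature (psi b) k.

(* Main.v *)
Require Import Defs.
From HB Require Import structures.
From mathcomp Require Import all_boot all_order all_algebra.
From mathcomp Require Import all_classical all_reals all_analysis.
From mathcomp Require Import ring lra zify.

(** Balls of [hatR R d] are unit space-like vectors of the Lorentz space of
    dimension [d + 2], points are null rays, Moebius maps are Lorentz matrices
    and the curvature is a linear form.  Edge-scribability prescribes the
    product -1 for adjacent vertices, and in dimension 3 this determines the
    Gram matrix of a tetrahedron, an octahedron or a cube, so that up to a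
    Lorentz map there is one packing of each type.  Each standard configuration
    is carried into that of the orthoplex by a conformal linear embedding
    [x |-> x J + om w], where [w] spans the orthogonal of the image of [J]:
    the tetrahedron lies in the mirror of a facet inversion, the octahedron in
    a coordinate hyperplane, and the cube is the orthogonal projection of the
    whole orthoplex along (1,1,1,1).  Facet inversions of the disk packing
    become facet inversions of the orthoplex, or products of two commuting ones
    in the octahedral case.  A Moebius map is then chosen so that the curvature
    forms match.  The eight vertices of the orthoplex span a lattice preserved
    by the facet inversions, so integrality only depends on eight curvatures. *)

Set Implicit Arguments.
Unset Strict Implicit.
Unset Printing Implicit Defensive.

Import Order.TTheory GRing.Theory Num.Theory.
Import numFieldNormedType.Exports.

Local Open Scope classical_set_scope.
Local Open Scope ring_scope.

(** The delicate point is that one disk can be written [g(b)] in many ways, while the sphere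
    assigned to it must not depend on the presentation. The matrix of [g] is extended to [w] by a
    sign [chi], and a ball carries a component [om] along [w]. For the tetrahedron and the
    octahedron [om] is 0 and the presentation is harmless; the octahedron still needs [chi] to be
    the determinant, because each of its inversions must act by -1 on [w]. For the cube [om] takes
    both signs, and an invariant modulo 4 of the orbits has to tell the two kinds of vertices apart.
    Integrality passes from spheres to disks through the section. In the other direction the disks
    must account for all eight vertices of the orthoplex: the cube gives all of them, the
    tetrahedron reaches its four missing ones by a linear relation modulo [w], and the octahedron
    its two missing ones by a parity argument resting on the nullity of the curvature form. Facets
    of an arbitrary polytope are never enumerated: a vertex of the polar is determined up to scale
    by the vertices at which it is tight. *)

Section Dot.
Context {R : realType} {n : nat}.
Implicit Types u v w : 'rV[R]_n.

Lemma dotE u v : dot u v = (u *m v^T) 0 0.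
Proof. by rewrite mxE; apply: eq_bigr => i _; rewrite mxE. Qed.

Lemma dotC u v : dot u v = dot v u.
Proof. by apply: eq_bigr => i _; rewrite mulrC. Qed.

Lemma dotDl u v w : dot (u + v) w = dot u w + dot v w.
Proof. by rewrite !dotE mulmxDl mxE. Qed.

Lemma dotZl a u w : dot (a *: u) w = a * dot u w.
Proof. by rewrite !dotE -scalemxAl mxE. Qed.

Lemma dotNl u w : dot (- u) w = - dot u w.
Proof. by rewrite !dotE mulNmx mxE. Qed.

Lemma dotBl u v w : dot (u - v) w = dot u w - dot v w.
Proof. by rewrite dotDl dotNl. Qed.

Lemma dot0l w : dot 0 w = 0.
Proof. by rewrite dotE mul0mx mxE. Qed.

Lemma dotDr u v w : dot w (u + v) = dot w u + dot w v.
Proof. by rewrite dotC dotDl !(dotC w). Qed.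

Lemma dotZr a u w : dot w (a *: u) = a * dot w u.
Proof. by rewrite dotC dotZl (dotC w). Qed.

Lemma dotNr u w : dot w (- u) = - dot w u.
Proof. by rewrite dotC dotNl (dotC w). Qed.

Lemma dotBr u v w : dot w (u - v) = dot w u - dot w v.
Proof. by rewrite dotDr dotNr. Qed.

Lemma dot0r w : dot w 0 = 0.
Proof. by rewrite dotC dot0l. Qed.

Lemma dot_sumr (I : finType) (c : I -> R) (p : I -> 'rV[R]_n) w :
  dot w (\sum_i c i *: p i) = \sum_i c i * dot w (p i).
Proof.
rewrite dotE raddf_sum mulmx_sumr summxE; apply: eq_bigr => i _.
by rewrite -dotE dotZr.
Qed.

Lemma dot_ge0 u : 0 <= dot u u.
Proof. by apply: sumr_ge0 => i _; rewrite -expr2 sqr_ge0. Qed.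

Lemma dot_eq0 u : (dot u u == 0) = (u == 0).
Proof.
apply/idP/eqP => [|->]; last by rewrite dot0l.
rewrite psumr_eq0 => [/allP h|i _]; last by rewrite -expr2 sqr_ge0.
apply/rowP => i; rewrite mxE; apply/eqP.
by move: (h i (mem_index_enum i)); rewrite /= mulf_eq0 orbb.
Qed.

Lemma dot_gt0 u : (0 < dot u u) = (u != 0).
Proof. by rewrite lt_neqAle dot_ge0 andbT eq_sym dot_eq0. Qed.

Lemma enorm_ge0 u : 0 <= enorm u.
Proof. exact: sqrtr_ge0. Qed.

Lemma enorm_sqr u : enorm u ^+ 2 = dot u u.
Proof. by rewrite sqr_sqrtr ?dot_ge0. Qed.

Lemma enorm_le u r : 0 <= r -> (enorm u <= r) = (dot u u <= r ^+ 2).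
Proof. by move=> r0; rewrite -enorm_sqr ler_sqr // nnegrE enorm_ge0. Qed.

Lemma le_enorm u r : 0 <= r -> (r <= enorm u) = (r ^+ 2 <= dot u u).
Proof. by move=> r0; rewrite -enorm_sqr ler_sqr // nnegrE enorm_ge0. Qed.

Lemma lt_enorm u r : 0 <= r -> (r < enorm u) = (r ^+ 2 < dot u u).
Proof. by move=> r0; rewrite -enorm_sqr ltr_sqr // nnegrE enorm_ge0. Qed.

Lemma enorm_eq1 u : (enorm u = 1) <-> (dot u u = 1).
Proof.
split=> [h|h]; first by rewrite -enorm_sqr h expr1n.
by rewrite /enorm h sqrtr1.
Qed.

End Dot.

Lemma dot_row_mx (R : realType) n m (u u' : 'rV[R]_n) (v v' : 'rV[R]_m) :
  dot (row_mx u v) (row_mx u' v') = dot u u' + dot v v'.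
Proof. by rewrite !dotE tr_row_mx mul_row_col mxE. Qed.

Lemma dot_scalar_mx (R : realType) (a b : R) :
  dot (a%:M : 'rV_1) (b%:M : 'rV_1) = a * b.
Proof. by rewrite /dot big_ord1 !mxE. Qed.

Lemma eq_mx_rows (R : realType) n m (A B : 'M[R]_(n, m)) :
  (forall u : 'rV_n, u *m A = u *m B) -> A = B.
Proof. by move=> h; apply/row_matrixP => i; rewrite !rowE h. Qed.

(** * Lorentz forms *)

Definition leta (R : realType) (n : nat) : 'M[R]_(n + 1) :=
  block_mx 1%:M 0 0 (-1)%:M.
Arguments leta {R n}.

Definition lor {R : realType} {n : nat} (u v : 'rV[R]_(n + 1)) : R :=
  (u *m leta *m v^T) 0 0.

Definition lorentz {R : realType} {n : nat} (M : 'M[R]_(n + 1)) : Prop :=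
  M *m leta *m M^T = leta.

(** The inverse of a Lorentz matrix, read off from [M *m leta *m M^T = leta] and [leta *m leta = 1].
    Vectors are rows, so matrices act on the right throughout. *)
Definition lorentz_adj {R : realType} {n : nat} (M : 'M[R]_(n + 1)) :=
  leta *m M^T *m leta.

Definition refl {R : realType} {n : nat} (F : 'rV[R]_(n + 1)) : 'M[R]_(n + 1) :=
  1%:M - (2 / lor F F) *: (leta *m F^T *m F).

Section Lorentz.
Context {R : realType} {n : nat}.
Implicit Types u v w F : 'rV[R]_(n + 1).
Implicit Types M : 'M[R]_(n + 1).

Lemma eta_tr : (leta : 'M[R]_(n + 1))^T = leta.
Proof. by rewrite /leta tr_block_mx !trmx0 !tr_scalar_mx. Qed.

Lemma eta_sqr : (leta : 'M[R]_(n + 1)) *m leta = 1%:M.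
Proof.
rewrite /leta mulmx_block !mulmx0 !mul0mx !addr0 !add0r !mul1mx.
by rewrite -scalar_mxM mulrNN mulr1 -scalar_mx_block.
Qed.

Lemma lorE (u v : 'rV[R]_n) (a b : R) :
  lor (row_mx u a%:M) (row_mx v b%:M) = dot u v - a * b.
Proof.
rewrite /lor /leta mul_row_block !mulmx0 addr0 add0r mulmx1 tr_row_mx.
by rewrite mul_row_col mxE -dotE -scalar_mxM tr_scalar_mx -scalar_mxM mxE /=; ring.
Qed.


Lemma lorC u v : lor u v = lor v u.
Proof.
have -> : lor u v = (u *m leta *m v^T)^T 0 0 by rewrite [RHS]mxE.
by rewrite !trmx_mul trmxK eta_tr mulmxA.
Qed.

Lemma lorDl u v w : lor (u + v) w = lor u w + lor v w.
Proof. by rewrite /lor !mulmxDl mxE. Qed.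

Lemma lorZl a u w : lor (a *: u) w = a * lor u w.
Proof. by rewrite /lor -!scalemxAl mxE. Qed.

Lemma lorNl u w : lor (- u) w = - lor u w.
Proof. by rewrite /lor !mulNmx mxE. Qed.

Lemma lor0l w : lor 0 w = 0.
Proof. by rewrite /lor !mul0mx mxE. Qed.

Lemma lorDr u v w : lor w (u + v) = lor w u + lor w v.
Proof. by rewrite lorC lorDl !(lorC w). Qed.

Lemma lorZr a u w : lor w (a *: u) = a * lor w u.
Proof. by rewrite lorC lorZl (lorC w). Qed.

Lemma lorNr u w : lor w (- u) = - lor w u.
Proof. by rewrite lorC lorNl (lorC w). Qed.

Lemma lor0r w : lor w 0 = 0.
Proof. by rewrite lorC lor0l. Qed.

Definition lorl := (lorDl, lorZl, lorNl, lor0l).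
Definition lorr := (lorDr, lorZr, lorNr, lor0r).

Lemma lorM M u v : lorentz M -> lor (u *m M) (v *m M) = lor u v.
Proof. by move=> h; rewrite /lor trmx_mul !mulmxA -2!(mulmxA u) h. Qed.

Lemma lor_nondeg u : (forall v, lor u v = 0) -> u = 0.
Proof.
move=> h; apply/eqP; rewrite -dot_eq0 dotE; apply/eqP.
by have := h (u *m leta); rewrite /lor trmx_mul eta_tr !mulmxA -(mulmxA u) eta_sqr mulmx1.
Qed.

Lemma lorentzP M : (forall u v, lor (u *m M) (v *m M) = lor u v) -> lorentz M.
Proof.
move=> h; apply: eq_mx_rows => u; apply/eqP; rewrite -subr_eq0; apply/eqP.
set z := _ - _; have hz v : dot z v = 0.
  have -> : dot z v = lor (u *m M) (v *m M) - lor u v.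
    by rewrite /z dotBl !dotE /lor trmx_mul !mulmxA.
  by rewrite h subrr.
by apply/eqP; rewrite -dot_eq0 hz.
Qed.

Lemma lorentz1 : lorentz (1%:M : 'M[R]_(n + 1)).
Proof. by rewrite /lorentz mul1mx trmx1 mulmx1. Qed.

Lemma lorentz_mul M M' : lorentz M -> lorentz M' -> lorentz (M *m M').
Proof. by move=> h h'; apply: lorentzP => u v; rewrite !mulmxA !lorM. Qed.

Lemma mul_adj M : lorentz M -> M *m lorentz_adj M = 1%:M.
Proof. by move=> h; rewrite /lorentz_adj !mulmxA h eta_sqr. Qed.

Lemma adj_mul M : lorentz M -> lorentz_adj M *m M = 1%:M.
Proof. by move=> h; apply: mulmx1C; apply: mul_adj. Qed.

Lemma mulmx_adjK m (A : 'M[R]_(m, n + 1)) M :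
  lorentz M -> A *m lorentz_adj M *m M = A.
Proof. by move=> h; rewrite -(mulmxA A) adj_mul // mulmx1. Qed.

Lemma mulmxK_adj m (A : 'M[R]_(m, n + 1)) M :
  lorentz M -> A *m M *m lorentz_adj M = A.
Proof. by move=> h; rewrite -(mulmxA A) mul_adj // mulmx1. Qed.

Lemma lorentz_adjP M : lorentz M -> lorentz (lorentz_adj M).
Proof. by move=> h; apply: lorentzP => u v; rewrite -(lorM _ _ h) !mulmx_adjK. Qed.

Lemma lor_adj M u v : lorentz M -> lor (u *m M) v = lor u (v *m lorentz_adj M).
Proof. by move=> h; rewrite -[RHS](lorM _ _ h) mulmx_adjK. Qed.

Lemma mul_refl F u : u *m refl F = u - (2 * lor u F / lor F F) *: F.
Proof.
rewrite /refl mulmxBr mulmx1 -scalemxAr !mulmxA [u *m leta *m F^T]mx11_scalar.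
by rewrite mul_scalar_mx scalerA -/(lor u F); congr (_ - _ *: _); rewrite mulrAC.
Qed.

Lemma lorentz_refl F : lor F F != 0 -> lorentz (refl F).
Proof.
move=> h; apply: lorentzP => u v; rewrite !mul_refl !lorl !lorr (lorC F v).
by field.
Qed.

Lemma refl_refl F : lor F F != 0 -> refl F *m refl F = 1%:M.
Proof.
move=> h; apply: eq_mx_rows => u; rewrite mulmx1 mulmxA !mul_refl !lorl.
rewrite -addrA -opprD -scalerDl -[RHS]subr0; congr (_ - _).
by rewrite -[RHS](scale0r F); congr (_ *: _); field.
Qed.

Lemma refl_scale c F : c != 0 -> refl (c *: F) = refl F.
Proof.
(* For an isotropic [F] both sides are the identity, since the inverse of 0 is 0. *)
move=> c0; have [h|h] := eqVneq (lor F F) 0.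
  rewrite /refl !lorl !lorr h !mulr0 invr0 mulr0.
  by rewrite !scale0r.
apply: eq_mx_rows => u; rewrite !mul_refl !lorl !lorr scalerA.
by congr (_ - _ *: _); field; apply/andP.
Qed.

Lemma refl_mul F M : lorentz M ->
  refl (F *m M) = lorentz_adj M *m refl F *m M.
Proof.
move=> h; apply: eq_mx_rows => u.
rewrite (mulmxA u) (mulmxA u) !mul_refl mulmxBl mulmx_adjK // -scalemxAl lorM //.
by rewrite (lorC u) lor_adj // (lorC F).
Qed.

End Lorentz.

(** * Balls and Moebius transformations in the Lorentz model *)

Definition dotl {R : realType} {n : nat} := (@dotDl R n, @dotZl R n, @dotNl R n, @dot0l R n).
Definition dotr {R : realType} {n : nat} := (@dotDr R n, @dotZr R n, @dotNr R n, @dot0r R n).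

(** Coordinates adapted to the stereographic projection: [v] is horizontal, [a] is the coordinate
    along the pole and [t] the time. *)
Definition lvec {R : realType} {d : nat} (v : 'rV[R]_d) (a t : R) :
  'rV[R]_(d + 1 + 1) := row_mx (row_mx v a%:M) t%:M.

(* The point at infinity is the north pole of the sphere. *)
Definition npt {R : realType} {d : nat} (x : hatR R d) : 'rV[R]_(d + 1 + 1) :=
  match x with
  | None => lvec 0 1 1
  | Some x => lvec (2 *: x) (dot x x - 1) (dot x x + 1)
  end.

(** Only the ray of [V] matters, and [- V] bounds the closed complementary ball. For a unit [V] this
    is the ball with Lorentz normal [V]. *)
Definition bset {R : realType} {d : nat} (V : 'rV[R]_(d + 1 + 1)) :
  set (hatR R d) := [set x | 0 <= lor V (npt x)].

Definition curv {R : realType} {d : nat} (V : 'rV[R]_(d + 1 + 1)) : R :=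
  - lor V (npt None).

(** The classical inversive coordinates of a sphere, normalised so that the product with
    [npt (Some x)] is [(r ^+ 2 - dot (x - c) (x - c)) / r], which is nonnegative exactly on the
    ball. *)
Definition sphere_vec {R : realType} {d : nat} (c : 'rV[R]_d) (r : R) :=
  lvec (r^-1 *: c) ((dot c c - r ^+ 2 - 1) / (2 * r))
                   ((dot c c - r ^+ 2 + 1) / (2 * r)).

Definition plane_vec {R : realType} {d : nat} (n : 'rV[R]_d) (a : R) :=
  lvec (- n) (- a) (- a).

(** A point is a null ray, so the factor [c] depends on the point. Its positivity excludes [- M],
    which would exchange each ball with its complement. *)
Definition mlift {R : realType} {d : nat} (g : hatR R d -> hatR R d)
    (M : 'M[R]_(d + 1 + 1)) : Prop :=
  lorentz M /\ forall x, exists2 c, 0 < c & npt x *m M = c *: npt (g x).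

Section Model.
Context {R : realType} {d : nat}.
Implicit Types (v c n : 'rV[R]_d) (V F : 'rV[R]_(d + 1 + 1)) (a t r : R).
Implicit Types (g h s : hatR R d -> hatR R d) (M : 'M[R]_(d + 1 + 1)).

Lemma lvecP V : exists v a t, V = lvec v a t.
Proof.
exists (lsubmx (lsubmx V)), (rsubmx (lsubmx V) 0 0), (rsubmx V 0 0).
by rewrite /lvec -!mx11_scalar !hsubmxK.
Qed.

Lemma lvecD v v' a a' t t' :
  lvec v a t + lvec v' a' t' = lvec (v + v') (a + a') (t + t').
Proof. by rewrite /lvec !add_row_mx -!raddfD. Qed.

Lemma lvecZ k v a t : k *: lvec v a t = lvec (k *: v) (k * a) (k * t).
Proof. by rewrite /lvec !scale_row_mx !scale_scalar_mx. Qed.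

Lemma lvecN v a t : - lvec v a t = lvec (- v) (- a) (- t).
Proof. by rewrite -scaleN1r lvecZ scaleN1r !mulN1r. Qed.

Lemma lvecB v v' a a' t t' :
  lvec v a t - lvec v' a' t' = lvec (v - v') (a - a') (t - t').
Proof. by rewrite lvecN lvecD. Qed.

Lemma lvec_inj v v' a a' t t' :
  lvec v a t = lvec v' a' t' -> [/\ v = v', a = a' & t = t'].
Proof.
move=> /eq_row_mx[/eq_row_mx[-> /(congr1 (fun A : 'M[R]_1 => A 0 0))]].
by rewrite !mxE /= !mulr1n => -> /(congr1 (fun A : 'M[R]_1 => A 0 0)); rewrite !mxE /= !mulr1n => ->.
Qed.

Lemma lor_lvec v v' a a' t t' :
  lor (lvec v a t) (lvec v' a' t') = dot v v' + a * a' - t * t'.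
Proof. by rewrite /lvec lorE dot_row_mx dot_scalar_mx. Qed.

Lemma curv_lvec v a t : curv (lvec v a t) = t - a.
Proof. by rewrite /curv lor_lvec dot0r; ring. Qed.

Lemma curvD V V' : curv (V + V') = curv V + curv V'.
Proof. by rewrite /curv lorDl opprD. Qed.

Lemma curvZ k V : curv (k *: V) = k * curv V.
Proof. by rewrite /curv lorZl mulrN. Qed.

Lemma curvN V : curv (- V) = - curv V.
Proof. by rewrite /curv lorNl. Qed.

Lemma lor_npt_None v a t : lor (lvec v a t) (npt None) = a - t.
Proof. by rewrite lor_lvec dot0r; ring. Qed.

Lemma lor_npt_Some v a t x :
  lor (lvec v a t) (npt (Some x)) = (a - t) * dot x x + 2 * dot v x - (a + t).
Proof. by rewrite lor_lvec !dotr; ring. Qed.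

Lemma npt_inj (x y : hatR R d) k : npt x = k *: npt y -> x = y.
Proof.
case: x y => [x|] [y|] /=; rewrite lvecZ => /lvec_inj[e1 e2 e3] //.
- have k1 : k = 1 by clear e1; lra.
  by move: e1; rewrite k1 scale1r => /scalerI -> //; rewrite pnatr_eq0.
- by exfalso; clear e1; lra.
- by exfalso; clear e1; have k0 : k = 0 by [lra]; move: e2; rewrite k0 mul0r; lra.
Qed.

Lemma bsetZ k V : 0 < k -> bset (k *: V) = bset V.
Proof. by move=> k0; apply/funext => x; rewrite /bset /= lorZl pmulr_rge0. Qed.

Lemma lor_sphere_vec c r x : 0 < r ->
  lor (sphere_vec c r) (npt (Some x)) = (r ^+ 2 - dot (x - c) (x - c)) / r.
Proof.
move=> r0; rewrite lor_npt_Some !(dotl, dotr) (dotC c x); field.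
by rewrite gt_eqF.
Qed.

Lemma curv_sphere_vec c r : 0 < r -> curv (sphere_vec c r) = r^-1.
Proof. by move=> r0; rewrite curv_lvec; field; rewrite gt_eqF. Qed.

Lemma sphere_vec_unit c r : 0 < r -> lor (sphere_vec c r) (sphere_vec c r) = 1.
Proof. by move=> r0; rewrite lor_lvec !(dotl, dotr); field; rewrite gt_eqF. Qed.

Lemma lor_plane_vec n a x :
  lor (plane_vec n a) (npt (Some x)) = 2 * (a - dot n x).
Proof. by rewrite lor_npt_Some !dotl; ring. Qed.

Lemma curv_plane_vec n a : curv (plane_vec n a) = 0.
Proof. by rewrite curv_lvec subrr. Qed.

Lemma plane_vec_norm n a : lor (plane_vec n a) (plane_vec n a) = dot n n.
Proof. by rewrite lor_lvec !(dotl, dotr); ring. Qed.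

Lemma bset_sphere_vec c r : 0 < r -> bset (sphere_vec c r) = inner_ball c r.
Proof.
move=> r0; apply/seteqP; split=> [[x|]|_ [x /= hx <-]] /=; rewrite /bset /=.
- rewrite lor_sphere_vec // pmulr_lge0 ?invr_gt0 // subr_ge0 => h.
  by exists x => //=; rewrite enorm_le // ltW.
- have := curv_sphere_vec c r0; rewrite /curv => e h.
  by have := invr_gt0 r; rewrite r0 -e => /esym; lra.
- rewrite lor_sphere_vec // pmulr_lge0 ?invr_gt0 // subr_ge0.
  by rewrite -enorm_le // ltW.
Qed.

Lemma bset_sphere_vecN c r : 0 < r -> bset (- sphere_vec c r) = outer_ball c r.
Proof.
move=> r0; apply/seteqP; split=> [[x|]|_ [->|[x /= hx <-]]] /=; rewrite /bset /=.
- rewrite lorNl lor_sphere_vec // -mulNr pmulr_lge0 ?invr_gt0 // oppr_ge0 subr_le0 => h.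
  by right; exists x => //=; rewrite le_enorm // ltW.
- by left.
- by have := curv_sphere_vec c r0; rewrite /curv lorNl => ->; rewrite invr_ge0 ltW.
- rewrite lorNl lor_sphere_vec // -mulNr pmulr_lge0 ?invr_gt0 // oppr_ge0 subr_le0.
  by rewrite -le_enorm // ltW.
Qed.

Lemma bset_plane_vec n a : bset (plane_vec n a) = half_space n a.
Proof.
apply/seteqP; split=> [[x|]|_ [->|[x /= hx <-]]] /=; rewrite /bset /=.
- by rewrite lor_plane_vec => h; right; exists x => //=; lra.
- by left.
- by rewrite lor_npt_None; lra.
- by rewrite lor_plane_vec; lra.
Qed.

(** The sign of the curvature [t - a] decides. When it is positive, its inverse is the radius and
    [v] divided by it the centre; a negative curvature is treated by passing to [- V]; curvature 0
    leaves a hyperplane with unit normal. *)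
Lemma unit_vec_cases V : lor V V = 1 ->
  [\/ exists2 cr : 'rV[R]_d * R, 0 < cr.2 & V = sphere_vec cr.1 cr.2,
      exists2 cr : 'rV[R]_d * R, 0 < cr.2 & V = - sphere_vec cr.1 cr.2 |
      exists2 na : 'rV[R]_d * R, dot na.1 na.1 = 1 & V = plane_vec na.1 na.2].
Proof.
have pos W : lor W W = 1 -> 0 < curv W ->
    exists2 cr : 'rV[R]_d * R, 0 < cr.2 & W = sphere_vec cr.1 cr.2.
  have [v [a [t ->]]] := lvecP W; rewrite lor_lvec curv_lvec => h k0.
  exists ((t - a)^-1 *: v, (t - a)^-1); rewrite /= ?invr_gt0 //.
  have k1 : t - a != 0 by rewrite gt_eqF.
  have e : dot v v = 1 - a * a + t * t by lra.
  rewrite /sphere_vec invrK scalerA divff // scale1r !(dotl, dotr) e.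
  by congr lvec; field.
move=> h; have [k0|k0|k0] := ltrgt0P (curv V).
- by constructor 1; apply: pos.
- constructor 2; have [||cr r0 e] := pos (- V).
  + by rewrite lorNl lorNr opprK.
  + by rewrite curvN oppr_gt0.
  + by exists cr => //; rewrite -e opprK.
- constructor 3; move: h k0; have [v [a [t ->]]] := lvecP V.
  rewrite lor_lvec curv_lvec => h k0; have e : t = a by lra.
  exists (- v, - a); rewrite /= ?(dotl, dotr) ?opprK; first by move: h; rewrite e; lra.
  by rewrite /plane_vec !opprK e.
Qed.

Lemma unit_direction (d_gt0 : (0 < d)%N) (u : 'rV[R]_d) :
  exists2 e : 'rV[R]_d, dot e e = 1 & u = enorm u *: e.
Proof.
have [->|u0] := eqVneq u 0.
  exists (delta_mx 0 (Ordinal d_gt0)).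
    rewrite /dot (bigD1 (Ordinal d_gt0)) //= big1 => [|i hi]; rewrite !mxE.
      by rewrite eqxx mulr1 addr0.
    by rewrite (negbTE hi) mulr0.
  by rewrite /enorm dot0l sqrtr0 scale0r.
have n0 : enorm u != 0 by rewrite -sqrf_eq0 enorm_sqr dot_eq0.
exists ((enorm u)^-1 *: u); last by rewrite scalerA divff // scale1r.
by rewrite !(dotl, dotr) -enorm_sqr; field.
Qed.

Lemma inner_ball_sub (d_gt0 : (0 < d)%N) c r c' r' : 0 < r -> 0 < r' ->
  inner_ball c r `<=` inner_ball c' r' -> enorm (c - c') + r <= r'.
Proof.
move=> r0 r0' h; have [e e1 ec] := unit_direction d_gt0 (c - c').
(* The point of the first ball farthest from [c'], on the line of centres. *)
have := h (Some (c + r *: e)); case.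
  exists (c + r *: e) => //=; rewrite enorm_le ?(ltW r0) //.
  by rewrite addrAC subrr add0r !(dotl, dotr) e1 mulr1 -expr2.
move=> y /= hy [ey]; move: hy; rewrite ey enorm_le ?(ltW r0') // addrAC ec.
rewrite -scalerDl !(dotl, dotr) e1 mulr1 -expr2 ler_sqr ?nnegrE ?(ltW r0') //.
  by rewrite -ec.
by apply: addr_ge0; [exact: enorm_ge0|exact: ltW].
Qed.

Lemma outer_ball_sub (d_gt0 : (0 < d)%N) c r c' r' : 0 < r -> 0 < r' ->
  outer_ball c r `<=` outer_ball c' r' -> enorm (c' - c) + r' <= r.
Proof.
move=> r0 r0' h; have [e e1 ec] := unit_direction d_gt0 (c' - c).
rewrite leNgt; apply/negP => hr; set k := enorm _ in hr ec.
have k0 : 0 <= k by apply: enorm_ge0.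
(* A distance [s] for which [c' + s *: e] is removed from the second set, being at distance less
   than [r'] from [c'], but belongs to the first, being at distance [k + s >= r] from [c]. *)
have [s [s0 sr ks]] : exists s : R, [/\ 0 <= s, s < r' & r <= k + s].
  have [rk|rk] := leP r k; first by exists 0; split => //; lra.
  by exists (r - k); split; lra.
have := h (Some (c' + s *: e)); case => //.
  right; exists (c' + s *: e) => //=; rewrite le_enorm ?(ltW r0) //.
  by rewrite addrAC ec -scalerDl !(dotl, dotr) e1 mulr1 -expr2 ler_sqr ?nnegrE //; lra.
move=> [y /= hy [ey]]; move: hy; rewrite ey le_enorm ?(ltW r0') //.
rewrite addrAC subrr add0r !(dotl, dotr) e1 mulr1 -expr2 ler_sqr ?nnegrE //; lra.
Qed.

Lemma half_space_sub n a n' a' : dot n n = 1 -> dot n' n' = 1 ->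
  half_space n a `<=` half_space n' a' -> n = n' /\ a <= a'.
Proof.
move=> n1 n1' h.
have key x : dot n x <= a -> dot n' x <= a'.
  move=> hx; have := h (Some x); case => //; first by right; exists x.
  by move=> [y /= hy [<-]].
have n'E : n' = dot n n' *: n.
  apply/eqP; rewrite -subr_eq0 -dot_eq0; apply/eqP.
  have zn : dot n (n' - dot n n' *: n) = 0 by rewrite !dotr n1 mulr1 subrr.
  have zz : dot n' (n' - dot n n' *: n) =
      dot (n' - dot n n' *: n) (n' - dot n n' *: n).
    by rewrite [RHS]dotBl dotZl zn mulr0 subr0.
  move: (n' - _) zn zz => z zn zz.
  apply/eqP; rewrite eq_le dot_ge0 andbT leNgt; apply/negP => z0.
  (* Moving along [z], the part of [n'] orthogonal to [n], stays on the boundary of the first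
     half-space; the coefficient makes [dot n' x] equal to [a' + 1]. *)
  have := key (a *: n + ((a' - a * dot n' n + 1) / dot z z) *: z).
  rewrite !dotr n1 zn zz mulr0 addr0 mulr1 lexx => /(_ isT).
  by rewrite divfK ?gt_eqF //; lra.
have nn : dot n n' ^+ 2 = 1 by rewrite expr2 -{1}n1' {3}n'E dotZl.
have nn1 : dot n n' = 1.
  have [//|nn1] : dot n n' = 1 \/ dot n n' = -1.
    by move/eqP: nn; rewrite sqrf_eq1 => /orP[] /eqP; [left|right].
  (* With [n' = - n], a point far enough along [- n] satisfies the first inequality and violates the
     second. *)
  exfalso; have := key ((a - `|a'| - `|a| - 1) *: n).
  rewrite !dotr n1 (dotC n') nn1 mulr1 mulrN1.
  have := ler_norm a'; have := ler_norm a; have := normr_ge0 a'; have := normr_ge0 a.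
  by move=> h1 h2 h3 h4 /(_ ltac:(lra)); lra.
move: n'E; rewrite nn1 scale1r => e; split => //.
by have := key (a *: n); rewrite !dotr e n1 mulr1 lexx => /(_ isT).
Qed.

Lemma outer_not_sub_half c r n a : 0 < r -> dot n n = 1 ->
  ~ outer_ball c r `<=` half_space n a.
Proof.
move=> r0 n1 h.
have [s [sr sa]] : exists s : R, r <= s /\ a - dot n c < s.
  exists (r + `|a - dot n c| + 1).
  by have := normr_ge0 (a - dot n c); have := ler_norm (a - dot n c); split; lra.
have := h (Some (c + s *: n)); case => //.
  right; exists (c + s *: n) => //=; rewrite le_enorm ?(ltW r0) //.
  by rewrite addrAC subrr add0r !(dotl, dotr) n1 mulr1 -expr2 ler_sqr ?nnegrE //; lra.
move=> [y /= hy [ey]]; move: hy; rewrite ey !dotr n1 mulr1; lra.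
Qed.

(** The point at infinity separates inner balls from the other two kinds, and an outer ball is too
    large for a half-space. Within one kind, the two inclusions give opposite inequalities between
    radii or offsets. A positive dimension is essential: it supplies the directions in which balls
    are compared. *)
Lemma bset_inj (d_gt0 : (0 < d)%N) V V' :
  lor V V = 1 -> lor V' V' = 1 -> bset V = bset V' -> V = V'.
Proof.
have inner_outer c r c' r' : 0 < r -> 0 < r' -> inner_ball c r = outer_ball c' r' -> False.
  move=> r0 r0' e; have : (outer_ball c' r' : set (hatR R d)) None by left.
  by rewrite -e => -[].
have inner_half c r n a : 0 < r -> inner_ball c r = half_space n a -> False.
  move=> r0 e; have : (half_space n a : set (hatR R d)) None by left.
  by rewrite -e => -[].
move=> /unit_vec_cases[] [[c r] /= r0 ->] /unit_vec_cases[] [[c' r'] /= r0' ->];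
  rewrite ?bset_sphere_vec ?bset_sphere_vecN ?bset_plane_vec // => e.
- have [h1 h2] : inner_ball c r `<=` inner_ball c' r' /\
      inner_ball c' r' `<=` inner_ball c r by rewrite e; split.
  have := inner_ball_sub d_gt0 r0 r0' h1; have := inner_ball_sub d_gt0 r0' r0 h2.
  have := enorm_ge0 (c - c'); have := enorm_ge0 (c' - c) => k k' i i'.
  have /eqP : enorm (c - c') = 0 by lra.
  rewrite -sqrf_eq0 enorm_sqr dot_eq0 subr_eq0 => /eqP ->; congr sphere_vec; lra.
- by have := inner_outer _ _ _ _ r0 r0' e.
- by have := inner_half _ _ _ _ r0 e.
- by have := inner_outer _ _ _ _ r0' r0 (esym e).
- have [h1 h2] : outer_ball c r `<=` outer_ball c' r' /\
      outer_ball c' r' `<=` outer_ball c r by rewrite e; split.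
  have := outer_ball_sub d_gt0 r0 r0' h1; have := outer_ball_sub d_gt0 r0' r0 h2.
  have := enorm_ge0 (c - c'); have := enorm_ge0 (c' - c) => k k' i i'.
  have /eqP : enorm (c - c') = 0 by lra.
  rewrite -sqrf_eq0 enorm_sqr dot_eq0 subr_eq0 => /eqP ->; congr (- sphere_vec _ _); lra.
- by exfalso; apply: (@outer_not_sub_half c r c' r') => //; rewrite e.
- by have := inner_half _ _ _ _ r0' (esym e).
- by exfalso; apply: (@outer_not_sub_half c' r' c r) => //; rewrite e.
- have [h1 h2] : half_space c r `<=` half_space c' r' /\
      half_space c' r' `<=` half_space c r by rewrite e; split.
  have [-> ?] := half_space_sub r0 r0' h1; have [_ ?] := half_space_sub r0' r0 h2.
  by congr plane_vec; lra.
Qed.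

Lemma normalize F : 0 < lor F F ->
  exists2 k : R, 0 < k & lor (k *: F) (k *: F) = 1.
Proof.
move=> h; exists (Num.sqrt (lor F F))^-1; first by rewrite invr_gt0 sqrtr_gt0.
rewrite lorZl lorZr mulrA -expr2 exprVn sqr_sqrtr ?ltW //.
by rewrite mulVf // gt_eqF.
Qed.

Lemma half_spaceZ k n a : 0 < k -> half_space (k *: n) (k * a) = half_space n a.
Proof.
move=> k0; rewrite -!bset_plane_vec -(bsetZ (plane_vec n a) k0); congr bset.
by rewrite lvecZ scalerN !mulrN.
Qed.

Lemma normal_normalize n : n != 0 ->
  exists2 k : R, 0 < k & dot (k *: n) (k *: n) = 1.
Proof.
move=> h; exists (enorm n)^-1; first by rewrite invr_gt0 sqrtr_gt0 dot_gt0.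
by rewrite dotZl dotZr mulrA -expr2 exprVn enorm_sqr mulVf // dot_eq0.
Qed.

Lemma has_curvature_bset (d_gt0 : (0 < d)%N) V k : lor V V = 1 ->
  has_curvature (bset V) k <-> k = curv V.
Proof.
move=> V1; split.
  case=> [c r r0|c r r0|n a n0].
  - rewrite -bset_sphere_vec // => /bset_inj -> //; first by rewrite curv_sphere_vec.
    by rewrite sphere_vec_unit.
  - rewrite -bset_sphere_vecN // => /bset_inj -> //; first by rewrite curvN curv_sphere_vec.
    by rewrite lorNl lorNr opprK sphere_vec_unit.
  - have [k0 k0p e] := normal_normalize n0.
    rewrite -(half_spaceZ n a k0p) -bset_plane_vec => /bset_inj -> //.
      by rewrite curv_plane_vec.
    by rewrite plane_vec_norm.
move=> ->; case: (unit_vec_cases V1) => [] [[c r] /= r0 ->].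
- rewrite curv_sphere_vec // bset_sphere_vec //; exact: InnerCurvature.
- rewrite curvN curv_sphere_vec // bset_sphere_vecN //; exact: OuterCurvature.
- rewrite curv_plane_vec bset_plane_vec; apply: HalfSpaceCurvature erefl.
  by rewrite -dot_eq0 r0 oner_eq0.
Qed.

Lemma refl_sphere_center c r : 0 < r ->
  npt (Some c) *m refl (sphere_vec c r) = r ^+ 2 *: npt None.
Proof.
move=> r0; have r1 : r != 0 by rewrite gt_eqF.
rewrite mul_refl sphere_vec_unit // divr1 lorC lor_sphere_vec // subrr dot0l subr0.
rewrite /npt !lvecZ lvecB; congr lvec; [|by field|by field].
by apply/rowP => i; rewrite !mxE; field.
Qed.

Lemma refl_sphere_infty c r : 0 < r ->
  npt None *m refl (sphere_vec c r) = (r ^+ 2)^-1 *: npt (Some c).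
Proof.
move=> r0; have r1 : r != 0 by rewrite gt_eqF.
have := curv_sphere_vec c r0; rewrite /curv => /eqP; rewrite eqr_oppLR => /eqP h.
rewrite mul_refl sphere_vec_unit // divr1 lorC h.
rewrite /npt !lvecZ lvecB; congr lvec; [|by field|by field].
by apply/rowP => i; rewrite !mxE; field.
Qed.

(** An inversion is the Lorentz reflection in the normal of its sphere. The null vector of [x] is
    scaled by the squared distance to the centre over [r ^+ 2]; the centre and infinity are
    exchanged and need separate factors. *)
Lemma lift_sphere_inversion c r : 0 < r ->
  mlift (sphere_inversion c r) (refl (sphere_vec c r)).
Proof.
move=> r0; have r1 : r != 0 by rewrite gt_eqF.
have h1 := sphere_vec_unit c r0.
split; first by apply: lorentz_refl; rewrite h1 oner_eq0.
case=> [x|]; last first.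
  exists (r ^+ 2)^-1; first by rewrite invr_gt0 exprn_gt0.
  exact: refl_sphere_infty.
rewrite /sphere_inversion; case: eqVneq => [->|xc].
  by exists (r ^+ 2); [rewrite exprn_gt0|apply: refl_sphere_center].
rewrite mul_refl h1 divr1 (lorC (npt _)) lor_sphere_vec //.
have D0 : 0 < dot (x - c) (x - c) by rewrite dot_gt0 subr_eq0.
exists (dot (x - c) (x - c) / r ^+ 2); first by rewrite divr_gt0 // exprn_gt0.
have DE : dot (x - c) (x - c) = dot x x - 2 * dot x c + dot c c.
  by rewrite !(dotl, dotr) (dotC c x); ring.
have D1 : dot x x - 2 * dot x c + dot c c != 0 by rewrite -DE gt_eqF.
rewrite DE /npt !lvecZ lvecB; congr lvec.
- by apply/rowP => i; rewrite !mxE; field; rewrite D1.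
- by rewrite !(dotl, dotr) (dotC c x); field; rewrite D1.
- by rewrite !(dotl, dotr) (dotC c x); field; rewrite D1.
Qed.

Lemma lift_hyperplane_reflection n a : n != 0 ->
  mlift (hyperplane_reflection n a) (refl (plane_vec n a)).
Proof.
move=> n0; have h1 := plane_vec_norm n a.
have n1 : dot n n != 0 by rewrite dot_eq0.
split; first by apply: lorentz_refl; rewrite h1.
case=> [x|]; rewrite mul_refl h1 (lorC (npt _)); exists 1; rewrite ?ltr01 // scale1r.
  rewrite lor_plane_vec /npt /hyperplane_reflection lvecZ lvecB; congr lvec.
  - by apply/rowP => i; rewrite !mxE; field.
  - by rewrite !(dotl, dotr) (dotC x n); field.
  - by rewrite !(dotl, dotr) (dotC x n); field.
by rewrite lor_npt_None subrr mulr0 mul0r scale0r subr0.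
Qed.

(** The centre and radius, or the normal and offset, hidden in [boundary_inversion] come from some
    presentation of the ball. By [bset_inj] the corresponding vector agrees with [F] up to a nonzero
    factor, which [refl] ignores. *)
Lemma boundary_inversion_lift (d_gt0 : (0 < d)%N) F s : 0 < lor F F ->
  boundary_inversion (bset F) s -> mlift s (refl F).
Proof.
move=> /normalize[k k0 k1]; rewrite -(bsetZ F k0) -(@refl_scale _ _ k F) ?gt_eqF //.
move: (k *: F) k1 => V V1; case=> [c r r0|c r r0|n a n0].
- rewrite -bset_sphere_vec // => /bset_inj -> //; last by rewrite sphere_vec_unit.
  exact: lift_sphere_inversion.
- rewrite -bset_sphere_vecN // => /bset_inj -> //; last first.
    by rewrite lorNl lorNr opprK sphere_vec_unit.
  rewrite -scaleN1r refl_scale ?oppr_eq0 ?oner_eq0 //; exact: lift_sphere_inversion.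
- have [k' k0' e] := normal_normalize n0.
  rewrite -(half_spaceZ n a k0') -bset_plane_vec => /bset_inj -> //.
    have -> : plane_vec (k' *: n) (k' * a) = k' *: plane_vec n a.
      by rewrite lvecZ scalerN !mulrN.
    rewrite refl_scale ?gt_eqF //; exact: lift_hyperplane_reflection.
  by rewrite plane_vec_norm.
Qed.

Lemma boundary_inversion_exists F : 0 < lor F F ->
  exists s, boundary_inversion (bset F) s.
Proof.
move=> /normalize[k k0]; rewrite -(bsetZ F k0) => V1.
case: (unit_vec_cases V1) => [] [[c r] /= r0 ->].
- exists (sphere_inversion c r); apply: InnerInversion => //; exact: bset_sphere_vec.
- exists (sphere_inversion c r); apply: OuterInversion => //; exact: bset_sphere_vecN.
- exists (hyperplane_reflection c r); apply: HalfSpaceInversion.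
    by rewrite -dot_eq0 r0 oner_eq0.
  exact: bset_plane_vec.
Qed.

Lemma lift_id : mlift (id : hatR R d -> hatR R d) 1%:M.
Proof.
by split=> [|x]; [exact: lorentz1|exists 1; rewrite ?ltr01 // mulmx1 scale1r].
Qed.

Lemma lift_comp g h M M' : mlift g M -> mlift h M' -> mlift (g \o h) (M' *m M).
Proof.
move=> [lM hM] [lM' hM']; split=> [|x]; first exact: lorentz_mul.
have [k k0 e] := hM' x; have [k' k0' e'] := hM (h x).
by exists (k * k'); rewrite ?mulr_gt0 // mulmxA e -scalemxAl e' scalerA.
Qed.

Lemma lift_fun_uniq g h M : mlift g M -> mlift h M -> g = h.
Proof.
move=> [_ hg] [_ hh]; apply/funext => x.
have [k k0 e] := hg x; have [k' k0' e'] := hh x.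
apply: (@npt_inj _ _ (k^-1 * k')).
by rewrite -scalerA -e' e scalerA mulVf ?scale1r // gt_eqF.
Qed.

Lemma lift_cancel g h M M' : mlift g M -> mlift h M' -> M *m M' = 1%:M -> cancel g h.
Proof.
move=> hg hh e x; have := lift_comp hh hg; rewrite e => /lift_fun_uniq/(_ lift_id) e'.
by rewrite -[LHS]/((h \o g) x) e'.
Qed.

Lemma lift_image g h M V : mlift g M -> cancel h g -> g @` bset V = bset (V *m M).
Proof.
move=> [lM hM] hg; apply/seteqP; split=> [_ [x /= hx <-]|x /= hx].
  have [k k0 e] := hM x; move: hx; rewrite /bset /= -(lorM _ _ lM) e lorZr.
  by rewrite pmulr_rge0.
exists (h x); rewrite ?hg //; have [k k0 e] := hM (h x).
by rewrite /bset /= -(lorM _ _ lM) e lorZr hg pmulr_rge0.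
Qed.

(** Null rays fix images only up to factors, whereas a unit space-like vector is recovered exactly
    from its ball. So [g] determines the matrix on space-like vectors, and these span. *)
Lemma lift_mx_uniq (d_gt0 : (0 < d)%N) g h M M' :
  cancel h g -> mlift g M -> mlift g M' -> M = M'.
Proof.
move=> hg h1 h2.
have pos F : 0 < lor F F -> F *m M = F *m M'.
  move=> /normalize[k k0 k1].
  have : (k *: F) *m M = (k *: F) *m M'.
    apply: (bset_inj d_gt0); rewrite ?(lorM _ _ h1.1) ?(lorM _ _ h2.1) //.
    by rewrite -(lift_image _ h1 hg) -(lift_image _ h2 hg).
  by rewrite -!scalemxAl => /scalerI -> //; rewrite gt_eqF.
apply: eq_mx_rows => u; have [v [a [t ->]]] := lvecP u.
have e1 : lvec 0 1 0 *m M = lvec 0 1 0 *m M' :> 'rV_(d + 1 + 1).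
  by apply: pos; rewrite lor_lvec dot0l; lra.
(* Raising the spatial coordinate to [|t| + 1] makes any vector space-like; the correction is a
   multiple of the space-like vector of [e1]. *)
have e2 : lvec v (`|t| + 1) t *m M = lvec v (`|t| + 1) t *m M'.
  apply: pos; rewrite lor_lvec; have := dot_ge0 v; have := normr_ge0 t.
  have e : `|t| * `|t| = t * t by rewrite -!expr2 real_normK ?num_real.
  by rewrite mulrDl !mulrDr e; lra.
have -> : lvec v a t = lvec v (`|t| + 1) t - (`|t| + 1 - a) *: lvec 0 1 0.
  by rewrite lvecZ lvecB scaler0 !subr0 mulr0 subr0; congr lvec; ring.
by rewrite !mulmxBl e2 -!scalemxAl e1.
Qed.

End Model.

(** * Groups generated by inversions *)

Lemma generated_group_lift (R : realType) (d : nat)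
    (S : set (hatR R d -> hatR R d))
    (Pm : (hatR R d -> hatR R d) -> 'M[R]_(d + 1 + 1) -> Prop) :
  Pm id 1%:M ->
  (forall g h M M', Pm g M -> Pm h M' -> Pm (g \o h) (M' *m M)) ->
  (forall s, S s -> exists M, [/\ mlift s M, M *m M = 1%:M & Pm s M]) ->
  forall g, generated_group S g ->
  exists M h M', [/\ mlift g M, mlift h M', cancel g h, cancel h g & Pm g M].
Proof.
move=> P1 PM PS.
pose G := [set g | exists M h M', [/\ mlift g M, mlift h M', M *m M' = 1%:M,
                                    M' *m M = 1%:M & Pm g M /\ Pm h M']].
move=> g /(_ G)[].
- split.
  + by exists 1%:M, id, 1%:M; rewrite mulmx1; split=> //; apply: lift_id.
  + move=> g1 g2 [M [h [M' [a1 a2 a3 a4 [a5 a6]]]]] [N [k [N' [b1 b2 b3 b4 [b5 b6]]]]].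
    exists (N *m M), (k \o h), (M' *m N'); split.
    * exact: lift_comp.
    * exact: lift_comp.
    * by rewrite !mulmxA -(mulmxA N) a3 mulmx1.
    * by rewrite !mulmxA -(mulmxA M') b4 mulmx1.
    * by split; apply: PM.
  + move=> g1 [M [h [M' [a1 a2 a3 a4 [a5 a6]]]]]; exists h.
      by exists M', g1, M.
    by split; [apply: lift_cancel a1 a2 a3|apply: lift_cancel a2 a1 a4].
- move=> s /PS[M [h1 h2 h3]]; exists M, s, M; split=> //.
- move=> M [h [M' [a1 a2 a3 a4 [a5 a6]]]]; exists M, h, M'; split=> //.
    exact: lift_cancel a1 a2 a3.
  exact: lift_cancel a2 a1 a4.
Qed.

Lemma generated_group_inv {T : Type} (S : set (T -> T)) g h :
  generated_group S g -> cancel g h -> cancel h g -> generated_group S h.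
Proof.
move=> gS gh hg G GG SG; have [_ _ /(_ g (gS G GG SG))[h' Gh' [gh' hg']]] := GG.
by rewrite (_ : h = h') //; apply/funext => x; rewrite -[in RHS](hg x) gh'.
Qed.

Lemma generated_group_id {T : Type} (S : set (T -> T)) : generated_group S id.
Proof. by move=> G []. Qed.

Lemma generated_group_comp {T : Type} (S : set (T -> T)) g h :
  generated_group S g -> generated_group S h -> generated_group S (g \o h).
Proof.
by move=> hg hh G GG SG; case: (GG) => _ + _; apply; [apply: hg|apply: hh].
Qed.

Lemma generated_group_gen {T : Type} (S : set (T -> T)) : S `<=` generated_group S.
Proof. by move=> s Ss G _; apply. Qed.

(** * Caps *)

(** The cap seen from [v] is cut out by the polar hyperplane of [v]. *)
Lemma visible_capE (R : realType) n (v x : 'rV[R]_n) : 1 < dot v v ->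
  visible_cap v x <-> dot x x = 1 /\ 1 <= dot v x.
Proof.
move=> v1; rewrite /visible_cap /=; split=> -[].
  move=> /enorm_eq1 x1 h; split=> //; rewrite leNgt; apply/negP => c1.
  have D0 : 0 < dot v v - 2 * dot v x + 1.
    have := dot_ge0 (v - x); rewrite !(dotl, dotr) x1 (dotC x v) => ?; lra.
  set D := dot v v - 2 * dot v x + 1 in D0.
  (* The combination [s *: v + (1 - s) *: x] is the point of the line nearest to the origin: its
     squared norm is [1 + 2 * s * (dot v x - 1) + s ^+ 2 * D], which falls below 1 there. *)
  have [s [s0 s1 sD]] : exists s : R, [/\ 0 < s, s <= 1 & s * D = 1 - dot v x].
    exists ((1 - dot v x) / D); split; last by rewrite divfK // gt_eqF.
      by rewrite divr_gt0 // subr_gt0.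
    by rewrite ler_pdivrMr // mul1r /D; lra.
  have /h : 0 <= 1 - s < 1 by apply/andP; split; lra.
  rewrite lt_enorm // !(dotl, dotr) x1 (dotC x v) expr1n subKr => h1.
  have : s * (s * D + 2 * dot v x - 2) <= 0.
    by rewrite sD pmulr_rle0 //; lra.
  by rewrite /D; nra.
move=> x1 c1; split=> [|t /andP[t0 t1]]; first exact/enorm_eq1.
rewrite lt_enorm // !(dotl, dotr) x1 (dotC x v) expr1n.
set V := dot v v in v1 *; set c := dot v x in c1 *.
have : 0 < (1 - t) * (1 - t) * (V - 1) by rewrite !mulr_gt0 //; lra.
have : 0 <= t * (1 - t) * (c - 1) by rewrite !mulr_ge0 //; lra.
by lra.
Qed.

Lemma npt_stereographic (R : realType) d (x : 'rV[R]_(d + 1)) : dot x x = 1 ->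
  exists2 k, 0 < k & npt (stereographic x) = k *: row_mx x 1%:M.
Proof.
rewrite /stereographic; set t := rsubmx x 0 0.
have -> : x = row_mx (lsubmx x) t%:M by rewrite -mx11_scalar hsubmxK.
rewrite row_mxKl; move: (lsubmx x) t => y t.
rewrite dot_row_mx dot_scalar_mx => h; case: eqVneq => [t1|t1].
  exists 1; rewrite ?ltr01 // scale1r t1; congr (row_mx (row_mx _ _) _).
  by apply/esym/eqP; rewrite -dot_eq0; move: h; rewrite t1 => h; apply/eqP; lra.
have t2 : t < 1.
  rewrite lt_neqAle t1 /=; have := dot_ge0 y; nra.
have t3 : 1 - t != 0 by rewrite subr_eq0 eq_sym.
exists (2 / (1 - t)); first by rewrite divr_gt0 // subr_gt0.
have yE : dot y y = 1 - t * t by lra.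
rewrite -[row_mx _ _]/(lvec y t 1) lvecZ /npt !(dotl, dotr) yE.
congr lvec; [|by field|by field].
by rewrite scalerA.
Qed.

Lemma stereographic_surj (R : realType) d (p : hatR R d) :
  exists2 x, dot x x = 1 & stereographic x = p.
Proof.
case: p => [y|].
  have D0 : dot y y + 1 != 0 by rewrite gt_eqF // ltr_wpDl ?dot_ge0.
  exists (row_mx ((2 / (dot y y + 1)) *: y) ((dot y y - 1) / (dot y y + 1))%:M).
    by rewrite dot_row_mx dot_scalar_mx !(dotl, dotr); field.
  rewrite /stereographic row_mxKr row_mxKl mxE eqxx mulr1n.
  have -> : 1 - (dot y y - 1) / (dot y y + 1) = 2 / (dot y y + 1) by field.
  case: eqVneq => [e|_].
    have : (dot y y - 1) / (dot y y + 1) * (dot y y + 1) = dot y y + 1 by rewrite e mul1r.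
    by rewrite divfK // => ?; exfalso; lra.
  congr Some; rewrite scalerA -[RHS]scale1r; congr (_ *: _); field.
  exact: D0.
exists (row_mx 0 1%:M); first by rewrite dot_row_mx dot_scalar_mx dot0l; lra.
by rewrite /stereographic row_mxKr mxE eqxx mulr1n eqxx.
Qed.

(** Both sides express [1 <= dot v x], because [lor (row_mx v 1) (row_mx x 1)] is [dot v x - 1] and
    [npt] of the projection of [x] is a positive multiple of [row_mx x 1]. *)
Lemma stereographic_cap (R : realType) d (v : 'rV[R]_(d + 1)) : 1 < dot v v ->
  stereographic @` visible_cap v = bset (row_mx v 1%:M).
Proof.
move=> v1; apply/seteqP; split=> [_ [x /(visible_capE _ v1)[x1 h] <-]|p].
  have [k k0 e] := npt_stereographic x1.
  by rewrite /bset /= e lorZr lorE pmulr_rge0 // subr_ge0 mulr1.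
have [x x1 <-] := stereographic_surj p; have [k k0 e] := npt_stereographic x1.
rewrite /bset /= e lorZr lorE pmulr_rge0 // subr_ge0 mulr1 => h.
by exists x => //; apply/visible_capE.
Qed.

(** * Polytopes *)

Lemma finite_small (R : realType) (T : finType) (Q : T -> R -> Prop) :
  (forall t, exists2 e, 0 < e & forall e', 0 < e' <= e -> Q t e') ->
  exists2 e, 0 < e & forall t, Q t e.
Proof.
move=> h.
have [e e0 he] : exists2 e, 0 < e &
    forall t e', t \in enum T -> 0 < e' <= e -> Q t e'.
  elim: (enum T) => [|t s [e e0 IH]]; first by exists 1.
  have [e1 e10 h1] := h t; exists (Num.min e e1); first by rewrite lt_min e0.
  move=> t' e'; rewrite inE le_min => /orP[/eqP->|ts] /and3P[e'0 ee ee1].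
    by apply: h1; rewrite e'0.
  by apply: IH => //; rewrite e'0.
by exists e => // t; apply: he; rewrite ?mem_enum ?e0 /=.
Qed.

Lemma lt_perturb (R : realType) (a b a' b' : R) : a < b ->
  exists2 e, 0 < e & forall e', 0 < e' <= e -> a + e' * a' < b + e' * b'.
Proof.
move=> ab; exists ((b - a) / (`|a' - b'| + 1)).
  by rewrite divr_gt0 ?subr_gt0 // ltr_wpDl.
have n0 : 0 < `|a' - b'| + 1 by rewrite ltr_wpDl.
move=> e /andP[e0]; rewrite ler_pdivlMr // mulrDr mulr1 => h.
have : e * (a' - b') <= e * `|a' - b'| by rewrite ler_pM2l // ler_norm.
by rewrite mulrBr; lra.
Qed.

Lemma tiebreak (R : realType) (T : finType) (f g : T -> R) :
  exists2 e, 0 < e & forall i j, f i < f j -> f i + e * g i < f j + e * g j.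
Proof.
have [|e e0 he] := @finite_small R (T * T)%type
  (fun t e => f t.1 < f t.2 -> f t.1 + e * g t.1 < f t.2 + e * g t.2).
  move=> [i j] /=; have [fij|fij] := ltP (f i) (f j); last by exists 1.
  by have [e e0 he] := lt_perturb (g i) (g j) fij; exists e => // e' /he.
by exists e => // i j; apply: (he (i, j)).
Qed.

Lemma hull_le (R : realType) n m (q : 'I_m -> 'rV[R]_n) u a x :
  (forall i, dot u (q i) <= a) -> convex_hull q x -> dot u x <= a.
Proof.
move=> h [w [w0 w1 ->]]; rewrite dot_sumr -[a]mul1r -w1 mulr_suml.
by apply: ler_sum => i _; apply: ler_wpM2l.
Qed.

Lemma hull_point (R : realType) n m (q : 'I_m -> 'rV[R]_n) i : convex_hull q (q i).
Proof.
exists (fun j => (j == i)%:R); split=> [j||]; first by rewrite ler0n.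
  by rewrite (bigD1 i) //= eqxx big1 ?addr0 // => j /negbTE->.
rewrite (bigD1 i) //= eqxx scale1r big1 ?addr0 // => j /negbTE->.
by rewrite scale0r.
Qed.

Lemma hull_max (R : realType) n m (q : 'I_m -> 'rV[R]_n) u a (w : 'I_m -> R) :
  (forall i, dot u (q i) <= a) -> (forall i, 0 <= w i) -> \sum_i w i = 1 ->
  dot u (\sum_i w i *: q i) = a -> forall i, w i != 0 -> dot u (q i) = a.
Proof.
move=> h w0 w1; rewrite dot_sumr => e i wi.
have : \sum_i w i * (a - dot u (q i)) = 0.
  under eq_bigr do rewrite mulrBr.
  by rewrite sumrB -mulr_suml w1 mul1r e subrr.
move/eqP; rewrite psumr_eq0 => [/allP/(_ i (mem_index_enum i))|j _]; last first.
  by rewrite mulr_ge0 // subr_ge0.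
by rewrite /= mulf_eq0 (negbTE wi) /= subr_eq0 => /eqP.
Qed.

Lemma dot_delta (R : realType) n (l : 'I_n) (x : 'rV[R]_n) :
  dot (delta_mx 0 l) x = x 0 l.
Proof.
rewrite /dot (bigD1 l) //= big1 => [|i hi]; rewrite !mxE ?eqxx.
  by rewrite mul1r addr0.
by rewrite (negbTE hi) mul0r.
Qed.

(** The coordinates are added to [u] one after another, each with a weight too small to reverse a
    strict inequality already present. After [k] rounds equal values force the first [k] coordinates
    to agree. *)
Lemma separating_functional (R : realType) n m (q : 'I_m -> 'rV[R]_n) u :
  exists w, forall i j,
    (dot u (q i) < dot u (q j) -> dot w (q i) < dot w (q j)) /\
    (dot w (q i) = dot w (q j) -> q i = q j).
Proof.
have : forall k, (k <= n)%N -> exists w, forall i j,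
    (dot u (q i) < dot u (q j) -> dot w (q i) < dot w (q j)) /\
    (dot w (q i) = dot w (q j) -> forall l : 'I_n, (l < k)%N -> q i 0 l = q j 0 l).
  elim=> [_|k IH kn]; first by exists u.
  have [w hw] := IH (ltnW kn); pose l0 := Ordinal kn.
  have [e e0 he] := tiebreak (fun i => dot w (q i)) (fun i => q i 0 l0).
  exists (w + e *: delta_mx 0 l0) => i j; rewrite !dotl !dot_delta.
  split=> [uij|wij]; first by apply: he; apply: (hw i j).1.
  have wE : dot w (q i) = dot w (q j).
    have [hij|hij|//] := ltgtP (dot w (q i)) (dot w (q j)).
      by have := he _ _ hij; rewrite wij ltxx.
    by have := he _ _ hij; rewrite wij ltxx.
  have cE : q i 0 l0 = q j 0 l0.
    by move: wij; rewrite wE => /addrI/mulfI; apply; rewrite gt_eqF.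
  move=> l; rewrite ltnS leq_eqVlt => /orP[/eqP lk|lk]; last exact: (hw i j).2.
  by have -> : l = l0 by apply: val_inj.
move=> /(_ n (leqnn n))[w hw]; exists w => i j; split; first exact: (hw i j).1.
by move=> /(hw i j).2 h; apply/rowP => l; apply: h.
Qed.

(* Lexicographic maximisation of [u], [d] and the coordinates, turned into the
   maximisation of a single functional by successive small perturbations. *)
Lemma hull_exposed_vertex (R : realType) n m (q : 'I_m -> 'rV[R]_n) x0 u d :
  convex_hull q x0 ->
  exists v, [/\ vertex (convex_hull q) v,
     forall x, convex_hull q x -> dot u x <= dot u v &
     forall x, convex_hull q x -> dot u x = dot u v -> dot d x <= dot d v].
Proof.
move=> hx0; have m0 : (0 < m)%N.
  case: m q hx0 => // q [w [_ + _]]; rewrite big_ord0 => /eqP.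
  by rewrite eq_sym oner_eq0.
have [e e0 he] := tiebreak (fun i => dot u (q i)) (fun i => dot d (q i)).
have [w hw] := separating_functional q (u + e *: d).
have [k _ hk] := @arg_maxP _ _ _ (Ordinal m0) xpredT (fun i => dot w (q i)) isT.
have umax i : dot u (q i) <= dot u (q k).
  rewrite leNgt; apply/negP => hi; have := hk i isT; apply/negP; rewrite -ltNge.
  by apply: (hw k i).1; rewrite !dotl; apply: he.
exists (q k); split.
- exists w, (dot w (q k)); split; first by move=> x; apply: hull_le => i; apply: hk.
  apply/seteqP; split=> [_ ->|x /= [[c [c0 c1 ->]] hx]].
    by split=> //; apply: hull_point.
  have h := hull_max (fun i => hk i isT) c0 c1 hx.
  rewrite [RHS](_ : _ = \sum_i c i *: q k); last by rewrite -scaler_suml c1 scale1r.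
  apply: eq_bigr => i _; have [->|ci] := eqVneq (c i) 0; first by rewrite !scale0r.
  by rewrite ((hw i k).2 (h i ci)).
- by move=> x; apply: hull_le.
- move=> _ [c [c0 c1 ->]] hx; have h := hull_max umax c0 c1 hx.
  rewrite dot_sumr -[leRHS]mul1r -c1 mulr_suml; apply: ler_sum => i _.
  have [->|ci] := eqVneq (c i) 0; first by rewrite !mul0r.
  apply: ler_wpM2l => //; rewrite leNgt; apply/negP => hi.
  have := hk i isT; apply/negP; rewrite -ltNge; apply: (hw k i).1.
  by rewrite !dotl (h i ci) ltrD2l ltr_pM2l.
Qed.

Lemma exposed_vertex (R : realType) n (P : set 'rV[R]_n) u d :
  is_full_polytope P ->
  exists v, [/\ vertex P v, forall x, P x -> dot u x <= dot u v &
     forall x, P x -> dot u x = dot u v -> dot d x <= dot d v].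
Proof.
move=> [[m [q ->]] [x0 [_ [hx0 _ _ _]]]]; exact: hull_exposed_vertex hx0.
Qed.

Lemma face_vertex (R : realType) n (P G : set 'rV[R]_n) x :
  is_full_polytope P -> face P G -> G x -> exists2 v, vertex P v & G v.
Proof.
move=> hP [u [a [ua ->]]] [/= Px ux]; have [v [vv vu _]] := exposed_vertex u 0 hP.
have Pv : P v by case: vv => u' [a' [_ /seteqP[/(_ v erefl)[]]]].
by exists v => //; split=> //=; apply/eqP; rewrite eq_le ua //= -ux vu.
Qed.

Lemma vertex_in (R : realType) n (P : set 'rV[R]_n) v : vertex P v -> P v.
Proof. by case=> u [a [_ /seteqP[/(_ v erefl)[]]]]. Qed.

Lemma vertex_exposed (R : realType) n (P : set 'rV[R]_n) v : vertex P v ->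
  exists u, forall x, P x -> x <> v -> dot u x < dot u v.
Proof.
case=> u [a [ua /seteqP[/(_ v erefl)[Pv /= uv] h]]]; exists u => x Px xv.
rewrite lt_neqAle uv ua // andbT; apply/eqP => ux; apply: xv.
by apply: h.
Qed.

Lemma face_set0 (R : realType) n (P : set 'rV[R]_n) : face P set0.
Proof.
exists 0, 1; split=> [x _|]; first by rewrite dot0l ler01.
apply/seteqP; split=> x //= [_]; rewrite dot0l => /eqP.
by rewrite eq_sym oner_eq0.
Qed.

(** The empty face is the least one, hence preserved, so vertices correspond as the minimal nonempty
    faces. The last hypothesis, that every nonempty face of [Q] meets [W], makes [W] exhaust the
    vertices of [Q]. *)
Lemma combinatorial_vertices (R : realType) n n' (P : set 'rV[R]_n)
    (Q : set 'rV[R]_n') (I : Type) (W : I -> 'rV[R]_n') :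
  is_full_polytope P -> combinatorially_equivalent P Q ->
  injective W -> (forall i, vertex Q (W i)) ->
  (forall H x, face Q H -> H x -> exists i, H (W i)) ->
  exists p : I -> 'rV[R]_n,
    [/\ injective p, forall v, vertex P v <-> exists i, v = p i &
     forall H, face Q H -> exists2 G, face P G & forall i, G (p i) <-> H (W i)].
Proof.
move=> hP [f [[ff finj fsurj] fle]] Winj Wv Wex.
have f0 : f set0 = set0.
  have [G GP e] := fsurj _ (face_set0 Q).
  by apply/seteqP; split=> // x; rewrite -e; apply: (fle _ _ (face_set0 P) GP).1.
have fne F : face P F -> F !=set0 -> f F !=set0.
  move=> FP [x Fx]; apply/set0P/eqP; rewrite -f0.
  by move=> /(finj _ _ (mem_set FP) (mem_set (face_set0 P))) e; rewrite e in Fx.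
have /choice[p hp] : forall i, exists v, vertex P v /\ f [set v] = [set W i].
  move=> i; have [G GP e] := fsurj _ (Wv i).
  have [x Gx] : G !=set0.
    apply/set0P/eqP => G0; move: e; rewrite G0 f0 => e.
    by have : [set W i] (W i) by []; rewrite -e.
  have [v vv Gv] := face_vertex hP GP Gx; exists v; split=> //.
  have le1 : f [set v] `<=` [set W i] by rewrite -e; apply: (fle _ _ vv GP).1 => _ ->.
  apply/seteqP; split=> // _ ->; have [y fy] := fne _ vv (ex_intro _ v erefl).
  by rewrite -(le1 _ fy).
exists p; split.
- move=> i j e; apply: Winj; have := (hp i).2; rewrite e (hp j).2 => ew.
  by have : [set W i] (W i) by []; rewrite -ew.
- move=> v; split=> [vv|[i ->]]; last by have [] := hp i.
  have [y fy] := fne _ vv (ex_intro _ v erefl).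
  have [i hi] := Wex _ _ (ff _ vv) fy; exists i.
  have : [set p i] `<=` [set v].
    by apply/(fle _ _ (hp i).1 vv); rewrite (hp i).2 => _ ->.
  by move=> /(_ _ erefl).
- move=> H HQ; have [G GP <-] := fsurj _ HQ; exists G => // i.
  have le := fle _ _ (hp i).1 GP; rewrite (hp i).2 in le; split=> h.
    by apply: (le.1 _ _ erefl) => _ ->.
  by apply: (le.2 _ _ erefl) => _ ->.
Qed.

(** Let [dd] be the part of [x - v] orthogonal to [w - v]. Among the points of the face, [dd] is
    largest at a vertex, that is at [v] or [w], where it takes the same value; hence
    [dot dd (x - v)], which is the square of [dd], is at most 0. *)
Lemma edge_line (R : realType) n (P G : set 'rV[R]_n) (v w x : 'rV[R]_n) :
  is_full_polytope P -> face P G -> (forall z, vertex P z -> G z -> z = v \/ z = w) ->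
  v <> w -> G x -> exists c, x = v + c *: (w - v).
Proof.
move=> hP [u [a [ua ->]]] hz vw [Px /= ux].
pose c := dot (x - v) (w - v) / dot (w - v) (w - v); exists c.
have wv0 : dot (w - v) (w - v) != 0 by rewrite dot_eq0 subr_eq0; apply/eqP => /esym.
pose dd := x - v - c *: (w - v).
have dw : dot dd (w - v) = 0 by rewrite /dd dotBl dotZl /c divfK // subrr.
have dx : dot dd (x - v) = dot dd dd by rewrite -[dd in RHS]/(x - v - c *: (w - v)) [RHS]dotBr dotZr dw mulr0 subr0.
have [z [vz uz dz]] := exposed_vertex u dd hP.
have uz' : dot u z = a.
  apply/eqP; rewrite eq_le; apply/andP; split; last by rewrite -ux; apply: uz.
  by apply: ua; apply: vertex_in.
have dzv : dot dd z = dot dd v.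
  have [->//|->] := hz z vz (conj (vertex_in vz) uz').
  by apply/eqP; rewrite -subr_eq0 -dotBr dw.
have := dz _ Px; rewrite ux uz' => /(_ erefl); rewrite dzv -subr_le0 -dotBr dx => d0.
have : dd == 0 by rewrite -dot_eq0 eq_le d0 dot_ge0.
by rewrite /dd subr_eq0 subr_eq addrC => /eqP.
Qed.

Definition hvec {R : realType} {n : nat} (p : 'rV[R]_n) : 'rV[R]_(n + 1) :=
  row_mx p 1%:M.

(** The unit normal of the cap seen from [p]; [lor (hvec p) (hvec p)] is [dot p p - 1], positive for
    a point outside the sphere. *)
Definition uvec {R : realType} {n : nat} (p : 'rV[R]_n) : 'rV[R]_(n + 1) :=
  (Num.sqrt (dot p p - 1))^-1 *: hvec p.

Lemma uvec_unit (R : realType) n (p : 'rV[R]_n) : 1 < dot p p ->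
  lor (uvec p) (uvec p) = 1.
Proof.
move=> h; rewrite /uvec lorZl lorZr lorE mulr1 mulrA -expr2 exprVn.
by rewrite sqr_sqrtr ?subr_ge0 ?ltW // mulVf // subr_eq0 gt_eqF.
Qed.

(** The contact point [x = (1 - c) v + c w] satisfies [dot x v = dot x w = 1], so the Gram matrix of
    [hvec v] and [hvec w] is singular and the normalised product is 1 or -1. Since [x] lies strictly
    between [v] and [w], the sign is negative. *)
Lemma edge_uvec (R : realType) n (P G : set 'rV[R]_n) (v w : 'rV[R]_n) :
  is_full_polytope P -> edge_scribed P -> (forall z, vertex P z -> 1 < enorm z) ->
  vertex P v -> vertex P w -> v <> w -> face P G -> G v -> G w ->
  (forall z, vertex P z -> G z -> z = v \/ z = w) ->
  lor (uvec v) (uvec w) = -1.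
Proof.
move=> hP hE hO vv vw nvw GP Gv Gw hz.
have line x := @edge_line _ _ _ _ _ _ x hP GP hz nvw.
have wv0 : w - v != 0 by rewrite subr_eq0; apply/eqP => /esym.
have : edge P G.
  split=> //; exists v, (w - v); split=> //.
  - by rewrite /row_free rank_rV wv0.
  - move=> i; have -> : row i (w - v) = w - v by apply/rowP => j; rewrite !mxE (ord1 i).
    by rewrite addrC subrK.
  - move=> x /line[c ->]; rewrite addrAC subrr add0r.
    exact: scalemx_sub.
move=> /hE[x [Gx /enorm_eq1 x1 hx]].
have xv : dot x v = 1 by have := hx _ Gv; rewrite dotBr x1; lra.
have xw : dot x w = 1 by have := hx _ Gw; rewrite dotBr x1; lra.
have Px : P x by case: GP Gx => u [a [_ ->]] [].
have [c xE] := line x Gx.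
have v1 : 0 < dot v v - 1.
  by have := hO v vv; rewrite lt_enorm // expr1n; lra.
have w1 : 0 < dot w w - 1.
  by have := hO w vw; rewrite lt_enorm // expr1n; lra.
set g := dot v w - 1.
have e1 : (1 - c) * (dot v v - 1) + c * g = 0.
  by move: xv; rewrite xE !dotl (dotC w v) /g; lra.
have e2 : (1 - c) * g + c * (dot w w - 1) = 0.
  by move: xw; rewrite xE !dotl /g; lra.
have c0 : c != 0.
  by apply/eqP => c0; move: e1; rewrite c0; lra.
have c1 : 1 - c != 0.
  by apply/eqP => c1; move: e2; rewrite c1 (_ : c = 1); lra.
(* The contact point has norm 1, so it is not [v]; a functional maximal only at [v] puts it on the
   side of [w]. *)
have c_ge0 : 0 <= c.
  have [u' hu'] := vertex_exposed vv.
  have huw := hu' _ (vertex_in vw) (fun e => nvw (esym e)).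
  have [xv'|xv'] := pselect (x = v).
    exfalso; move: x1 v1; rewrite xv'; lra.
  have := hu' _ Px xv'; rewrite {1}xE !dotr => h.
  have : 0 < c * (dot u' v - dot u' w) by lra.
  by rewrite pmulr_lgt0 ?subr_gt0 // => /ltW.
have gn : g < 0.
  have [cg|cg] := ltP 0 (1 - c).
    have c0' : 0 < c by rewrite lt_neqAle eq_sym c0.
    have : 0 < (1 - c) * (dot v v - 1) by rewrite mulr_gt0.
    by move=> h; have : c * g < 0 by [lra]; rewrite pmulr_rlt0.
  exfalso; have [u' hu'] := vertex_exposed vw.
  have huw := hu' _ (vertex_in vv) nvw.
  have [xv'|xv'] := pselect (x = w).
    by move: x1 w1; rewrite xv'; lra.
  have := hu' _ Px xv'; rewrite {1}xE !dotr => h.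
  have : 0 < (1 - c) * (dot u' w - dot u' v) by lra.
  by rewrite pmulr_lgt0 ?subr_gt0 //; lra.
have g2 : g ^+ 2 = (dot v v - 1) * (dot w w - 1).
  have cc : c * (1 - c) != 0 by rewrite mulf_neq0.
  apply: (mulfI cc); rewrite expr2.
  have -> : c * (1 - c) * (g * g) = (c * g) * ((1 - c) * g) by ring.
  have -> : c * g = - ((1 - c) * (dot v v - 1)) by lra.
  have -> : (1 - c) * g = - (c * (dot w w - 1)) by lra.
  ring.
rewrite /uvec lorZl lorZr lorE mulr1 -/g.
have s1 : Num.sqrt (dot v v - 1) * Num.sqrt (dot w w - 1) = - g.
  by rewrite -sqrtrM ?ltW // -g2 sqrtr_sqr ltr0_norm.
have sv : Num.sqrt (dot v v - 1) != 0 by rewrite gt_eqF ?sqrtr_gt0.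
have sw : Num.sqrt (dot w w - 1) != 0 by rewrite gt_eqF ?sqrtr_gt0.
rewrite -[g]opprK -s1; field.
by rewrite sv sw.
Qed.

Section PolarVertices.
Context (R : realType) (n : nat) (P : set 'rV[R]_n) (I : finType) (p : I -> 'rV[R]_n).
Hypotheses (hP : is_full_polytope P) (vP : forall v, vertex P v <-> exists i, v = p i).

Lemma le_vertices u a : (forall i, dot u (p i) <= a) -> forall x, P x -> dot u x <= a.
Proof.
move=> h x Px; have [v [/vP[i ->] hv _]] := exposed_vertex u 0 hP.
exact: le_trans (hv _ Px) (h i).
Qed.

Lemma polarE y : polar P y <-> forall i, dot (p i) y <= 1.
Proof.
split=> [h i|h x Px]; first by apply: h; apply: vertex_in; apply/vP; exists i.
by rewrite dotC; apply: le_vertices Px => i; rewrite dotC.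
Qed.

(** Along a direction orthogonal to all tight vertices one can move both ways without leaving the
    polar, but a vertex is not interior to a segment of the polar. *)
Lemma polar_vertex_tight y d : vertex (polar P) y ->
  (forall i, dot (p i) y = 1 -> dot (p i) d = 0) -> d = 0.
Proof.
move=> vy hd; have /polarE yP := vertex_in vy.
have [|e e0 he] := @finite_small R I
  (fun i e => dot (p i) (y + e *: d) <= 1 /\ dot (p i) (y - e *: d) <= 1).
  move=> i; have [yi|yi] := eqVneq (dot (p i) y) 1.
    by exists 1 => // e _; rewrite !dotr hd // mulr0 oppr0 addr0 yi lexx.
  have yi' : dot (p i) y < 1 by rewrite lt_neqAle yi yP.
  have [e1 e10 h1] := lt_perturb (dot (p i) d) 0 yi'.
  have [e2 e20 h2] := lt_perturb (- dot (p i) d) 0 yi'.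
  exists (Num.min e1 e2) => [|e]; first by rewrite lt_min e10.
  rewrite le_min => /and3P[e0 ee1 ee2]; rewrite !dotr -mulrN.
  have := h1 e; have := h2 e; rewrite e0 ee1 ee2 mulr0 addr0 => /(_ isT)/ltW ? /(_ isT)/ltW ?.
  by split.
have [u hu] := vertex_exposed vy.
have h1 : polar P (y + e *: d) by apply/polarE => i; have [] := he i.
have h2 : polar P (y - e *: d) by apply/polarE => i; have [] := he i.
apply: contrapT => d0.
have ed : e *: d <> 0 by move=> /eqP; rewrite scaler_eq0 gt_eqF //= => /eqP.
have n1 : y + e *: d <> y by move=> /eqP; rewrite -subr_eq0 addrAC subrr add0r => /eqP.
have n2 : y - e *: d <> y.
  by move=> /eqP; rewrite -subr_eq0 addrAC subrr add0r oppr_eq0 => /eqP.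
have := hu _ h1 n1; have := hu _ h2 n2; rewrite !dotr; lra.
Qed.

(** Homogeneous form of the preceding fact, applied to [d - t *: y]. It identifies the ray of a
    facet normal from orthogonality relations alone. *)
Lemma polar_vertex_extremal y D : vertex (polar P) y ->
  (forall i, lor (hvec y) (hvec (p i)) = 0 -> lor D (hvec (p i)) = 0) ->
  exists c, D = c *: hvec y.
Proof.
move=> vy; rewrite -(hsubmxK D) [rsubmx D]mx11_scalar; move: (lsubmx D) (_ 0 0) => d t h.
exists t; rewrite /hvec scale_row_mx scale_scalar_mx mulr1; congr row_mx.
apply/eqP; rewrite -subr_eq0; apply/eqP; apply: (polar_vertex_tight vy) => i yi.
have := h i; rewrite !lorE !mulr1 (dotC y) yi subrr => /(_ erefl).
by rewrite !dotr yi (dotC d) mulr1.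
Qed.

(** The linear form [dot d] is constant on the polytope; the origin gives the constant 0, and a
    small multiple of [d], available because the origin is interior, gives [d = 0]. *)
Lemma vertices_span D : interior P 0 ->
  (forall i, lor D (hvec (p i)) = 0) -> D = 0.
Proof.
move=> iP; rewrite -(hsubmxK D) [rsubmx D]mx11_scalar; move: (lsubmx D) (_ 0 0) => d t h.
have di i : dot d (p i) = t by have := h i; rewrite lorE mulr1; lra.
have dx x : P x -> dot d x = t.
  move=> Px; apply/eqP; rewrite eq_le (le_vertices _ Px) => [/=|i]; last by rewrite di.
  by rewrite -lerN2 -dotNl (le_vertices _ Px) // => i; rewrite dotNl di.
have P0 : P 0 := interior_subset iP.
have t0 : t = 0 by rewrite -(dx 0) // dot0r.
have [e [e0 Pe]] : exists e : R, 0 < e /\ P (e *: d).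
  have /nbhs_ballP[e /= e0 he] : nbhs (0 : 'rV[R]_n) P by exact: iP.
  exists (e / (enorm d + 1)).
  have d1 : 0 < enorm d + 1 by rewrite ltr_wpDl ?enorm_ge0.
  split; first by rewrite divr_gt0.
  apply: he; split=> // i j; rewrite !mxE /ball /= sub0r normrN normrM gtr0_norm ?divr_gt0 //.
  rewrite mulrAC ltr_pdivrMr // ltr_pM2l // ltr_pwDr //.
  rewrite le_enorm // real_normK ?num_real // /dot (bigD1 j) //= (ord1 i) expr2.
  by rewrite lerDl sumr_ge0 // => k _; rewrite -expr2 sqr_ge0.
have := dx _ Pe; rewrite dotZr t0 => /eqP; rewrite mulf_eq0 gt_eqF //= dot_eq0 => /eqP->.
by rewrite raddf0 row_mx0.
Qed.

End PolarVertices.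

(** * Sections of Apollonian packings *)

Lemma boundary_inversion_involution (R : realType) d (b : set (hatR R d)) s :
  boundary_inversion b s -> exists M, mlift s M /\ M *m M = 1%:M.
Proof.
case=> [c r r0 _|c r r0 _|n a n0 _].
- exists (refl (sphere_vec c r)); split; first exact: lift_sphere_inversion.
  by rewrite refl_refl // sphere_vec_unit // oner_eq0.
- exists (refl (sphere_vec c r)); split; first exact: lift_sphere_inversion.
  by rewrite refl_refl // sphere_vec_unit // oner_eq0.
- exists (refl (plane_vec n a)); split; first exact: lift_hyperplane_reflection.
  by rewrite refl_refl // plane_vec_norm dot_eq0.
Qed.

Lemma inversion_group_lift (R : realType) d (S : set (hatR R d -> hatR R d)) g :
  (forall s, S s -> exists b, boundary_inversion b s) -> generated_group S g ->
  exists M h M', [/\ mlift g M, mlift h M', cancel g h & cancel h g].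
Proof.
move=> hS gS.
have [//|//||M [h [M' [? ? ? ? _]]]] :=
  @generated_group_lift R d S (fun _ _ => True) _ _ _ g gS.
  move=> s /hS[b /boundary_inversion_involution[M [h1 h2]]]; exists M; split=> //.
by exists M, h, M'.
Qed.

Lemma apollonian_lift (R : realType) d (B : polytopal_packing R d) g :
  apollonian_group B g ->
  exists M h M', [/\ mlift g M, mlift h M', cancel g h & cancel h g].
Proof. by apply: inversion_group_lift => s [b _ h]; exists b. Qed.

Lemma moebius_lift (R : realType) d (g : hatR R d -> hatR R d) : moebius g ->
  exists M h M', [/\ mlift g M, mlift h M', cancel g h & cancel h g].
Proof. by apply: inversion_group_lift => s hs; exact: hs. Qed.

Section ArithmeticSection.
Context (R : realType) (B : polytopal_packing R 2) (B' : polytopal_packing R 3).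
Context (I : Type) (V : I -> 'rV[R]_(2 + 1 + 1)) (V' : I -> 'rV[R]_(3 + 1 + 1)).
Context (J : 'M[R]_(2 + 1 + 1, 3 + 1 + 1)) (K : 'M[R]_(3 + 1 + 1, 2 + 1 + 1)).
Context (w : 'rV[R]_(3 + 1 + 1)) (k : 'cV[R]_(3 + 1 + 1)) (om : I -> R).
Context (chi : 'M[R]_(2 + 1 + 1) -> R) (Pm : 'M[R]_(2 + 1 + 1) -> Prop).

(** [K] and [k] are the coordinates dual to [J] and [w]. The matrix acts as [M] on the image of [J]
    and as the scalar [chi M] on [w]. *)
Definition section_mx (M : 'M[R]_(2 + 1 + 1)) : 'M[R]_(3 + 1 + 1) :=
  K *m M *m J + chi M *: (k *m w).

Hypotheses (JK : J *m K = 1%:M) (wK : w *m K = 0) (Jk : J *m k = 0)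
  (wk : w *m k = 1%:M) (KJ : K *m J + k *m w = 1%:M).
Hypothesis V'E : forall i, V' i = V i *m J + om i *: w.
Hypotheses (V1 : forall i, lor (V i) (V i) = 1)
  (V'1 : forall i, lor (V' i) (V' i) = 1).
Hypothesis ballsE : forall b, balls B b <-> exists i, b = bset (V i).
Hypothesis balls' : forall i, balls B' (bset (V' i)).
Hypothesis curvE : forall x a, curv (x *m J + a *: w) = curv x.
Hypotheses (chi1 : chi 1%:M = 1)
  (chiM : forall M M', chi (M *m M') = chi M * chi M').
Hypotheses (Pm1 : Pm 1%:M) (PmM : forall M M', Pm M -> Pm M' -> Pm (M *m M')).
Hypothesis om_chi : forall M, Pm M -> forall i, om i * chi M = om i.
Hypothesis om_inj : forall M M' i j, Pm M -> Pm M' ->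
  V i *m M = V j *m M' -> om i = om j.
Hypothesis gens : forall b s, dual_balls B b -> boundary_inversion b s ->
  exists M, [/\ mlift s M, M *m M = 1%:M, Pm M &
    exists2 h, apollonian_group B' h & mlift h (section_mx M)].

Let A := apollonian_group B.
Let A' := apollonian_group B'.

Lemma section_mx1 : section_mx 1%:M = 1%:M.
Proof. by rewrite /section_mx chi1 scale1r mulmx1. Qed.

Lemma section_mxM M M' :
  section_mx (M *m M') = section_mx M *m section_mx M'.
Proof.
rewrite /section_mx mulmxDl !mulmxDr -!scalemxAl -!scalemxAr !mulmxA.
rewrite -(mulmxA (K *m M) J K) JK mulmx1 -(mulmxA (K *m M) J k) Jk mulmx0 mul0mx.
rewrite scaler0 addr0 -(mulmxA k w K) wK mulmx0 !mul0mx scaler0 add0r.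
by rewrite -(mulmxA k w k) wk mulmx1 scalerA -chiM.
Qed.

Lemma section_mxK M : J *m section_mx M *m K = M.
Proof.
rewrite /section_mx mulmxDr -scalemxAr !mulmxA JK mul1mx Jk mul0mx scaler0 addr0.
by rewrite -mulmxA JK mulmx1.
Qed.

Lemma section_mx_act M x a :
  (x *m J + a *: w) *m section_mx M = x *m M *m J + (a * chi M) *: w.
Proof.
rewrite /section_mx mulmxDl !mulmxDr -!scalemxAl -!scalemxAr !mulmxA.
rewrite -(mulmxA x J K) JK mulmx1 wK !mul0mx scaler0 add0r.
by rewrite -(mulmxA x J k) Jk mulmx0 mul0mx scaler0 addr0 wk mul1mx scalerA.
Qed.

Lemma section_mx_row i M : Pm M ->
  V' i *m section_mx M = V i *m M *m J + om i *: w.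
Proof. by move=> PM; rewrite V'E section_mx_act om_chi. Qed.

Lemma section_lift g : A g ->
  exists M g1 M1, [/\ mlift g M, mlift g1 M1, cancel g g1, cancel g1 g &
    Pm M /\ exists2 h, A' h & mlift h (section_mx M)].
Proof.
apply: (@generated_group_lift _ _ _
  (fun _ M => Pm M /\ exists2 h, A' h & mlift h (section_mx M))).
- split=> //; exists id; first exact: generated_group_id.
  by rewrite section_mx1; apply: lift_id.
- move=> _ _ M M' [PM [h hA lh]] [PM' [h' hA' lh']]; split; first exact: PmM.
  exists (h \o h'); first exact: generated_group_comp.
  by rewrite section_mxM; apply: lift_comp.
- by move=> s [b Bb /(gens Bb)[M [h1 h2 h3 h4]]]; exists M; split.
Qed.

Lemma lift_uniqA g M M' : A g -> mlift g M -> mlift g M' -> M = M'.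
Proof.
move=> /apollonian_lift[_ [h [_ [_ _ _ hg]]]].
exact: lift_mx_uniq.
Qed.

Lemma lift_uniqA' g M M' : A' g -> mlift g M -> mlift g M' -> M = M'.
Proof.
move=> /apollonian_lift[_ [h [_ [_ _ _ hg]]]].
exact: lift_mx_uniq.
Qed.

Lemma liftA_Pm g M : A g -> mlift g M -> Pm M.
Proof.
move=> Ag lM; have [M' [_ [_ [lM' _ _ _ [PM' _]]]]] := section_lift Ag.
by rewrite (lift_uniqA Ag lM lM').
Qed.

Lemma orbitE b : ball_orbit A (balls B) b <->
  exists g M i, [/\ A g, mlift g M & b = bset (V i *m M)].
Proof.
split=> [[g [Ag [c [/ballsE[i ->] ->]]]]|[g [M [i [Ag lM ->]]]]].
  have [M [h [_ [lM _ _ hg]]]] := apollonian_lift Ag.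
  by exists g, M, i; split=> //; rewrite (lift_image _ lM hg).
exists g; split=> //; exists (bset (V i)); split; first by apply/ballsE; exists i.
have [_ [h [_ [_ _ _ hg]]]] := apollonian_lift Ag.
by rewrite (lift_image _ lM hg).
Qed.

(** [phi g] is an element whose matrix is [section_mx] of that of [g]; uniqueness of lifts turns the
    multiplicativity of [section_mx] into that of [phi], and [section_mxK] gives injectivity. [psi]
    maps the disk of [x] to the sphere of [x *m J + om i *: w], which has the same curvature by
    [curvE]. *)
Lemma arithmetic_section :
  exists G X, is_apollonian_section B' G X /\
    arithmetically_equivalent (apollonian_group B) (balls B) G X.
Proof.
have /choice[phi hphi] : forall g, exists h, A g -> A' h /\
    exists2 M, mlift g M & mlift h (section_mx M).
  move=> g; have [Ag|nAg] := pselect (A g); last by exists id.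
  have [M [_ [_ [lM _ _ _ [PM [h Ah lh]]]]]] := section_lift Ag.
  by exists h; split=> //; exists M.
have phi_lift g M : A g -> mlift g M -> mlift (phi g) (section_mx M).
  move=> Ag lM; have [_ [M' lM' lh]] := hphi g Ag.
  by rewrite (lift_uniqA Ag lM lM').
have phiM g h : A g -> A h -> phi (g \o h) = phi g \o phi h.
  move=> Ag Ah; have [M [_ [_ [lM _ _ _]]]] := apollonian_lift Ag.
  have [M' [_ [_ [lM' _ _ _]]]] := apollonian_lift Ah.
  apply: (@lift_fun_uniq _ _ _ _ (section_mx (M' *m M))).
    by apply: phi_lift; [apply: generated_group_comp|apply: lift_comp].
  by rewrite section_mxM; apply: lift_comp; apply: phi_lift.
have Aid : A id by apply: generated_group_id.
have phi1 : phi id = id.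
  apply: (@lift_fun_uniq _ _ _ _ (section_mx 1%:M)).
    by apply: phi_lift => //; apply: lift_id.
  by rewrite section_mx1; apply: lift_id.
have V'unit i M g : A g -> mlift g M ->
    lor (V i *m M *m J + om i *: w) (V i *m M *m J + om i *: w) = 1.
  move=> Ag lM; rewrite -section_mx_row; last exact: liftA_Pm lM.
  by rewrite lorM //; have [] := phi_lift _ _ Ag lM.
have Vunit i M g : mlift g M -> lor (V i *m M) (V i *m M) = 1.
  by case=> lM _; rewrite lorM.
(* Two presentations of one disk give the same unit vector by [bset_inj], and then the same
   component along [w] by [om_inj]. *)
have /choice[psi hpsi] : forall b, exists b', forall g M i, A g -> mlift g M ->
    b = bset (V i *m M) -> b' = bset (V i *m M *m J + om i *: w).
  move=> b; have [[g [M [i [Ag lM bE]]]]|nb] := pselect (exists g M i,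
    [/\ A g, mlift g M & b = bset (V i *m M)]); last first.
    by exists set0 => g M i Ag lM bE; exfalso; apply: nb; exists g, M, i.
  exists (bset (V i *m M *m J + om i *: w)) => g' M' i' Ag' lM' bE'.
  have e : V i *m M = V i' *m M'.
    apply: (@bset_inj R 2 isT _ _ (Vunit _ _ _ lM) (Vunit _ _ _ lM')).
    by rewrite -bE.
  by rewrite e (om_inj (liftA_Pm Ag lM) (liftA_Pm Ag' lM') e).
have psiE g M i : A g -> mlift g M ->
    psi (bset (V i *m M)) = bset (V i *m M *m J + om i *: w).
  by move=> Ag lM; apply: hpsi lM erefl.
have phi_bset g M i : A g -> mlift g M ->
    phi g @` bset (V' i) = bset (V i *m M *m J + om i *: w).
  move=> Ag lM; have [/apollonian_lift[_ [h [_ [_ _ _ hg]]]] _] := hphi g Ag.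
  rewrite (lift_image _ (phi_lift _ _ Ag lM) hg) section_mx_row //.
  exact: liftA_Pm lM.
pose X := [set b | exists i, b = bset (V' i)].
exists (phi @` A), X; split.
  split.
  - split.
    + by exists id.
    + by move=> _ _ [g Ag <-] [h Ah <-]; exists (g \o h); [apply: generated_group_comp|apply: phiM].
    + move=> _ [g Ag <-]; have [_ [h [_ [_ _ gh hg]]]] := apollonian_lift Ag.
      have Ah : A h by apply: generated_group_inv gh hg.
      exists (phi h); first by exists h.
      split=> x.
        rewrite -[LHS]/((phi h \o phi g) x) -phiM // (_ : h \o g = id) ?phi1 //.
        by apply/funext.
      rewrite -[LHS]/((phi g \o phi h) x) -phiM // (_ : g \o h = id) ?phi1 //.
      by apply/funext.
  - by move=> _ [g Ag <-]; have [] := hphi g Ag.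
  - by move=> _ [i ->].
exists phi, psi; split.
  split.
  - split; last by [].
    split.
    + by move=> g Ag; exists g.
    + move=> g1 g2 /set_mem A1 /set_mem A2 e.
      have [A1' [M1 l1 l1']] := hphi g1 A1; have [A2' [M2 l2 l2']] := hphi g2 A2.
      have eM : section_mx M1 = section_mx M2.
        by apply: (lift_uniqA' A1' l1'); rewrite e.
      apply: (@lift_fun_uniq _ _ _ _ M1) => //.
      by rewrite -(section_mxK M1) eM section_mxK.
    + by move=> _ [g Ag <-]; exists g.
  - split.
    + move=> b /orbitE[g [M [i [Ag lM ->]]]]; exists (phi g); split; first by exists g.
      by exists (bset (V' i)); split; [exists i|rewrite (psiE g) // (phi_bset g M)].
    + move=> b1 b2 /set_mem/orbitE[g1 [M1 [i1 [A1 l1 ->]]]].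
      move=> /set_mem/orbitE[g2 [M2 [i2 [A2 l2 ->]]]].
      rewrite (psiE g1) // (psiE g2) // => e.
      have := @bset_inj R 3 isT _ _ (V'unit _ _ _ A1 l1) (V'unit _ _ _ A2 l2) e.
      (* [K] kills [w] and inverts [J], so it recovers the vector of the disk. *)
      move=> /(congr1 (mulmx^~ K)); rewrite !mulmxDl -!scalemxAl wK !scaler0 !addr0.
      by rewrite -!(mulmxA _ J K) JK !mulmx1 => ->.
    + move=> _ [_ [[g Ag <-] [_ [[i ->] ->]]]].
      have [M [_ [_ [lM _ _ _]]]] := apollonian_lift Ag.
      exists (bset (V i *m M)); first by apply/orbitE; exists g, M, i.
      by rewrite (psiE g) // (phi_bset g M).
  - move=> g b Ag /ballsE[i ->].
    have [M [h [_ [lM _ _ hg]]]] := apollonian_lift Ag.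
    rewrite (lift_image _ lM hg) (psiE g) // -(phi_bset g M) //; congr (_ @` _).
    by have := psiE id 1%:M i Aid lift_id; rewrite mulmx1 -V'E.
move=> b /orbitE[g [M [i [Ag lM ->]]]] c; rewrite (psiE g) //.
have c1 := @has_curvature_bset R 2 isT _ c (Vunit i _ _ lM).
have c2 := @has_curvature_bset R 3 isT _ c (V'unit i _ _ Ag lM).
by rewrite curvE in c2; split=> [/c1/c2|/c2/c1].
Qed.

End ArithmeticSection.

(** * Cross-polytopes *)

Lemma sqrt2_sqr (R : realType) : (Num.sqrt 2 : R) * Num.sqrt 2 = 2.
Proof. by rewrite -expr2 sqr_sqrtr. Qed.

Lemma sqrt2_gt0 (R : realType) : 0 < (Num.sqrt 2 : R).
Proof. by rewrite sqrtr_gt0. Qed.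

Lemma sqrt2_neq0 (R : realType) : (Num.sqrt 2 : R) != 0.
Proof. by rewrite gt_eqF // sqrt2_gt0. Qed.

Lemma sqrt2V (R : realType) : (Num.sqrt 2)^-1 = Num.sqrt 2 / 2 :> R.
Proof.
apply: (mulfI (sqrt2_neq0 R)).
by rewrite divff ?sqrt2_neq0 // mulrA sqrt2_sqr divff // pnatr_eq0.
Qed.

Lemma hull_finType (R : realType) n (T : finType) (q : T -> 'rV[R]_n) x :
  convex_hull (fun k : 'I_#|T| => q (enum_val k)) x <->
  exists w : T -> R, [/\ forall t, 0 <= w t, \sum_t w t = 1 & x = \sum_t w t *: q t].
Proof.
split=> -[w [w0 w1 ->]].
  exists (fun t => w (enum_rank t)); split=> [t//||].
    by rewrite -w1 [RHS](reindex enum_rank) //; apply: onW_bij; apply: enum_rank_bij.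
  rewrite (reindex enum_rank) /=; last by apply: onW_bij; apply: enum_rank_bij.
  by apply: eq_bigr => t _; rewrite enum_rankK.
exists (fun k => w (enum_val k)); split=> [k//||].
  by rewrite -w1 [RHS](reindex (@enum_val T T)) //; apply: onW_bij; apply: enum_val_bij.
by rewrite (reindex (@enum_val T T)) //; apply: onW_bij; apply: enum_val_bij.
Qed.

Lemma hull_face_point (R : realType) n m (q : 'I_m -> 'rV[R]_n) H x :
  face (convex_hull q) H -> H x -> exists k, H (q k).
Proof.
move=> [u [a [ua ->]]] [[w [w0 w1 ->]] /= hx].
have [k wk] : exists k, w k != 0.
  apply: contrapT => h; have : \sum_i w i = 0.
    by rewrite big1 // => i _; apply/eqP; apply: contrapT => hi; apply: h; exists i; apply/negP.
  by rewrite w1 => /eqP; rewrite oner_eq0.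
exists k; split; first exact: hull_point.
by apply: hull_max hx _ wk => // i; apply: ua; apply: hull_point.
Qed.

(** Two radii occur: 1 for the reference cross-polytope, and the square root of 2, for which the
    midpoint of two non-opposite vertices has norm 1. *)
Definition orth {R : realType} (n : nat) (r : R) : set 'rV[R]_n :=
  [set x | \sum_i `|x 0 i| <= r].

Definition sgb {R : realType} (b : bool) : R := if b then -1 else 1.

Definition orth_vertex {R : realType} {n : nat} (r : R) (p : 'I_n * bool) :
  'rV[R]_n := (r * sgb p.2) *: delta_mx 0 p.1.

Section CrossPolytope.
Context {R : realType} {n : nat} (r : R).
Hypothesis (r0 : 0 < r) (n0 : (0 < n)%N).
Local Notation P := (@orth R n r).
Local Notation q := (@orth_vertex R n r).

Lemma dot_orth_vertexr (u : 'rV[R]_n) p : dot u (q p) = r * sgb p.2 * u 0 p.1.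
Proof. by rewrite dotZr dotC dot_delta. Qed.

Lemma orth_hull : P = convex_hull (fun k : 'I_#|{: 'I_n * bool}| => q (enum_val k)).
Proof.
have rn0 : r != 0 by rewrite gt_eqF.
have nn0 : (n%:R : R) != 0 by rewrite pnatr_eq0 -lt0n.
apply/seteqP; split=> x.
  move=> hx; apply/hull_finType; rewrite /orth /= in hx.
  set S := \sum_i _ in hx.
  (* The first term writes [x] with total weight [S / r]; the slack [1 - S / r] is spread evenly
     over all vertices, where opposite contributions cancel. *)
  pose w (p : 'I_n * bool) := (`|x 0 p.1| + sgb p.2 * x 0 p.1) / (2 * r) + (1 - S / r) / (2 * n%:R).
  exists w; split.
  - move=> [i b]; apply: addr_ge0; apply: divr_ge0 => /=.
    + rewrite /sgb; case: b; first by rewrite mulN1r subr_ge0 ler_norm.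
      by rewrite mul1r; have := ler_norm (- x 0 i); rewrite normrN; lra.
    + by rewrite mulr_ge0 // ltW.
    + by rewrite subr_ge0 ler_pdivrMr // mul1r.
    + by rewrite mulr_ge0 // ler0n.
  - rewrite -(pair_bigA _ (fun i b => w (i, b))) /=.
    rewrite (eq_bigr (fun i => `|x 0 i| / r + (1 - S / r) / n%:R)); last first.
      by move=> i _; rewrite big_bool /w /sgb /=; field; rewrite rn0 nn0.
    rewrite big_split /= -mulr_suml -/S sumr_const card_ord -mulr_natr.
    by field; rewrite rn0 nn0.
  - rewrite [RHS](_ : _ = \sum_i x 0 i *: delta_mx 0 i); first exact: row_sum_delta.
    rewrite -(pair_bigA _ (fun i b => w (i, b) *: q (i, b))) /=.
    apply: eq_bigr => i _; rewrite big_bool /orth_vertex /= !scalerA -scalerDl.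
    by congr (_ *: _); rewrite /w /sgb /=; field; rewrite rn0 nn0.
move=> hx; rewrite /orth /=.
have -> : \sum_i `|x 0 i| = dot (\row_i Num.sg (x 0 i)) x.
  by apply: eq_bigr => i _; rewrite mxE normrEsg.
apply: hull_le hx => k; rewrite dot_orth_vertexr mxE -mulrA ger_pMr //.
by rewrite /sgb; case: (_.2); case: sgrP; lra.
Qed.

Lemma orth_point p : P (q p).
Proof.
by rewrite orth_hull; have := hull_point (fun k : 'I_#|{: 'I_n * bool}| => q (enum_val k)) (enum_rank p); rewrite enum_rankK.
Qed.

Lemma orth_vertex_norm p : dot (q p) (q p) = r ^+ 2.
Proof.
rewrite dot_orth_vertexr /orth_vertex !mxE !eqxx mulr1 /sgb.
by case: (_.2); ring.
Qed.

Lemma orth_vertexP v : vertex P v <-> exists p, v = q p.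
Proof.
split=> [vv|[p ->]].
  have [k <-] : exists k : 'I_#|{: 'I_n * bool}|, [set v] (q (enum_val k)).
    have : face P [set v] := vv; rewrite orth_hull => /hull_face_point; apply.
    by [].
  by exists (enum_val k).
exists (sgb p.2 *: delta_mx 0 p.1), r.
have dE x : dot (sgb p.2 *: delta_mx 0 p.1) x = sgb p.2 * x 0 p.1 :> R.
  by rewrite dotZl dot_delta.
have le1 (x : R) : sgb p.2 * x <= `|x|.
  rewrite /sgb; case: p.2; last by rewrite mul1r ler_norm.
  by rewrite mulN1r -normrN ler_norm.
have split_sum (x : 'rV[R]_n) : \sum_i `|x 0 i| =
   `|x 0 p.1| + \sum_(i | i != p.1) `|x 0 i| by rewrite (bigD1 p.1).
have rest0 (x : 'rV[R]_n) : 0 <= \sum_(i | i != p.1) `|x 0 i| by apply: sumr_ge0.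
split=> [x|].
  rewrite /orth /= dE split_sum => hx; have := le1 (x 0 p.1); have := rest0 x; lra.
apply/seteqP; split=> [_ ->|x /= [hx]].
  split; first exact: orth_point.
  rewrite /= dE /orth_vertex !mxE !eqxx mulr1 /sgb.
  by case: p.2; ring.
rewrite dE => e; move: hx; rewrite /orth /= split_sum => hx.
have h1 := le1 (x 0 p.1); have h2 := rest0 x.
have s0 : \sum_(i | i != p.1) `|x 0 i| = 0 by lra.
apply/rowP => i; rewrite /orth_vertex !mxE eqxx /=.
case: eqVneq => [->|ip].
  have ss : sgb p.2 * sgb p.2 = 1 :> R by rewrite /sgb; case: p.2; ring.
  by rewrite mulr1 -e mulrAC ss mul1r.
rewrite mulr0; move/eqP: s0; rewrite psumr_eq0 // => /allP/(_ i (mem_index_enum i)).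
by rewrite ip /= normr_eq0 => /eqP.
Qed.

Lemma orth_vertex_inj : injective q.
Proof.
move=> [i b] [j c] e; have := congr1 (fun v : 'rV[R]_n => v 0 i) e.
rewrite /orth_vertex !mxE /= !eqxx /=; case: eqVneq => [->|_] /=; last first.
  by rewrite mulr1 mulr0 /sgb; clear e => /eqP; rewrite mulf_eq0 (gt_eqF r0) /=; case: b; rewrite ?oppr_eq0 oner_eq0.
rewrite !mulr1 => /mulfI; rewrite (gt_eqF r0) /sgb => /(_ isT); clear e.
have h1 : -1 <> 1 :> R by lra.
by case: b; case: c => // /esym.
Qed.

Lemma orth_full : is_full_polytope P.
Proof.
split; first by exists #|{: 'I_n * bool}|, (fun k : 'I_#|{: 'I_n * bool}| => q (enum_val k)); apply: orth_hull.
exists 0, (r%:M : 'M[R]_n); split.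
- by rewrite /orth /= big1 ?ltW // => i _; rewrite mxE normr0.
- by rewrite row_free_unit unitmxE det_scalar unitfE expf_neq0 // gt_eqF.
- move=> i; rewrite add0r.
  have -> : row i (r%:M : 'M[R]_n) = q (i, false).
    rewrite /orth_vertex /= mulr1; apply/rowP => j; rewrite !mxE eqxx /= eq_sym.
    by case: eqVneq => _; rewrite ?mulr1 ?mulr0.
  exact: orth_point.
- move=> x _; apply: submx_full; rewrite row_full_unit unitmxE det_scalar unitfE.
  by rewrite expf_neq0 // gt_eqF.
Qed.

Lemma orth_interior : interior P 0.
Proof.
have nn0 : (0 : R) < n%:R by rewrite ltr0n.
apply/nbhs_ballP; exists (r / n%:R); first by rewrite /= divr_gt0.
move=> x [_ hx]; rewrite /orth /=.
have -> : r = \sum_(i < n) r / n%:R.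
  by rewrite sumr_const card_ord -[RHS]mulr_natr divfK // gt_eqF.
apply: ler_sum => i _; have := hx 0 i.
by rewrite /ball /= mxE sub0r normrN => /ltW.
Qed.

End CrossPolytope.

Lemma orth_scale_equivalent (R : realType) n (r : R) : 0 < r ->
  combinatorially_equivalent (@orth R n r) (@cross_polytope R n).
Proof.
move=> r0; have rn0 : r != 0 by rewrite gt_eqF.
pose f (F : set 'rV[R]_n) := [set x | F (r *: x)].
have fI F x : f F (r^-1 *: x) <-> F x.
  by rewrite /f /= scalerA divff // scale1r.
have PQ x : orth r (r *: x) <-> @cross_polytope R n x.
  rewrite /orth /cross_polytope /=.
  under eq_bigr do rewrite mxE normrM gtr0_norm //.
  by rewrite -mulr_sumr ger_pMr.
have ff F : face (@orth R n r) F -> face (@cross_polytope R n) (f F).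
  move=> [u [a [ua ->]]]; exists (r *: u), a; split=> [x /PQ/ua|].
    by rewrite dotZr dotZl.
  apply/seteqP; split=> x; rewrite /f /= dotZl dotZr => -[/PQ ? ?]; split=> //.
exists f; split; last first.
  move=> F G _ _; split=> h x; first exact: h.
  by move=> Fx; apply/(fI G); apply: h; apply/(fI F).
split=> //.
  move=> F G _ _ e; apply/seteqP; split=> x hx.
    by apply/(fI G); rewrite -e; apply/(fI F).
  by apply/(fI F); rewrite e; apply/(fI G).
move=> H [u [a [ua HE]]]; exists [set x | H (r^-1 *: x)]; last first.
  by apply/seteqP; split=> x; rewrite /f /= scalerA mulVf // scale1r.
have PQ' x : orth r x <-> @cross_polytope R n (r^-1 *: x).
  by rewrite -PQ scalerA divff // scale1r.
exists (r^-1 *: u), a; split=> [x hx|].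
  by rewrite dotZl -dotZr; apply: ua; apply/PQ'.
by apply/seteqP; split=> x; rewrite HE /= dotZl dotZr => -[/PQ' h1 h2]; split.
Qed.

Lemma orth_midpoint (R : realType) n (r : R) (x y : 'rV[R]_n) :
  orth r x -> orth r y -> orth r (2^-1 *: (x + y)).
Proof.
rewrite /orth /= => hx hy; apply: (@le_trans _ _ (\sum_i 2^-1 * (`|x 0 i| + `|y 0 i|))).
  apply: ler_sum => i _; rewrite !mxE normrM gtr0_norm ?invr_gt0 //.
  by rewrite ler_pM2l ?invr_gt0 // ler_normD.
by rewrite -mulr_sumr big_split /=; lra.
Qed.

(** A vertex has the two other points on the same side of it along the line. The three positive
    products obtained in this way multiply to minus a square. *)
Lemma vertices_not_collinear (R : realType) n (P : set 'rV[R]_n) p A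
    (v1 v2 v3 : 'rV[R]_n) (t1 t2 t3 : R) :
  vertex P v1 -> vertex P v2 -> vertex P v3 ->
  v1 <> v2 -> v2 <> v3 -> v3 <> v1 ->
  v1 = p + t1 *: A -> v2 = p + t2 *: A -> v3 = p + t3 *: A -> False.
Proof.
move=> h1 h2 h3 n12 n23 n31 e1 e2 e3.
have key (a b c : 'rV[R]_n) ta tb tc : vertex P a -> vertex P b -> vertex P c ->
    b <> a -> c <> a -> a = p + ta *: A -> b = p + tb *: A -> c = p + tc *: A ->
    0 < (tb - ta) * (tc - ta).
  move=> va vb vc ba ca ea eb ec; have [u hu] := vertex_exposed va.
  have := hu _ (vertex_in vb) ba; have := hu _ (vertex_in vc) ca.
  rewrite ea eb ec !dotr => i1 i2.
  have j1 : (tc - ta) * dot u A < 0 by lra.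
  have j2 : (tb - ta) * dot u A < 0 by lra.
  have [uA|uA|uA] := ltrgt0P (dot u A).
  - by rewrite nmulr_rgt0; [rewrite pmulr_llt0 in j1|rewrite pmulr_llt0 in j2].
  - by rewrite pmulr_rgt0; [rewrite nmulr_llt0 in j1|rewrite nmulr_llt0 in j2].
  - by move: j1; rewrite uA mulr0 ltxx.
have k1 := key _ _ _ _ _ _ h1 h2 h3 (nesym n12) n31 e1 e2 e3.
have k2 := key _ _ _ _ _ _ h2 h3 h1 (nesym n23) n12 e2 e3 e1.
have k3 := key _ _ _ _ _ _ h3 h1 h2 (nesym n31) n23 e3 e1 e2.
have := mulr_gt0 (mulr_gt0 k1 k2) k3.
have -> : (t2 - t1) * (t3 - t1) * ((t3 - t2) * (t1 - t2)) * ((t1 - t3) * (t2 - t3))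
  = - ((t2 - t1) * (t3 - t1) * (t3 - t2)) ^+ 2 by ring.
by rewrite oppr_gt0 ltNge sqr_ge0.
Qed.

Section EdgeScribedOrthoplex.
Context {R : realType} {n : nat}.
Hypothesis (n2 : (1 < n)%N).
Local Notation s2 := (Num.sqrt 2 : R).
Local Notation P := (@orth R n s2).
Local Notation q := (@orth_vertex R n s2).

(** An edge contains at least two vertices, otherwise it is a single point, and at most two, since
    three are not collinear. These two are not opposite, so they are orthogonal and their midpoint
    is the contact point. *)
Lemma orth_edge_scribed : edge_scribed P.
Proof.
have s0 := sqrt2_gt0 R; have n1 : (0 < n)%N := ltnW n2.
have Pq p : P (q p) by apply: orth_point.
have vq p : vertex P (q p) by apply/orth_vertexP => //; exists p.
move=> e [[u [a [ua eE]]] [p0 [A [ep0 rA eA lA]]]].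
have A0 : A != 0 by move: rA; rewrite /row_free rank_rV; case: (A =P 0).
have rowA : row 0 A = A by apply/rowP => j; rewrite !mxE.
have line p : dot u (q p) = a -> exists t, q p = p0 + t *: A.
  move=> hp; have /lA/sub_rVP[t ht] : e (q p) by rewrite eE; split.
  by exists t; rewrite -ht addrC subrK.
have comb x : e x -> exists w : 'I_n * bool -> R, [/\ forall t, 0 <= w t,
    \sum_t w t = 1, x = \sum_t w t *: q t & forall t, w t != 0 -> dot u (q t) = a].
  rewrite eE => -[]; rewrite {1}orth_hull // => /hull_finType[w [w0 w1 ->]] /= hx.
  exists w; split=> // t wt.
  have := @hull_max R n _ (fun k : 'I_#|{: 'I_n * bool}| => q (enum_val k)) u a (fun k => w (enum_val k)).
  have bij := onW_bij predT (@enum_val_bij {: 'I_n * bool}).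
  move=> /(_ (fun i => ua _ (Pq _)) (fun i => w0 _)).
  rewrite -[X in X = 1 -> _](reindex _ (F := w) bij) //= => /(_ w1).
  rewrite -[X in dot u X = a -> _](reindex _ (F := fun t => w t *: q t) bij) //= => /(_ hx (enum_rank t)).
  by rewrite enum_rankK; apply.
have [p [p' [pp' hp hp']]] : exists p p', [/\ p <> p', dot u (q p) = a & dot u (q p') = a].
  apply: contrapT => hn.
  have uniq x y : e x -> e y -> x = y.
    move=> /comb[w [w0 w1 -> wu]] /comb[w' [w0' w1' -> wu']].
    have [t wt] : exists t, w t != 0.
      apply: contrapT => h; move: w1; rewrite big1 => [/eqP|t _]; first by rewrite eq_sym oner_eq0.
      by apply/eqP; apply: contrapT => hi; apply: h; exists t; apply/negP.
    have one z (W : 'I_n * bool -> R) : (forall t, W t != 0 -> dot u (q t) = a) ->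
        \sum_t W t = 1 -> z = \sum_t W t *: q t -> z = q t.
      move=> Wu W1 ->; rewrite -[RHS]scale1r -W1 scaler_suml; apply: eq_bigr => t' _.
      have [->|Wt] := eqVneq (W t') 0; first by rewrite !scale0r.
      have [<-//|tt] := pselect (t = t'); exfalso; apply: hn; exists t, t'.
      by split=> //; [apply: wu|apply: Wu].
    by rewrite (one _ w wu w1 erefl) (one _ w' wu' w1' erefl).
  have := uniq _ _ ep0 (eA 0); rewrite rowA => /eqP.
  by rewrite -subr_eq0 opprD addNKr oppr_eq0 (negbTE A0).
have only t : dot u (q t) = a -> t = p \/ t = p'.
  move=> ht; apply: contrapT => /not_orP[tp tp'].
  have [t1 e1] := line _ hp; have [t2 e2] := line _ hp'; have [t3 e3] := line _ ht.
  have qi := @orth_vertex_inj R n _ s0.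
  apply: (vertices_not_collinear (vq p) (vq p') (vq t) _ _ _ e1 e2 e3).
  - by move=> /qi/pp'.
  - by move=> /qi/esym/tp'.
  - by move=> /qi/tp.
have p1 : p.1 != p'.1.
  apply/eqP => e1.
  have bn : p'.2 = ~~ p.2.
    case: p p' pp' e1 {hp hp' only} => [i b] [j c] /= pp' e1; rewrite e1 in pp'.
    by case: b c pp' => [] [].
  (* Opposite vertices at the same level force this level to be 0; then every vertex lies at level
     0, which contradicts [only]. *)
  have a0 : a = 0.
    move: hp hp'; rewrite !dot_orth_vertexr // e1 bn.
    by rewrite /sgb; case: p.2 => /=; lra.
  have all0 t : dot u (q t) = a.
    have := ua _ (Pq t); have := ua _ (Pq (t.1, ~~ t.2)); rewrite a0 !dot_orth_vertexr //=.
    by rewrite /sgb; case: t.2 => /=; lra.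
  have [i ip] : exists i, i != p.1.
    pose i0 := Ordinal n1; pose i1 := Ordinal n2.
    have [h|h] := eqVneq p.1 i0; last by exists i0; rewrite eq_sym.
    by exists i1; rewrite h.
  have [] := only (i, false) (all0 _) => h.
    by move: ip; rewrite -h eqxx.
  by move: ip; rewrite e1 -h eqxx.
pose x0 := 2^-1 *: (q p + q p').
have qq : dot (q p) (q p') = 0.
  rewrite dot_orth_vertexr // /orth_vertex !mxE eqxx /= eq_sym (negbTE p1).
  by rewrite !mulr0.
have x0p : dot x0 (q p) = 1.
  rewrite dotZl dotDl orth_vertex_norm (dotC (q p')) qq addr0 expr2 sqrt2_sqr; lra.
have x0p' : dot x0 (q p') = 1.
  rewrite dotZl dotDl orth_vertex_norm qq add0r expr2 sqrt2_sqr; lra.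
exists x0; split.
- rewrite eE; split; last by rewrite /= dotZr dotDr hp hp'; lra.
  exact: orth_midpoint.
- by apply/enorm_eq1; rewrite {2}/x0 dotZr dotDr x0p x0p'; lra.
- move=> y /comb[w [w0 w1 -> wu]]; rewrite dotBr {2}/x0 dotZr dotDr x0p x0p' dot_sumr.
  rewrite (eq_bigr w) => [|t _]; first by rewrite w1; lra.
  have [->|wt] := eqVneq (w t) 0; first by rewrite mul0r.
  by have [->|->] := only t (wu t wt); rewrite ?x0p ?x0p' mulr1.
Qed.

Lemma orth_polarP (sg : 'I_n -> bool) :
  vertex (polar P) (\row_i (s2^-1 * sgb (sg i))).
Proof.
have s0 := sqrt2_gt0 R; have n1 : (0 < n)%N := ltnW n2.
have pE y : polar P y <-> forall p, dot (q p) y <= 1.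
  by apply: polarE; [apply: orth_full|apply: orth_vertexP].
have yE y : polar P y -> forall i, sgb (sg i) * y 0 i <= s2^-1.
  move=> /pE h i; have := h (i, sg i); rewrite dotC dot_orth_vertexr //= => hi.
  by rewrite -[leRHS]mulr1 -ler_pdivrMl ?invr_gt0 // invrK mulrA.
have ss b : sgb b * sgb b = 1 :> R by rewrite /sgb; case: b; ring.
have dE y : dot (\row_i sgb (sg i)) y = \sum_i sgb (sg i) * y 0 i :> R.
  by apply: eq_bigr => i _; rewrite mxE.
exists (\row_i sgb (sg i)), (\sum_(i < n) s2^-1); split=> [y /yE h|].
  by rewrite dE; apply: ler_sum.
apply/seteqP; split=> [_ ->|y [/yE h /=]].
  split.
    apply/pE => -[i b]; rewrite dotC dot_orth_vertexr // !mxE /=.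
    have -> : s2 * sgb b * (s2^-1 * sgb (sg i)) = sgb b * sgb (sg i).
      by field; apply: sqrt2_neq0.
    by rewrite /sgb; case: b; case: (sg i); lra.
  by rewrite /= dE; apply: eq_bigr => i _; rewrite mxE mulrCA ss mulr1.
rewrite dE => e; apply/rowP => i; rewrite mxE.
have : \sum_i (s2^-1 - sgb (sg i) * y 0 i) = 0 by rewrite sumrB e subrr.
move/eqP; rewrite psumr_eq0 => [/allP/(_ i (mem_index_enum i))|j _]; last by rewrite subr_ge0.
by rewrite /= subr_eq0 => /eqP ->; rewrite mulrC mulrA ss mul1r.
Qed.

(** If neither vertex on the axis [i] were tight at [y], the direction of that axis would be
    orthogonal to all tight vertices. *)
Lemma orth_polar_vertex y : vertex (polar P) y ->
  exists sg : 'I_n -> bool, y = \row_i (s2^-1 * sgb (sg i)).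
Proof.
have s0 := sqrt2_gt0 R; have n1 : (0 < n)%N := ltnW n2.
have vP := @orth_vertexP R n s2 s0 n1; have fP := @orth_full R n s2 s0 n1.
move=> vy; have /(polarE fP vP) hy := vertex_in vy.
have hy' i b : s2 * sgb b * y 0 i <= 1 by have := hy (i, b); rewrite dotC dot_orth_vertexr.
exists (fun i => y 0 i < 0); apply/rowP => i; rewrite mxE.
have [p hp] : exists b, s2 * sgb b * y 0 i = 1.
  apply: contrapT => hn; have : delta_mx 0 i = 0 :> 'rV[R]_n.
    apply: (polar_vertex_tight fP vP vy) => -[j b].
    rewrite !(dotC (q _)) !dot_orth_vertexr //= mxE eqxx /=.
    case: eqVneq => [->|_]; last by rewrite mulr0.
    by move=> h; exfalso; apply: hn; exists b.
  by move=> /rowP/(_ i)/eqP; rewrite !mxE !eqxx oner_eq0.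
have yE : y 0 i = s2^-1 * sgb p.
  have ss : sgb p * sgb p = 1 :> R by rewrite /sgb; case: p {hp}; ring.
  rewrite -[RHS]mulr1 -[X in _ = _ * X]hp.
  have -> : s2^-1 * sgb p * (s2 * sgb p * y 0 i) = (s2^-1 * s2) * (sgb p * sgb p) * y 0 i by ring.
  by rewrite mulVf ?sqrt2_neq0 // ss !mul1r.
rewrite yE; congr (_ * sgb _).
rewrite /sgb; case: p {hp yE}; first by rewrite mulrN1 oppr_lt0 invr_gt0 s0.
by rewrite mulr1 ltNge invr_ge0 ltW.
Qed.

End EdgeScribedOrthoplex.

(** * Moebius maps with prescribed curvature functional *)

(** A future null vector is a positive multiple of the ray of a point. An inversion centred there
    sends this point to infinity, and its radius absorbs the multiple. If the point is infinity
    already, two concentric inversions provide the scaling. *)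
Lemma moebius_null (R : realType) d (v : 'rV[R]_d) a t :
  dot v v + a * a = t * t -> 0 < t ->
  exists mu L, [/\ moebius mu, mlift mu L & lvec v a t *m L = npt None].
Proof.
have inv c r : 0 < r -> moebius (sphere_inversion c r : hatR R d -> _).
  move=> r0; apply: generated_group_gen; exists (inner_ball c r).
  exact: InnerInversion.
have scale (k : R) : 0 < k -> exists2 r, 0 < r & k * r ^+ 2 = 1.
  move=> k0; exists (Num.sqrt k)^-1; first by rewrite invr_gt0 sqrtr_gt0.
  by rewrite exprVn sqr_sqrtr ?ltW // divff // gt_eqF.
move=> h t0; have [at_|ta] := eqVneq a t.
  have v0 : v = 0 by apply/eqP; rewrite -dot_eq0; move: h; rewrite at_ => h; apply/eqP; lra.
  have [r r0 hr] := scale t t0.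
  exists (sphere_inversion 0 r \o sphere_inversion 0 1).
  exists (refl (sphere_vec 0 1) *m refl (sphere_vec 0 r)); split.
  - by apply: generated_group_comp; apply: inv.
  - by apply: lift_comp; apply: lift_sphere_inversion.
  - have -> : lvec v a t = t *: npt None by rewrite v0 at_ lvecZ scaler0 mulr1.
    rewrite mulmxA -scalemxAl refl_sphere_infty // expr1n invr1 scale1r.
    by rewrite -scalemxAl refl_sphere_center // scalerA hr scale1r.
have k0 : 0 < t - a.
  have := dot_ge0 v; rewrite subr_gt0 lt_neqAle ta /= => v0; nra.
have k1 : 0 < (t - a) / 2 by rewrite divr_gt0.
have kn : t - a != 0 by rewrite gt_eqF.
have [r r0 hr] := scale _ k1.
have -> : lvec v a t = ((t - a) / 2) *: npt (Some ((t - a)^-1 *: v)).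
  have e : dot v v = t * t - a * a by lra.
  rewrite /npt lvecZ !(dotl, dotr) e !scalerA; congr lvec; [|by field|by field].
  by rewrite -[LHS]scale1r; congr (_ *: _); field.
exists (sphere_inversion ((t - a)^-1 *: v) r), (refl (sphere_vec ((t - a)^-1 *: v) r)).
split; [exact: inv|exact: lift_sphere_inversion|].
by rewrite -scalemxAl refl_sphere_center // scalerA hr scale1r.
Qed.

(** * Balls and dual inversions of polytopal packings *)

Section PackingModel.
Context (R : realType) (d : nat) (d_gt0 : (0 < d)%N) (B : polytopal_packing R d).
Context (L : 'M[R]_(d + 1 + 1)) (muL : mlift (moebius_map B) L).
Local Notation P := (tangency_polytope B).

Lemma mu_image V : moebius_map B @` bset V = bset (V *m L).
Proof.
have [_ [h [_ [_ _ _ hg]]]] := moebius_lift (moebius_mapP B).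
exact: lift_image muL hg.
Qed.

Lemma polytope_vertex_gt1 v : vertex P v -> 1 < dot v v.
Proof. by move=> /tangency_polytope_outside; rewrite lt_enorm // expr1n. Qed.

Lemma bset_uvec (v : 'rV[R]_(d + 1)) : 1 < dot v v ->
  bset (hvec v *m L) = bset (uvec v *m L).
Proof.
move=> v1; rewrite /uvec -scalemxAl bsetZ // invr_gt0 sqrtr_gt0 subr_gt0 //.
Qed.

Lemma ballsP b : balls B b <-> exists2 v, vertex P v & b = bset (uvec v *m L).
Proof.
split=> [[_ [v vv <-] <-]|[v vv ->]].
  have v1 := polytope_vertex_gt1 vv; exists v => //.
  by rewrite stereographic_cap // mu_image bset_uvec.
have v1 := polytope_vertex_gt1 vv; exists (stereographic @` visible_cap v).
  by exists v.
by rewrite stereographic_cap // mu_image bset_uvec.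
Qed.

Lemma dual_inversion b s : dual_balls B b -> boundary_inversion b s ->
  exists y, [/\ vertex (polar P) y, 1 < dot y y & mlift s (refl (hvec y *m L))].
Proof.
move=> [_ [y vy <-] <-] hs; exists y.
have y1 : 1 < dot y y.
  rewrite ltNge; apply/negP => y1.
  (* From a point of the closed ball nothing is visible, and the empty set is not a ball, so it
     bounds no inversion. *)
  have cap0 : visible_cap y = set0.
    apply/seteqP; split=> // x [_ /(_ 0)]; rewrite lexx ltr01 => /(_ isT).
    by rewrite subr0 scale1r scale0r addr0 lt_enorm // expr1n ltNge y1.
  move: hs; rewrite cap0 !image_set0; case=> [c r r0|c r r0|n a n0] e.
  - have : (set0 : set (hatR R d)) (Some c).
      by rewrite e; exists c => //=; rewrite subrr /enorm dot0l sqrtr0 ltW.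
    by [].
  - have : (set0 : set (hatR R d)) None by rewrite e; left.
    by [].
  - have : (set0 : set (hatR R d)) None by rewrite e; left.
    by [].
split=> //; move: hs; rewrite stereographic_cap // mu_image.
apply: boundary_inversion_lift => //.
by rewrite lorM ?lorE ?mulr1 ?subr_gt0 //; case: muL.
Qed.

Lemma dual_inversion_exists y : vertex (polar P) y -> 1 < dot y y ->
  exists2 s, apollonian_group B s & mlift s (refl (hvec y *m L)).
Proof.
move=> vy y1; have hL : 0 < lor (hvec y *m L) (hvec y *m L).
  by rewrite lorM ?lorE ?mulr1 ?subr_gt0 //; case: muL.
have [s hs] := boundary_inversion_exists hL; exists s; last exact: boundary_inversion_lift hs.
apply: generated_group_gen; exists (bset (hvec y *m L)) => //.
exists (stereographic @` visible_cap y); first by exists y.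
by rewrite stereographic_cap // mu_image.
Qed.

End PackingModel.

(** * The orthoplicial packing *)

(** The vertices of the orthoplex and those of its polar both have squared norm 2, so [ovec] and
    [fvec] are unit vectors without further scaling. *)
Definition ovec {R : realType} (p : 'I_(3 + 1) * bool) : 'rV[R]_(3 + 1 + 1) :=
  hvec (orth_vertex (Num.sqrt 2) p).

Definition fvec {R : realType} (sg : 'I_(3 + 1) -> bool) : 'rV[R]_(3 + 1 + 1) :=
  hvec (\row_i ((Num.sqrt 2)^-1 * sgb (sg i))).

Section Orthoplicial.
Context {R : realType}.
Local Notation s2 := (Num.sqrt 2 : R).
Implicit Types (p : 'I_(3 + 1) * bool) (sg : 'I_(3 + 1) -> bool).

Lemma orth4_outside (v : 'rV[R]_(3 + 1)) : vertex (orth s2) v -> 1 < enorm v.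
Proof.
move=> /(orth_vertexP (sqrt2_gt0 R) (isT : (0 < 3 + 1)%N))[p ->].
by rewrite lt_enorm // orth_vertex_norm sqr_sqrtr // expr1n; lra.
Qed.

Definition orthoplicial_packing mu (hmu : moebius mu) : polytopal_packing R 3 :=
  @PolytopalPacking R 3 (orth s2) mu (orth_full (sqrt2_gt0 R) (isT : (0 < 3 + 1)%N))
    (orth_interior (sqrt2_gt0 R) (isT : (0 < 3 + 1)%N)) orth4_outside (orth_edge_scribed (isT : (1 < 3 + 1)%N)) hmu.

Lemma orthoplicial_packingP mu (hmu : moebius mu) :
  orthoplicial (orthoplicial_packing hmu).
Proof. exact: orth_scale_equivalent (sqrt2_gt0 R). Qed.

Lemma sgb_sqr b : sgb b * sgb b = 1 :> R.
Proof. by rewrite /sgb; case: b; ring. Qed.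

Lemma ovec_uvec p : uvec (orth_vertex s2 p) = ovec p.
Proof.
rewrite /uvec orth_vertex_norm sqr_sqrtr //.
by rewrite (_ : 2 - 1 = 1) ?sqrtr1 ?invr1 ?scale1r //; ring.
Qed.

Lemma lor_ovec_fvec p sg : lor (ovec p) (fvec sg) = sgb p.2 * sgb (sg p.1) - 1 :> R.
Proof.
rewrite /ovec /fvec lorE mulr1 dotC dot_orth_vertexr mxE.
by congr (_ - _); field; apply: sqrt2_neq0.
Qed.

Lemma lor_ovec p : lor (ovec p) (ovec p) = 1 :> R.
Proof.
by rewrite /ovec lorE mulr1 orth_vertex_norm sqr_sqrtr //; ring.
Qed.

Lemma dot_sign_row sg :
  dot (\row_i (s2^-1 * sgb (sg i))) (\row_i (s2^-1 * sgb (sg i))) = 2 :> R.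
Proof.
rewrite /dot (eq_bigr (fun _ => 2^-1)) => [|i _].
  by rewrite sumr_const card_ord; lra.
by rewrite !mxE mulrACA sgb_sqr mulr1 -invfM sqrt2_sqr.
Qed.

Lemma lor_fvec sg : lor (fvec sg) (fvec sg) = 1 :> R.
Proof. by rewrite /fvec lorE dot_sign_row mulr1; ring. Qed.

(** A facet reflection fixes a vertex or adds [4 *: fvec sg] to it, so this multiple has to be an
    integer combination of vertices. The four vertices of the facet produce the spatial part, and an
    opposite pair, which sums to [row_mx 0 2], corrects the time. *)
Lemma fvec_lattice sg : 4 *: fvec sg = 2 *: (\sum_i ovec (i, sg i))
   - 2 *: (ovec (0, false) + ovec (0, true)) :> 'rV[R]_(3 + 1 + 1).
Proof.
have -> : ovec (0, false) + ovec (0, true) = row_mx 0 2%:M :> 'rV[R]_(3 + 1 + 1).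
  rewrite /ovec /hvec add_row_mx -raddfD; congr row_mx.
  by rewrite /orth_vertex /sgb /= -scalerDl mulr1 mulrN1 subrr scale0r.
have -> : \sum_i ovec (i, sg i) = row_mx (\row_i (s2 * sgb (sg i))) 4%:M.
  rewrite /ovec /hvec.
  rewrite (eq_bigr (fun i => row_mx (orth_vertex s2 (i, sg i)) 0 + row_mx 0 1%:M)); last first.
    by move=> i _; rewrite add_row_mx addr0 add0r.
  rewrite big_split /= sumr_const card_ord.
  have -> : \sum_(i < 3 + 1) row_mx (orth_vertex s2 (i, sg i)) (0 : 'M[R]_1) =
     row_mx (\row_i (s2 * sgb (sg i))) 0.
    apply/rowP => j; rewrite summxE; rewrite -[j]splitK; case: (fintype.split j) => k /=.
      rewrite row_mxEl mxE (bigD1 k) //= big1 => [|i ik].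
        by rewrite row_mxEl /orth_vertex !mxE !eqxx addr0 mulr1.
      by rewrite row_mxEl /orth_vertex !mxE eq_sym (negbTE ik) andbF mulr0.
    rewrite row_mxEr mxE big1 // => i _; by rewrite row_mxEr mxE.
  rewrite -(scaler_nat (3 + 1)%N (row_mx 0 1%:M)) scale_row_mx scaler0 scale_scalar_mx mulr1 add_row_mx addr0.
  by rewrite add0r.
rewrite /fvec /hvec !scale_row_mx !scale_scalar_mx scaler0 opp_row_mx add_row_mx oppr0 addr0.
congr row_mx; last by rewrite -raddfB /=; congr (_%:M); ring.
apply/rowP => i; rewrite !mxE mulrA; have h := sqrt2_sqr R.
rewrite sqrt2V.
by field.
Qed.

Section WithMap.
Context (mu : hatR R 3 -> hatR R 3) (hmu : moebius mu) (L : 'M[R]_(3 + 1 + 1)).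
Hypothesis muL : mlift mu L.
Local Notation B := (orthoplicial_packing hmu).

Lemma orthoplicial_balls b : balls B b <-> exists p, b = bset (ovec p *m L).
Proof.
have h := @ballsP R 3 B L muL b; split=> [/h[v]|[p bE]].
  move=> /(orth_vertexP (sqrt2_gt0 R) (isT : (0 < 3 + 1)%N))[p ->] ->.
  by exists p; rewrite -ovec_uvec.
apply/h; exists (orth_vertex s2 p); last by rewrite bE ovec_uvec.
by apply/orth_vertexP; [apply: sqrt2_gt0|..|exists p].
Qed.

Lemma orthoplicial_dual b s : dual_balls B b -> boundary_inversion b s ->
  exists sg, mlift s (refl (fvec sg *m L)).
Proof.
move=> h1 h2; have [y [vy _ hy]] := @dual_inversion R 3 isT B L muL b s h1 h2.
have [sg e] := orth_polar_vertex (isT : (1 < 3 + 1)%N) vy.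
by exists sg; rewrite /fvec -e.
Qed.

Lemma orthoplicial_reflection sg :
  exists2 s, apollonian_group B s & mlift s (refl (fvec sg *m L)).
Proof.
apply: (@dual_inversion_exists R 3 isT B L muL).
  exact: (orth_polarP (isT : (1 < 3 + 1)%N)).
by rewrite dot_sign_row; lra.
Qed.

Definition in_lattice (x : 'rV[R]_(3 + 1 + 1)) : Prop :=
  exists c : 'I_(3 + 1) * bool -> int, x = \sum_p (c p)%:~R *: ovec p.

Lemma in_latticeD x y : in_lattice x -> in_lattice y -> in_lattice (x + y).
Proof.
move=> [c ->] [c' ->]; exists (fun p => c p + c' p); rewrite -big_split /=.
by apply: eq_bigr => p _; rewrite intrD scalerDl.
Qed.

Lemma in_latticeZ (z : int) x : in_lattice x -> in_lattice (z%:~R *: x).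
Proof.
move=> [c ->]; exists (fun p => z * c p); rewrite scaler_sumr.
by apply: eq_bigr => p _; rewrite intrM scalerA.
Qed.

Lemma in_lattice_ovec p : in_lattice (ovec p).
Proof.
exists (fun p' => (p' == p)%:Z); rewrite (bigD1 p) //= eqxx scale1r big1 ?addr0 //.
by move=> p' /negbTE ->; rewrite scale0r.
Qed.

Lemma in_lattice_sum (I : finType) (F : I -> 'rV[R]_(3 + 1 + 1)) :
  (forall i, in_lattice (F i)) -> in_lattice (\sum_i F i).
Proof.
move=> h; apply: (big_ind in_lattice) => //; last exact: in_latticeD.
by exists (fun=> 0); rewrite big1 // => p _; rewrite scale0r.
Qed.

Lemma in_lattice_refl sg x : in_lattice x -> in_lattice (x *m refl (fvec sg)).
Proof.
have h4 : in_lattice (4 *: fvec sg).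
  rewrite fvec_lattice; apply: in_latticeD.
    apply: (in_latticeZ (2 : int)); apply: in_lattice_sum => i; exact: in_lattice_ovec.
  rewrite -scaleNr; apply: (in_latticeZ (- 2 : int)).
  apply: in_latticeD; exact: in_lattice_ovec.
move=> [c ->]; rewrite mulmx_suml; apply: in_lattice_sum => p.
rewrite -scalemxAl; apply: in_latticeZ; rewrite mul_refl lor_fvec divr1 lor_ovec_fvec.
have [e|e] : sgb p.2 * sgb (sg p.1) = 1 :> R \/ sgb p.2 * sgb (sg p.1) = -1 :> R.
- by rewrite /sgb; case: p.2; case: (sg _); [left|right|right|left]; ring.
- by rewrite e subrr mulr0 scale0r subr0; apply: in_lattice_ovec.
- rewrite e -scaleNr (_ : - (2 * (-1 - 1)) = 4); last by ring.
  by apply: in_latticeD => //; apply: in_lattice_ovec.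
Qed.

Lemma orthoplicial_integral :
  (forall p, exists z : int, curv (ovec p *m L) = z%:~R) ->
  integral_packing (apollonian_packing B).
Proof.
move=> hz b [g [Ag [c [/orthoplicial_balls[p ->] ->]]]].
have lL : lorentz L by case: muL.
have [||s|M [h [M' [gM _ _ hg hM]]]] := @generated_group_lift R 3 _
  (fun _ M => forall x, in_lattice x ->
     exists2 y, in_lattice y & x *m L *m M = y *m L) _ _ _ g Ag.
- by move=> x hx; exists x => //; rewrite mulmx1.
- move=> _ _ M M' hM hM' x /hM'[y /hM[z hz' e2] e1]; exists z => //.
  by rewrite mulmxA e1 e2.
- move=> [b' hb' /(orthoplicial_dual hb')[sg hs]]; exists (refl (fvec sg *m L)); split=> //.
    by rewrite refl_refl // lorM // lor_fvec oner_eq0.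
  move=> x hx; exists (x *m refl (fvec sg)); first exact: in_lattice_refl.
  by rewrite refl_mul // (mulmxA (x *m L)) (mulmxA (x *m L)) mulmxK_adj.
rewrite (lift_image _ gM hg); have [y [c0 ye] e] := hM _ (in_lattice_ovec p).
have [z hcz] : exists z : int, curv (y *m L) = z%:~R.
  rewrite ye mulmx_suml; elim/big_ind: _ => [|x x' [z1 e1] [z2 e2]|p' _].
  - by exists 0; rewrite -(scale0r 0) curvZ mul0r.
  - by exists (z1 + z2); rewrite curvD e1 e2 intrD.
  - have [z1 e1] := hz p'; exists (c0 p' * z1).
    by rewrite -scalemxAl curvZ e1 intrM.
exists z; rewrite e; apply/(@has_curvature_bset R 3 isT); last by rewrite hcz.
have lM : lorentz M by case: gM.
by rewrite -e !lorM // lor_ovec.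
Qed.

End WithMap.
End Orthoplicial.

(** * Embedding a disk packing into an orthoplicial packing *)

(** Both sides are the half-turn that is -1 on the plane of [a] and [b] and the identity on its
    orthogonal; any orthogonal basis of the plane yields it, in particular [a + b], [a - b]. *)
Lemma refl_rotate (R : realType) n (a b : 'rV[R]_(n + 1)) :
  lor a b = 0 -> lor a a = lor b b -> lor a a != 0 ->
  refl a *m refl b = refl (a + b) *m refl (a - b).
Proof.
move=> ab aa a0; apply: eq_mx_rows => u; rewrite !mulmxA !mul_refl !lorl !lorr.
rewrite (lorC b a) ab -aa; apply/rowP => i; rewrite !mxE; field.
by apply/andP; split=> //; rewrite (_ : _ + _ = 2 * lor a a) ?mulf_neq0 //; ring.
Qed.

Definition ltime {R : realType} {n : nat} (u : 'rV[R]_(n + 1)) : R := rsubmx u 0 0.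

Lemma ltime_row_mx (R : realType) n (u : 'rV[R]_n) t : ltime (row_mx u t%:M) = t.
Proof. by rewrite /ltime row_mxKr mxE eqxx. Qed.

Lemma ltimeZ (R : realType) n k (u : 'rV[R]_(n + 1)) : ltime (k *: u) = k * ltime u.
Proof. by rewrite /ltime linearZ mxE. Qed.

Lemma ltimeD (R : realType) n (u v : 'rV[R]_(n + 1)) : ltime (u + v) = ltime u + ltime v.
Proof. by rewrite /ltime linearD mxE. Qed.

Definition has_orthoplicial_section {R : realType} (B : polytopal_packing R 2) :=
  exists B' : polytopal_packing R 3,
    [/\ orthoplicial B',
        exists (G : set (hatR R 3 -> hatR R 3)) (X : set (set (hatR R 3))),
          is_apollonian_section B' G X /\
          arithmetically_equivalent (apollonian_group B) (balls B) G X &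
        integral_packing (apollonian_packing B) <->
        integral_packing (apollonian_packing B')].

Section Assemble.
Context (R : realType) (B : polytopal_packing R 2) (I Jx : Type).
Context (Vs : I -> 'rV[R]_(2 + 1 + 1)) (Fs : Jx -> 'rV[R]_(2 + 1 + 1)).
Context (L : 'M[R]_(2 + 1 + 1)) (nu : 'rV[R]_(2 + 1 + 1)).
Hypothesis lL : lorentz L.
Hypothesis ballsE : forall b, balls B b <-> exists i, b = bset (Vs i *m L).
Hypothesis dualE : forall b s, dual_balls B b -> boundary_inversion b s ->
  exists j, mlift s (refl (Fs j *m L)).
Hypothesis curvE : forall x, curv (x *m L) = - lor x nu.
Hypotheses (nu0 : lor nu nu = 0) (nu_gt0 : 0 < ltime nu).
Hypotheses (Vs1 : forall i, lor (Vs i) (Vs i) = 1)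
  (Fs0 : forall j, lor (Fs j) (Fs j) != 0).

(* [J0] is a conformal embedding of Lorentz spaces with factor [s], and [w0]
   spans the orthogonal of its image. *)
Context (J0 : 'M[R]_(2 + 1 + 1, 3 + 1 + 1)) (s : R) (w0 : 'rV[R]_(3 + 1 + 1)).
Hypotheses (s0 : 0 < s) (J0_conf : forall x y, lor (x *m J0) (y *m J0) = s * lor x y)
  (J0_orth : forall x, lor (x *m J0) w0 = 0) (w00 : lor w0 w0 != 0).
Hypothesis J0_last : forall x, 0 < ltime x -> 0 < ltime (x *m J0).
Context (om : I -> R) (vi : I -> 'I_(3 + 1) * bool).
Hypothesis VsE : forall i, ovec (vi i) = Vs i *m J0 + om i *: w0.
Context (chi : 'M[R]_(2 + 1 + 1) -> R) (Pm : 'M[R]_(2 + 1 + 1) -> Prop).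
Hypotheses (chi1 : chi 1%:M = 1)
  (chiM : forall M M', chi (M *m M') = chi M * chi M').
Hypotheses (Pm1 : Pm 1%:M) (PmM : forall M M', Pm M -> Pm M' -> Pm (M *m M'))
  (Pm_refl : forall j, Pm (refl (Fs j))).
Hypothesis om_chi : forall M, Pm M -> forall i, om i * chi M = om i.
Hypothesis om_inj : forall M M' i j, Pm M -> Pm M' ->
  Vs i *m M = Vs j *m M' -> om i = om j.
(** Either the reflection extends by the identity on [w0] and is a facet reflection of the
    orthoplex, or it extends by -1 on [w0] and is the half-turn in the plane of [Fs j *m J0] and
    [w0], which [refl_rotate] splits into two facet reflections. *)
Hypothesis facets : forall j,
  (chi (refl (Fs j)) = 1 /\ exists k sg, k != 0 /\ Fs j *m J0 = k *: fvec sg) \/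
  (chi (refl (Fs j)) = -1 /\ lor (Fs j *m J0) (Fs j *m J0) = lor w0 w0 /\
   exists k sg sg', [/\ k != 0, Fs j *m J0 + w0 = k *: fvec sg &
                        Fs j *m J0 - w0 = k *: fvec sg']).
Hypothesis integers : (forall i, exists z : int, - lor (Vs i) nu = z%:~R) ->
  forall p, exists z : int, - lor (ovec p) (s^-1 *: (nu *m J0)) = z%:~R.

(** The Lorentz adjoint of [J0] divided by its conformal factor: inverse to [J0] on its image and
    zero on [w0]. *)
Let K0 : 'M[R]_(3 + 1 + 1, 2 + 1 + 1) := s^-1 *: (leta *m J0^T *m leta).
Let k0 : 'cV[R]_(3 + 1 + 1) := (lor w0 w0)^-1 *: (leta *m w0^T).

Let sn0 : s != 0. Proof. by rewrite gt_eqF. Qed.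

Let lor_mx n (x y : 'rV[R]_(n + 1)) : x *m leta *m y^T = (lor x y)%:M.
Proof. exact: mx11_scalar. Qed.

Let J0K0 : J0 *m K0 = 1%:M.
Proof.
have conf : J0 *m leta *m J0^T = s *: leta.
  apply: eq_mx_rows => x; apply/eqP; rewrite -subr_eq0 -dot_eq0; apply/eqP.
  have h y : dot (x *m (J0 *m leta *m J0^T) - x *m (s *: leta)) y = 0.
    rewrite dotBl !dotE -scalemxAr -scalemxAl [X in _ - X]mxE.
    have := J0_conf x y; rewrite /lor trmx_mul !mulmxA => ->.
    by rewrite subrr.
  exact: h.
rewrite /K0 -scalemxAr !mulmxA conf -scalemxAl scalerA mulVf // scale1r.
exact: eta_sqr.
Qed.

Let w0K0 : w0 *m K0 = 0.
Proof.
rewrite /K0 -scalemxAr !mulmxA; suff -> : w0 *m leta *m J0^T = 0 by rewrite mul0mx scaler0.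
apply/eqP; rewrite -dot_eq0; apply/eqP.
have h y : dot (w0 *m leta *m J0^T) y = 0.
  by rewrite dotE -[RHS](J0_orth y) lorC /lor trmx_mul !mulmxA.
exact: h.
Qed.

Let J0k0 : J0 *m k0 = 0.
Proof.
rewrite /k0 -scalemxAr mulmxA; apply/eqP; rewrite scaler_eq0; apply/orP; right.
apply/eqP; apply: eq_mx_rows => x; rewrite mulmx0 !mulmxA lor_mx J0_orth.
by rewrite raddf0.
Qed.

Let w0k0 : w0 *m k0 = 1%:M.
Proof. by rewrite /k0 -scalemxAr mulmxA lor_mx scale_scalar_mx mulVf. Qed.

(** Stacking [J0] and [w0] gives a square matrix, for which a right inverse is also a left
    inverse. *)
Let K0J0 : K0 *m J0 + k0 *m w0 = 1%:M.
Proof.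
have := @mulmx1C R (2 + 1 + 1 + 1) (col_mx J0 w0) (row_mx K0 k0).
rewrite mul_col_row J0K0 J0k0 w0K0 w0k0 -scalar_mx_block => /(_ erefl) <-.
by rewrite mul_row_col.
Qed.

Let Phi := section_mx J0 K0 w0 k0 chi.

Let decomp (y : 'rV[R]_(3 + 1 + 1)) : exists x a, y = x *m J0 + a *: w0.
Proof.
exists (y *m K0), ((y *m k0) 0 0).
rewrite -mul_scalar_mx -mx11_scalar -!mulmxA -mulmxDr K0J0 mulmx1 //.
Qed.

Let PhiE M x a : (x *m J0 + a *: w0) *m Phi M = x *m M *m J0 + (a * chi M) *: w0.
Proof.
exact: section_mx_act.
Qed.

Let refl_J0 F x a : lor F F != 0 ->
  (x *m J0 + a *: w0) *m refl (F *m J0) = x *m refl F *m J0 + a *: w0.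
Proof.
move=> F0; rewrite !mul_refl !lorl J0_conf (lorC w0) J0_orth mulr0 addr0 J0_conf.
rewrite mulmxBl -scalemxAl addrAC; congr (_ - _ *: _ + _).
by field; rewrite F0 sn0.
Qed.

Let Phi_refl1 F : lor F F != 0 -> chi (refl F) = 1 -> Phi (refl F) = refl (F *m J0).
Proof.
move=> F0 hc; apply: eq_mx_rows => y; have [x [a ->]] := decomp y.
by rewrite PhiE hc mulr1 refl_J0.
Qed.

Let Phi_reflN F : lor F F != 0 -> chi (refl F) = -1 ->
  Phi (refl F) = refl (F *m J0) *m refl w0.
Proof.
move=> F0 hc; apply: eq_mx_rows => y; have [x [a ->]] := decomp y.
rewrite PhiE hc mulrN1 mulmxA refl_J0 // [RHS]mul_refl lorDl lorZl J0_orth add0r.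
rewrite -addrA; congr (_ + _); rewrite -scalerBl; congr (_ *: _).
by field.
Qed.

Lemma assemble : has_orthoplicial_section B.
Proof.
(* The factor [s^-1] cancels the conformal factor, so that [lor (x *m J0 + a *: w0) nu' = lor x nu].
   Sending [nu'] to infinity then equates the curvatures of disks and spheres. *)
pose nu' := s^-1 *: (nu *m J0).
have [mu [L' [hmu muL' nuL']]] : exists mu (L' : 'M[R]_(3 + 1 + 1)),
    [/\ moebius mu, mlift mu L' & nu' *m L' = npt None].
  have [v [a [t e]]] := lvecP nu'; rewrite e; apply: moebius_null.
    have : lor nu' nu' = 0 by rewrite /nu' lorZl lorZr J0_conf nu0 !mulr0.
    by rewrite e lor_lvec; lra.
  have : 0 < ltime nu' by rewrite /nu' ltimeZ mulr_gt0 ?invr_gt0 // J0_last.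
  by rewrite e /lvec ltime_row_mx.
have lL' : lorentz L' by case: muL'.
have nu'E : npt None *m lorentz_adj L' = nu' by rewrite -nuL' mulmxK_adj.
have curvE' y : curv (y *m L') = - lor y nu' by rewrite /curv lor_adj // nu'E.
have lor_nu' x a : lor (x *m J0 + a *: w0) nu' = lor x nu.
  rewrite /nu' !lorl !lorr J0_conf (lorC w0) J0_orth; field.
  exact: sn0.
pose B' := orthoplicial_packing hmu; exists B'.
have sec : exists (G : set (hatR R 3 -> hatR R 3)) (X : set (set (hatR R 3))),
          is_apollonian_section B' G X /\
          arithmetically_equivalent (apollonian_group B) (balls B) G X.
  pose aL := lorentz_adj L; pose aL' := lorentz_adj L'.
  have aLK m (A : 'M[R]_(m, _)) : A *m aL *m L = A by apply: mulmx_adjK.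
  have LaK m (A : 'M[R]_(m, _)) : A *m L *m aL = A by apply: mulmxK_adj.
  have aLK' m (A : 'M[R]_(m, _)) : A *m aL' *m L' = A by apply: mulmx_adjK.
  have LaK' m (A : 'M[R]_(m, _)) : A *m L' *m aL' = A by apply: mulmxK_adj.
  clearbody aL aL'.
  have aL1 : aL *m L = 1%:M by rewrite -[aL]mul1mx aLK.
  have La1 : L *m aL = 1%:M by rewrite -[L]mul1mx LaK.
  have aL1' : aL' *m L' = 1%:M by rewrite -[aL']mul1mx aLK'.
  (* The standard data are transported by [L] on the disk side and by [L'] on the sphere side; [chi]
     and [Pm] are evaluated on matrices brought back to standard position. *)
  apply: (@arithmetic_section R B B' I (fun i => Vs i *m L)
    (fun i => ovec (vi i) *m L') (aL *m J0 *m L') (aL' *m K0 *m L) (w0 *m L')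
    (aL' *m k0) om (fun M => chi (L *m M *m aL)) (fun M => Pm (L *m M *m aL))).
  - by rewrite !mulmxA LaK' -(mulmxA aL J0) J0K0 mulmx1 aL1.
  - by rewrite !mulmxA LaK' w0K0 mul0mx.
  - by rewrite !mulmxA LaK' -(mulmxA aL J0) J0k0 mulmx0.
  - by rewrite !mulmxA LaK' w0k0.
  - rewrite !mulmxA -(mulmxA _ L aL) La1 mulmx1 -mulmxDl -!(mulmxA aL') -mulmxDr.
    by rewrite K0J0 mulmx1.
  - by move=> i; rewrite VsE mulmxDl -scalemxAl !mulmxA LaK.
  - by move=> i; rewrite lorM.
  - by move=> i; rewrite lorM // lor_ovec.
  - exact: ballsE.
  - by move=> i; apply/(orthoplicial_balls hmu muL'); exists (vi i).
  - move=> x a; rewrite -{2}(aLK _ x) curvE !mulmxA scalemxAl -mulmxDl curvE'.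
    by rewrite lor_nu'.
  - by rewrite mulmx1 La1.
  - by move=> M M'; rewrite -chiM !mulmxA aLK.
  - by rewrite mulmx1 La1.
  - by move=> M M' h1 h2; have := PmM h1 h2; rewrite !mulmxA aLK.
  - by move=> M PM i; apply: om_chi.
  - move=> M M' i j PM PM' e; apply: (om_inj PM PM').
    by rewrite !mulmxA e.
  - move=> b t hb ht; have [j hj] := dualE hb ht.
    have lLj : lor (Fs j *m L) (Fs j *m L) != 0 by rewrite lorM.
    have rE : L *m refl (Fs j *m L) *m aL = refl (Fs j).
      apply: eq_mx_rows => x; rewrite !mulmxA !mul_refl mulmxBl LaK -scalemxAl LaK.
      by rewrite !lorM.
    exists (refl (Fs j *m L)); split=> //.
    + exact: refl_refl.
    + by rewrite rE.
    have -> : section_mx (aL *m J0 *m L') (aL' *m K0 *m L) (w0 *m L') (aL' *m k0)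
        (fun M => chi (L *m M *m aL)) (refl (Fs j *m L)) = aL' *m Phi (refl (Fs j)) *m L'.
      rewrite /Phi /section_mx.
      have -> : aL' *m K0 *m L *m refl (Fs j *m L) *m (aL *m J0 *m L') =
          aL' *m K0 *m (L *m refl (Fs j *m L) *m aL) *m J0 *m L' by rewrite !mulmxA.
      rewrite rE mulmxDr mulmxDl -(scalemxAr (chi (refl (Fs j)))).
      by rewrite -(scalemxAl (chi (refl (Fs j)))) !mulmxA.
    have conj F : aL' *m refl F *m L' = refl (F *m L').
      apply: eq_mx_rows => x; rewrite !mulmxA !mul_refl mulmxBl aLK' -scalemxAl.
      by rewrite -(lorM (x *m aL') _ lL') aLK' lorM.
    case: (facets j) => [[hc [k [sg [k0' e]]]]|[hc [hn [k [sg [sg' [k0' e e']]]]]]].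
      rewrite Phi_refl1 // e refl_scale // conj.
      exact: orthoplicial_reflection.
    rewrite Phi_reflN // refl_rotate ?J0_orth // ?e ?e' ?refl_scale //; last first.
      by rewrite hn.
    have [h1 A1 l1] := orthoplicial_reflection hmu muL' sg.
    have [h2 A2 l2] := orthoplicial_reflection hmu muL' sg'.
    exists (h2 \o h1); first exact: generated_group_comp.
    have := lift_comp l2 l1; rewrite -!conj !mulmxA.
    by rewrite LaK'.
split=> //; first exact: orthoplicial_packingP.
split=> hI; last first.
  (* Each disk has the curvature of a sphere of the section, and the section lies in the
     orthoplicial packing. *)
  move=> b hb; have [G [X [[_ GA XB] [phi [psi [[_ [pf _ _] _] hc]]]]]] := sec.
  have [g [Gg [c [Xc e]]]] := pf _ hb.
  have [z hz] : exists z : int, has_curvature (psi b) z%:~R.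
    by apply: hI; exists g; split; [apply: GA|exists c; split; [apply: XB|]].
  by exists z; apply/(hc _ hb).
apply: (@orthoplicial_integral R mu hmu L' muL') => p; rewrite curvE'.
apply: integers => i.
have Vi : balls B (bset (Vs i *m L)) by apply/ballsE; exists i.
have [z hz] : exists z : int, has_curvature (bset (Vs i *m L)) z%:~R.
  apply: hI; exists id; split; first exact: generated_group_id.
  by exists (bset (Vs i *m L)); split=> //; rewrite image_id.
exists z; rewrite -curvE; apply/esym.
have V1 : lor (Vs i *m L) (Vs i *m L) = 1 by rewrite lorM.
exact: (@has_curvature_bset R 2 isT _ z%:~R V1).1 hz.
Qed.

End Assemble.

(** * The standard model of a disk packing *)

Lemma ltime_lor (R : realType) n (u : 'rV[R]_(n + 1)) :
  ltime u = - lor (row_mx 0 1%:M) u.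
Proof.
rewrite -{2}(hsubmxK u) [rsubmx u]mx11_scalar lorE dot0l.
by rewrite /ltime; ring.
Qed.

(** Reversed Cauchy-Schwarz for a time-like and a null vector of the future cone, read off from the
    square of [r *: x - t *: z]. *)
Lemma lor_future (R : realType) n (u v : 'rV[R]_(n + 1)) :
  lor u u < 0 -> 0 < ltime u -> lor v v = 0 -> 0 < ltime v -> lor u v < 0.
Proof.
rewrite -(hsubmxK u) -(hsubmxK v) [rsubmx u]mx11_scalar [rsubmx v]mx11_scalar.
move: (lsubmx u) (rsubmx u 0 0) (lsubmx v) (rsubmx v 0 0) => x t z r.
rewrite !ltime_row_mx !lorE => h1 t0 h2 r0.
have := dot_ge0 (r *: x - t *: z); rewrite !(dotl, dotr) (dotC z x) => h3.
have h4 : 0 < r * r * (t * t - dot x x) by rewrite !mulr_gt0 //; lra.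
have : 0 < (t * r) * (t * r - dot x z).
  have e : dot z z = r * r by lra.
  rewrite e in h3; lra.
by rewrite pmulr_rgt0 ?mulr_gt0 // => ?; lra.
Qed.

(** The equality case: here the square of [ltime v *: x - ltime u *: z], with [x] and [z] the
    spatial parts, vanishes. *)
Lemma lor_null_parallel (R : realType) n (u v : 'rV[R]_(n + 1)) :
  lor u u = 0 -> lor v v = 0 -> lor u v = 0 -> ltime v *: u = ltime u *: v.
Proof.
rewrite -(hsubmxK u) -(hsubmxK v) [rsubmx u]mx11_scalar [rsubmx v]mx11_scalar.
move: (lsubmx u) (rsubmx u 0 0) (lsubmx v) (rsubmx v 0 0) => x t z r.
rewrite !ltime_row_mx !lorE => h1 h2 h3; rewrite !scale_row_mx !scale_scalar_mx mulrC.
congr row_mx; apply/eqP; rewrite -subr_eq0 -dot_eq0 !(dotl, dotr) (dotC z x).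
have -> : dot x x = t * t by lra.
have -> : dot z z = r * r by lra.
have -> : dot x z = t * r by lra.
by apply/eqP; ring.
Qed.

Lemma npt_ltime (R : realType) d (x : hatR R d) : 0 < ltime (npt x).
Proof.
case: x => [x|]; rewrite /npt /lvec ltime_row_mx //.
by rewrite ltr_wpDl ?dot_ge0.
Qed.

Lemma npt_null (R : realType) d (x : hatR R d) : lor (npt x) (npt x) = 0.
Proof.
case: x => [x|]; rewrite /npt lor_lvec ?(dotl, dotr); ring.
Qed.

Section StdModel.
Context (R : realType) (B : polytopal_packing R 2) (I : finType) (Jx : Type).
Context (Vs : I -> 'rV[R]_(2 + 1 + 1)) (Fs : Jx -> 'rV[R]_(2 + 1 + 1)).
Context (p : I -> 'rV[R]_(2 + 1)) (LP : 'M[R]_(2 + 1 + 1)).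
Local Notation P := (tangency_polytope B).
Hypotheses (lLP : lorentz LP) (LP_gt0 : 0 < ltime (row_mx 0 1%:M *m LP)).
Hypothesis vP : forall v, vertex P v <-> exists i, v = p i.
Hypothesis pE : forall i, uvec (p i) = Vs i *m LP.
Hypothesis Fs0 : forall j, lor (Fs j) (Fs j) != 0.
Hypothesis facet_select : forall z, z != 0 -> (forall i, lor z (Vs i) <= 0) ->
  exists j, forall i, lor z (Vs i) = 0 -> lor (Fs j) (Vs i) = 0.

(** By [facet_select], some model normal [Fs j] vanishes at every vertex where [y] is tight;
    extremality of [y] makes the two proportional. *)
Lemma polar_std y : vertex (polar P) y ->
  exists j c, c != 0 /\ hvec y = c *: (Fs j *m LP).
Proof.
move=> vy; pose z := hvec y *m lorentz_adj LP.
have hP := tangency_polytope_full B.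
have /(polarE hP vP) yP := vertex_in vy.
have z0 : z != 0.
  apply/eqP => e; have : hvec y = 0 by rewrite -(mulmx_adjK (hvec y) lLP) -/z e mul0mx.
  move=> /(congr1 ltime); rewrite ltime_row_mx /ltime linear0 mxE => /eqP.
  by rewrite oner_eq0.
have k0 i : 0 < (Num.sqrt (dot (p i) (p i) - 1))^-1.
  rewrite invr_gt0 sqrtr_gt0 subr_gt0; apply: (@polytope_vertex_gt1 R 2 B).
  by apply/vP; exists i.
have zV D i : lor (D *m lorentz_adj LP) (Vs i) =
    (Num.sqrt (dot (p i) (p i) - 1))^-1 * lor D (hvec (p i)).
  by rewrite -(lorM _ _ lLP) mulmx_adjK // -pE lorZr.
have [i|j hj] := facet_select z0.
  by rewrite zV pmulr_rle0 // lorE mulr1 subr_le0 dotC.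
have [i|c e] := polar_vertex_extremal (D := Fs j *m LP) hP vP vy.
  move=> h; have hi : lor z (Vs i) = 0 by rewrite zV h mulr0.
  have := zV (Fs j *m LP) i; rewrite mulmxK_adj // hj // => /esym/eqP.
  by rewrite mulf_eq0 gt_eqF //= => /eqP.
have c0 : c != 0.
  apply/eqP => c0; have := Fs0 j; rewrite -(lorM _ _ lLP) e c0 scale0r lor0l.
  by rewrite eqxx.
by exists j, c^-1; rewrite invr_eq0 c0 e scalerA mulVf // scale1r.
Qed.

Lemma std_model : exists (L : 'M[R]_(2 + 1 + 1)) (nu : 'rV[R]_(2 + 1 + 1)),
  [/\ lorentz L, forall b, balls B b <-> exists i, b = bset (Vs i *m L),
    forall b s, dual_balls B b -> boundary_inversion b s ->
      exists j, mlift s (refl (Fs j *m L)),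
    forall x, curv (x *m L) = - lor x nu & lor nu nu = 0 /\ 0 < ltime nu].
Proof.
have [Mu [h [Mh [muM hMh gh hg]]]] := moebius_lift (moebius_mapP B).
have lMu : lorentz Mu by case: muM.
have lL := lorentz_mul lLP lMu.
exists (LP *m Mu), (npt None *m lorentz_adj (LP *m Mu)); split=> //.
- move=> b; split=> [/(ballsP muM)[v /vP[i ->] ->]|[i e]].
    by exists i; rewrite pE mulmxA.
  by apply/(ballsP muM); exists (p i); [apply/vP; exists i|rewrite pE -mulmxA].
- move=> b s hb hs.
  have [y [/polar_std[j [c [c0 e]]] y1 hy]] := @dual_inversion R 2 isT B Mu muM b s hb hs.
  by exists j; move: hy; rewrite e -scalemxAl refl_scale // mulmxA.
- by move=> x; rewrite /curv lor_adj.
split; first by rewrite lorM; [apply: npt_null|apply: lorentz_adjP].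
(* The time of [nu] is minus its product with the time axis. Moving [LP] to the axis keeps it in the
   future by [LP_gt0], and undoing [Mu] turns infinity into a positive multiple of the null vector
   of a point. *)
rewrite ltime_lor -lor_adj // mulmxA lor_adj // oppr_gt0.
have [k k0 e] := muM.2 (h None); rewrite hg in e.
have -> : npt None *m lorentz_adj Mu = k^-1 *: npt (h None).
  apply: (scalerI (_ : k != 0)); first by rewrite gt_eqF.
  by rewrite scalemxAl -e mulmxK_adj // scalerA divff ?scale1r // gt_eqF.
rewrite lorZr pmulr_rlt0 ?invr_gt0 //; apply: lor_future => //.
- by rewrite lorM // lorE dot0l; lra.
- exact: npt_null.
- exact: npt_ltime.
Qed.

End StdModel.

(** * Coordinates *)

Definition row3 {R : realType} (a b c : R) : 'rV[R]_(2 + 1) :=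
  \row_i nth 0 [:: a; b; c] i.

Definition v4 {R : realType} (a b c t : R) : 'rV[R]_(2 + 1 + 1) :=
  row_mx (row3 a b c) t%:M.

Definition frame {R : realType} {n} (r1 r2 r3 r4 : 'rV[R]_n) : 'M[R]_(2 + 1 + 1, n) :=
  col_mx (\matrix_i nth 0 [:: r1; r2; r3] i) r4.

Definition row4 {R : realType} (a b c d : R) : 'rV[R]_(3 + 1) :=
  \row_i nth 0 [:: a; b; c; d] i.

Definition v5 {R : realType} (a b c d t : R) : 'rV[R]_(3 + 1 + 1) :=
  row_mx (row4 a b c d) t%:M.

Section Coordinates.
Context {R : realType}.
Implicit Types a b c d t : R.

Lemma row3P (x : 'rV[R]_(2 + 1)) : exists a b c, x = row3 a b c.
Proof.
exists (x 0 (@Ordinal 3 0 isT)), (x 0 (@Ordinal 3 1 isT)), (x 0 (@Ordinal 3 2 isT)).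
apply/rowP => -[[|[|[|m]]] hm] //; rewrite mxE /=; congr (x _ _); exact: val_inj.
Qed.

Lemma row3_inj a b c a' b' c' : row3 a b c = row3 a' b' c' -> [/\ a = a', b = b' & c = c'].
Proof.
move=> /rowP e; have := e (@Ordinal 3 0 isT); have := e (@Ordinal 3 1 isT).
by have := e (@Ordinal 3 2 isT); rewrite !mxE /= => -> -> ->.
Qed.

Lemma dot_row3 a b c a' b' c' : dot (row3 a b c) (row3 a' b' c') = a * a' + b * b' + c * c'.
Proof. by rewrite /dot !big_ord_recl big_ord0 !mxE /= addr0 addrA. Qed.

Lemma row3E (x : 'rV[R]_(2 + 1)) (Q : R -> Prop) a b c : x = row3 a b c ->
  (forall i, Q (x 0 i)) <-> [/\ Q a, Q b & Q c].
Proof.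
move=> ->; split=> [h|[h1 h2 h3] [[|[|[|m]]] hm] //]; rewrite ?mxE //.
have := h (@Ordinal 3 0 isT); have := h (@Ordinal 3 1 isT).
by have := h (@Ordinal 3 2 isT); rewrite !mxE /= => *; split.
Qed.

Lemma v4P (x : 'rV[R]_(2 + 1 + 1)) : exists a b c t, x = v4 a b c t.
Proof.
have [a [b [c e]]] := row3P (lsubmx x); exists a, b, c, (rsubmx x 0 0).
by rewrite /v4 -e -mx11_scalar hsubmxK.
Qed.

Lemma lor_v4 a b c t a' b' c' t' :
  lor (v4 a b c t) (v4 a' b' c' t') = a * a' + b * b' + c * c' - t * t'.
Proof. by rewrite /v4 lorE dot_row3. Qed.

Lemma v4_eq0 a b c t : (v4 a b c t == 0) = [&& a == 0, b == 0, c == 0 & t == 0].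
Proof.
apply/eqP/and4P => [e|[/eqP-> /eqP-> /eqP-> /eqP->]]; last first.
  rewrite /v4 raddf0 -[RHS]row_mx0; congr row_mx.
  by apply/rowP => -[[|[|[|m]]] hm] //; rewrite !mxE.
have := f_equal ltime e; rewrite ltime_row_mx /ltime linear0 mxE => t0.
have : lsubmx (v4 a b c t) = 0 by rewrite e linear0.
rewrite row_mxKl => e3; have : row3 a b c = row3 0 0 0.
  by rewrite e3; apply/rowP => -[[|[|[|m]]] hm] //; rewrite !mxE.
by move=> /row3_inj[-> -> ->]; rewrite t0 !eqxx.
Qed.

Lemma mul_frame n a b c t (r1 r2 r3 r4 : 'rV[R]_n) :
  v4 a b c t *m frame r1 r2 r3 r4 = a *: r1 + b *: r2 + c *: r3 + t *: r4.
Proof.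
rewrite /v4 /frame mul_row_col mul_scalar_mx; congr (_ + _).
by rewrite mulmx_sum_row !big_ord_recl big_ord0 !rowK !mxE /= addr0 addrA.
Qed.

Lemma ltime_v4 a b c t : ltime (v4 a b c t) = t.
Proof. exact: ltime_row_mx. Qed.

Lemma v4_time : row_mx 0 1%:M = v4 0 0 0 1 :> 'rV[R]_(2 + 1 + 1).
Proof.
rewrite /v4; congr row_mx; apply/rowP => -[[|[|[|m]]] hm] //; by rewrite !mxE.
Qed.

Lemma lorentz_frame (A1 A2 A3 T : 'rV[R]_(2 + 1 + 1)) :
  [/\ lor A1 A1 = 1, lor A2 A2 = 1, lor A3 A3 = 1 & lor T T = -1] ->
  [/\ lor A1 A2 = 0, lor A1 A3 = 0 & lor A2 A3 = 0] ->
  [/\ lor A1 T = 0, lor A2 T = 0 & lor A3 T = 0] -> lorentz (frame A1 A2 A3 T).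
Proof.
move=> [h11 h22 h33 htt] [h12 h13 h23] [h1 h2 h3]; apply: lorentzP => u v.
have [a [b [c [t ->]]]] := v4P u; have [a' [b' [c' [t' ->]]]] := v4P v.
rewrite !mul_frame !lorl !lorr (lorC A2 A1) (lorC A3 A1) (lorC A3 A2).
rewrite (lorC T A1) (lorC T A2) (lorC T A3) h11 h22 h33 htt h12 h13 h23 h1 h2 h3.
by rewrite lor_v4; ring.
Qed.

Lemma free_perp (r1 r2 r3 r4 : 'rV[R]_(2 + 1 + 1)) :
  (forall a b c d, a *: r1 + b *: r2 + c *: r3 + d *: r4 = 0 ->
    [/\ a = 0, b = 0, c = 0 & d = 0]) ->
  forall z, lor z r1 = 0 -> lor z r2 = 0 -> lor z r3 = 0 -> lor z r4 = 0 -> z = 0.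
Proof.
move=> h z z1 z2 z3 z4; pose M := frame r1 r2 r3 r4.
have uM : M \in unitmx.
  rewrite -row_free_unit -kermx_eq0; apply/rowV0P => u /sub_kermxP.
  have [a [b [c [t ->]]]] := v4P u; rewrite mul_frame => /h[-> -> -> ->].
  by apply/eqP; rewrite v4_eq0 !eqxx.
apply: lor_nondeg => v; rewrite -(mulmxKV uM v).
have [a [b [c [t ->]]]] := v4P (v *m invmx M).
by rewrite mul_frame !lorr z1 z2 z3 z4 !mulr0 !addr0.
Qed.

Lemma perp_free (r1 r2 r3 r4 : 'rV[R]_(2 + 1 + 1)) :
  (forall z, lor z r1 = 0 -> lor z r2 = 0 -> lor z r3 = 0 -> lor z r4 = 0 -> z = 0) ->
  forall a b c d, a *: r1 + b *: r2 + c *: r3 + d *: r4 = 0 ->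
    [/\ a = 0, b = 0, c = 0 & d = 0].
Proof.
move=> h a b c d; pose M := frame r1 r2 r3 r4; rewrite -mul_frame -/M.
have uM : M \in unitmx.
  rewrite -unitmx_tr -row_free_unit -kermx_eq0; apply/rowV0P => u /sub_kermxP uM0.
  have e v : lor (u *m leta) (v *m M) = 0.
    by rewrite /lor trmx_mul -(mulmxA u) eta_sqr mulmx1 mulmxA uM0 mul0mx mxE.
  have e' x y z t : lor (u *m leta) (x *: r1 + y *: r2 + z *: r3 + t *: r4) = 0.
    by rewrite -mul_frame e.
  have : u *m leta = 0.
    apply: h.
    - by have := e' 1 0 0 0; rewrite scale1r !scale0r !addr0.
    - by have := e' 0 1 0 0; rewrite scale1r !scale0r !addr0 add0r.
    - by have := e' 0 0 1 0; rewrite scale1r !scale0r !addr0 !add0r.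
    - by have := e' 0 0 0 1; rewrite scale1r !scale0r !add0r.
  by move=> /(congr1 (mulmx^~ leta)); rewrite -mulmxA eta_sqr mulmx1 mul0mx.
move=> e; have /eqP : v4 a b c d = 0 by rewrite -(mulmxK uM (v4 a b c d)) e mul0mx.
by rewrite v4_eq0 => /and4P[/eqP-> /eqP-> /eqP-> /eqP->].
Qed.

Lemma lor_v5 a b c d t a' b' c' d' t' :
  lor (v5 a b c d t) (v5 a' b' c' d' t') = a * a' + b * b' + c * c' + d * d' - t * t'.
Proof.
by rewrite /v5 lorE /dot !big_ord_recl big_ord0 !mxE /= addr0 !addrA.
Qed.

Lemma ltime_v5 a b c d t : ltime (v5 a b c d t) = t.
Proof. exact: ltime_row_mx. Qed.

Lemma v5D a b c d t a' b' c' d' t' :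
  v5 a b c d t + v5 a' b' c' d' t' = v5 (a + a') (b + b') (c + c') (d + d') (t + t').
Proof.
rewrite /v5 add_row_mx -raddfD; congr row_mx.
by apply/rowP => -[[|[|[|[|m]]]] hm] //; rewrite !mxE.
Qed.

Lemma v5Z k a b c d t : k *: v5 a b c d t = v5 (k * a) (k * b) (k * c) (k * d) (k * t).
Proof.
rewrite /v5 scale_row_mx scale_scalar_mx; congr row_mx.
by apply/rowP => -[[|[|[|[|m]]]] hm] //; rewrite !mxE.
Qed.

Lemma v5N a b c d t : - v5 a b c d t = v5 (- a) (- b) (- c) (- d) (- t).
Proof. by rewrite -scaleN1r v5Z !mulN1r. Qed.

Lemma ovecE (i : 'I_(3 + 1)) (b : bool) (s := Num.sqrt 2 * sgb b : R) :
  ovec (i, b) = v5 (if i == 0 :> nat then s else 0) (if i == 1 :> nat then s else 0)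
    (if i == 2 :> nat then s else 0) (if i == 3 :> nat then s else 0) 1.
Proof.
rewrite /ovec /hvec /v5; congr row_mx; apply/rowP => j; rewrite /orth_vertex !mxE eqxx /=.
case: i j => [[|[|[|[|m]]]] hm] [[|[|[|[|m']]]] hm'] //=;
  by rewrite ?mulr1 ?mulr0.
Qed.

Definition sgf (b0 b1 b2 b3 : bool) (i : 'I_(3 + 1)) : bool :=
  nth false [:: b0; b1; b2; b3] i.

Lemma fvecE (b0 b1 b2 b3 : bool) (s := (Num.sqrt 2)^-1 : R) :
  fvec (sgf b0 b1 b2 b3) = v5 (s * sgb b0) (s * sgb b1) (s * sgb b2) (s * sgb b3) 1.
Proof.
rewrite /fvec /hvec /v5; congr row_mx; apply/rowP => j; rewrite !mxE.
by case: j => [[|[|[|[|m']]]] hm'].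
Qed.

End Coordinates.

(** * Combinatorics of the three polytopes *)

Section CombinatorialData.
Context (R : realType) (d n' : nat) (B : polytopal_packing R d) (Q : set 'rV[R]_n').
Context (I : finType) (W : I -> 'rV[R]_n').
Hypothesis eqPQ : combinatorially_equivalent (tangency_polytope B) Q.
Hypotheses (Winj : injective W) (Wv : forall i, vertex Q (W i)).
Hypothesis Wex : forall H x, face Q H -> H x -> exists i, H (W i).

(** The whole input of the rigidity arguments in terms of unit vectors. A face becomes a vector [F]
    supporting it, and the last clause encodes that three vertices are not collinear: in a vanishing
    combination the last coordinates add up to 0, which makes it an affine relation. *)
Lemma combinatorial_data : exists p : I -> 'rV[R]_(d + 1),
  [/\ forall v, vertex (tangency_polytope B) v <-> exists i, v = p i,
      forall i, lor (uvec (p i)) (uvec (p i)) = 1 /\ 0 < ltime (uvec (p i)),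
      forall i j H, i <> j -> face Q H -> (forall t, H (W t) <-> t = i \/ t = j) ->
        lor (uvec (p i)) (uvec (p j)) = -1,
      forall H, face Q H -> exists F, forall t,
        lor F (uvec (p t)) <= 0 /\ (lor F (uvec (p t)) = 0 <-> H (W t)) &
      (forall D, (forall i, lor D (uvec (p i)) = 0) -> D = 0) /\
      (forall i j l a b c, i <> j -> j <> l -> l <> i ->
        a *: uvec (p i) + b *: uvec (p j) + c *: uvec (p l) = 0 -> c = 0)].
Proof.
have hP := tangency_polytope_full B.
have [p [pinj vP pface]] := combinatorial_vertices hP eqPQ Winj Wv Wex.
have vp i : vertex (tangency_polytope B) (p i) by apply/vP; exists i.
have p1 i : 1 < dot (p i) (p i) by apply: polytope_vertex_gt1.
have k0 i : 0 < (Num.sqrt (dot (p i) (p i) - 1))^-1.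
  by rewrite invr_gt0 sqrtr_gt0 subr_gt0.
have lorF F i : lor F (uvec (p i)) =
  (Num.sqrt (dot (p i) (p i) - 1))^-1 * lor F (hvec (p i)) by rewrite /uvec lorZr.
exists p; split=> //.
- move=> i; split; first exact: uvec_unit.
  by rewrite /uvec ltimeZ ltime_row_mx mulr1.
- move=> i j H ij /pface[G GP hG] hH.
  apply: (@edge_uvec R _ (tangency_polytope B) G) => //.
  + exact: tangency_polytope_edge_scribed.
  + exact: tangency_polytope_outside.
  + by move=> /pinj.
  + by apply/hG/hH; left.
  + by apply/hG/hH; right.
  + by move=> _ /vP[t ->] /hG/hH[->|->]; [left|right].
- move=> H /pface[G [u [a [ua GE]]] hG]; exists (row_mx u a%:M) => t.
  rewrite lorF lorE mulr1 pmulr_rle0 // subr_le0; split.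
    by apply: ua; apply: vertex_in.
  split=> [/eqP|/hG].
    rewrite mulf_eq0 gt_eqF //= subr_eq0 => /eqP h; apply/hG; rewrite GE.
    by split=> //; apply: vertex_in.
  by rewrite GE => -[_ /= ->]; rewrite subrr mulr0.
split.
- move=> D hD; apply: (vertices_span hP vP (tangency_polytope_origin B)) => i.
  by have /eqP := hD i; rewrite lorF mulf_eq0 gt_eqF //= => /eqP.
- move=> i j l a b c ij jl li; rewrite /uvec !scalerA.
  set ka := a * _; set kb := b * _; set kc := c * _; rewrite /hvec !scale_row_mx.
  rewrite !add_row_mx !scale_scalar_mx !mulr1 -!raddfD => e.
  have e1 : ka *: p i + kb *: p j + kc *: p l = 0.
    by have := congr1 lsubmx e; rewrite row_mxKl linear0.
  have e2 : ka + kb + kc = 0.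
    by have := congr1 ltime e; rewrite ltime_row_mx /ltime linear0 mxE.
  apply: contrapT => c0; have kc0 : kc != 0.
    by rewrite mulf_neq0 //; [apply/eqP|rewrite gt_eqF].
  apply: (@vertices_not_collinear R _ _ (p i) (p j - p i) (p i) (p j) (p l) 0 1
    (- kb / kc) (vp i) (vp j) (vp l)).
  + by move=> /pinj.
  + by move=> /pinj.
  + by move=> /pinj.
  + by rewrite scale0r addr0.
  + by rewrite scale1r addrC subrK.
  + apply: (scalerI kc0).
    have -> : kc *: p l = - (ka *: p i + kb *: p j).
      by apply/eqP; rewrite -addr_eq0 addrC e1.
    have -> : ka = - kb - kc by lra.
    by apply/rowP => m; rewrite !mxE; field.
Qed.

End CombinatorialData.

Section Polytopes3.
Context {R : realType}.

Definition cubeW (i : bool * bool * bool) : 'rV[R]_(2 + 1) :=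
  row3 (sgb i.1.1) (sgb i.1.2) (sgb i.2).

Lemma cubeE (a b c : R) : @cube R 3 (row3 a b c) <-> [/\ `|a| <= 1, `|b| <= 1 & `|c| <= 1].
Proof. exact: (@row3E R (row3 a b c) (fun x => `|x| <= 1) a b c erefl). Qed.

Lemma sgb_mul_le (m b : bool) (x : R) : `|x| <= 1 -> m%:R * sgb b * x <= m%:R.
Proof.
rewrite ler_norml => /andP[h1 h2].
by rewrite /sgb; case: m; case: b => /=; lra.
Qed.

Lemma sgb_inj : injective (@sgb R).
Proof. by case; case=> //=; rewrite /sgb => h; exfalso; lra. Qed.

Lemma sgb_mul1 (b c : bool) : sgb b * sgb c = 1 :> R -> c = b.
Proof. by rewrite /sgb; case: b; case: c => // h; exfalso; lra. Qed.

Lemma cubeW_inj : injective cubeW.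
Proof.
by move=> [[a b] c] [[a' b'] c'] /row3_inj[/sgb_inj/= -> /sgb_inj/= -> /sgb_inj/= ->].
Qed.

Lemma cubeW_in i : @cube R 3 (cubeW i).
Proof.
have h b : `|sgb b : R| <= 1 by rewrite /sgb; case: b; rewrite ?normrN normr1.
by apply/cubeE; split; apply: h.
Qed.

(** The flags [m1], [m2], [m3] tell which coordinates are frozen: one for a square, two for an
    edge. *)
Lemma cube_face (m1 m2 m3 a b c : bool) : exists2 H, face (@cube R 3) H &
  forall a' b' c', H (cubeW (a', b', c')) <->
    [/\ m1 -> a' = a, m2 -> b' = b & m3 -> c' = c].
Proof.
pose u : 'rV[R]_3 := row3 (m1%:R * sgb a) (m2%:R * sgb b) (m3%:R * sgb c).
exists (@cube R 3 `&` [set x | dot u x = m1%:R + m2%:R + m3%:R]).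
  exists u, (m1%:R + m2%:R + m3%:R); split=> // x; have [x1 [x2 [x3 ->]]] := row3P x.
  move=> /cubeE[h1 h2 h3]; rewrite /u dot_row3.
  by rewrite !lerD // sgb_mul_le.
move=> a' b' c'; have key (m s s' : bool) : m%:R * sgb s * sgb s' <= m%:R :> R /\
    (m%:R * sgb s * sgb s' = m%:R :> R <-> (m -> s' = s)).
  split; first by apply: sgb_mul_le; rewrite /sgb; case: s'; rewrite ?normrN normr1.
  case: m => /=; last by rewrite !mul0r.
  by rewrite mul1r; split=> [/sgb_mul1|/(_ isT) ->] //; rewrite sgb_sqr.
have [l1 k1] := key m1 a a'; have [l2 k2] := key m2 b b'; have [l3 k3] := key m3 c c'.
split=> [[_]|[/k1 h1 /k2 h2 /k3 h3]].
  rewrite /= /u /cubeW dot_row3 /= => e.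
  by split; [apply/k1|apply/k2|apply/k3]; lra.
split; first exact: cubeW_in.
by rewrite /= /u /cubeW dot_row3 /= h1 h2 h3.
Qed.

Lemma cube_vertex i : vertex (@cube R 3) (cubeW i).
Proof.
exists (cubeW i), 3; have ss (b : bool) (x : R) : `|x| <= 1 -> sgb b * x <= 1 /\
    (sgb b * x = 1 -> x = sgb b).
  by rewrite ler_norml => /andP[h1 h2]; rewrite /sgb; case: b; split; lra.
split=> [x|].
  have [x1 [x2 [x3 ->]]] := row3P x; move=> /cubeE[h1 h2 h3]; rewrite dot_row3.
  have := (ss i.1.1 _ h1).1; have := (ss i.1.2 _ h2).1; have := (ss i.2 _ h3).1; lra.
apply/seteqP; split=> [_ ->|x [+ /=]].
  by split; [exact: cubeW_in|rewrite /= dot_row3 !sgb_sqr; lra].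
have [x1 [x2 [x3 ->]]] := row3P x; move=> /cubeE[h1 h2 h3]; rewrite dot_row3 => e.
have [l1 k1] := ss i.1.1 _ h1; have [l2 k2] := ss i.1.2 _ h2; have [l3 k3] := ss i.2 _ h3.
by congr row3; [apply: k1|apply: k2|apply: k3]; lra.
Qed.

Lemma cube_ex H x : face (@cube R 3) H -> H x -> exists i, H (cubeW i).
Proof.
move=> [u [a [ua ->]]] [Qx /= ux].
have [u1 [u2 [u3 uE]]] := row3P u; have [x1 [x2 [x3 xE]]] := row3P x.
exists (u1 < 0, u2 < 0, u3 < 0); split; first exact: cubeW_in.
apply/eqP; rewrite /= eq_le; apply/andP; split; first by apply: ua; apply: cubeW_in.
rewrite -ux uE xE dot_row3 /cubeW dot_row3 /=.
have key (v y : R) : `|y| <= 1 -> v * y <= v * sgb (v < 0).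
  rewrite ler_norml => /andP[h1 h2]; rewrite /sgb; case: ltP => v0; nra.
by move: Qx; rewrite xE => /cubeE[h1 h2 h3]; rewrite !lerD // key.
Qed.

(** The index (false, false) is the origin; two booleans are used so that the vertices share their
    index type with the sign vectors [tetra_V]. *)
Definition simplexW (i : bool * bool) : 'rV[R]_(2 + 1) :=
  row3 (~~ i.1 && i.2)%:R (i.1 && ~~ i.2)%:R (i.1 && i.2)%:R.

Lemma simplexE (a b c : R) : @simplex R 3 (row3 a b c) <->
  [/\ 0 <= a, 0 <= b, 0 <= c & a + b + c <= 1].
Proof.
rewrite /simplex /=; have -> : \sum_i row3 a b c 0 i = a + b + c.
  by rewrite !big_ord_recl big_ord0 !mxE /= addr0 addrA.
have h := @row3E R (row3 a b c) (fun x => 0 <= x) a b c erefl.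
by split=> [[/h[? ? ?] ?]|[? ? ? ?]]; split=> //; apply/h.
Qed.

Lemma simplexW_inj : injective simplexW.
Proof.
move=> [[] []] [[] []] //= /row3_inj[/eqP + /eqP + /eqP];
  by rewrite /= ?eqxx ?oner_eq0 // ?(eq_sym 0) ?oner_eq0.
Qed.

Lemma simplexW_in i : @simplex R 3 (simplexW i).
Proof. by apply/simplexE; case: i => [[] []] /=; split; lra. Qed.

Lemma simplex_face (S : bool * bool -> bool) : exists2 H, face (@simplex R 3) H &
  forall i, H (simplexW i) <-> S i.
Proof.
(* The functional [u] takes the value [a] on the vertices in [S] and [a - 1] on the others; its
   value 0 at the origin dictates [a]. *)
pose a : R := (~~ S (false, false))%:R.
pose u : 'rV[R]_3 := row3 (a - 1 + (S (false, true))%:R) (a - 1 + (S (true, false))%:R)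
  (a - 1 + (S (true, true))%:R).
exists (@simplex R 3 `&` [set x | dot u x = a]).
  exists u, a; split=> // x; have [x1 [x2 [x3 ->]]] := row3P x.
  move=> /simplexE[h1 h2 h3 h4]; rewrite /u dot_row3 /a.
  by case: (S _); case: (S _); case: (S _); case: (S _) => /=; lra.
move=> i; split=> [[_ /=]|Si].
  rewrite /u /simplexW dot_row3 /a; case: i => [[] []] /=;
    case: (S (false, false)); case: (S (false, true)); case: (S (true, false));
    case: (S (true, true)) => //= h; exfalso; lra.
split; first exact: simplexW_in.
rewrite /= /u /simplexW dot_row3 /a; case: i Si => [[] []] /= -> /=; lra.
Qed.

Lemma convex4_tight (l0 l1 l2 l3 c0 c1 c2 c3 a : R) :
  [/\ 0 <= l0, 0 <= l1, 0 <= l2 & 0 <= l3] -> l0 + l1 + l2 + l3 = 1 ->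
  [/\ c0 <= a, c1 <= a, c2 <= a & c3 <= a] ->
  c0 * l0 + c1 * l1 + c2 * l2 + c3 * l3 = a ->
  [/\ c0 < a -> l0 = 0, c1 < a -> l1 = 0, c2 < a -> l2 = 0 & c3 < a -> l3 = 0].
Proof.
move=> [h0 h1 h2 h3] hs [k0 k1 k2 k3] e.
have p0 : 0 <= (a - c0) * l0 by rewrite mulr_ge0 // subr_ge0.
have p1 : 0 <= (a - c1) * l1 by rewrite mulr_ge0 // subr_ge0.
have p2 : 0 <= (a - c2) * l2 by rewrite mulr_ge0 // subr_ge0.
have p3 : 0 <= (a - c3) * l3 by rewrite mulr_ge0 // subr_ge0.
have hs' : a = a * l0 + a * l1 + a * l2 + a * l3 by rewrite -!mulrDr hs mulr1.
have z c l : (a - c) * l = 0 -> c < a -> l = 0.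
  move=> /eqP + ca; rewrite mulf_eq0 subr_eq0 gt_eqF //= => /eqP ->//.
by split; apply: z; lra.
Qed.

Lemma simplex_vertex i : vertex (@simplex R 3) (simplexW i).
Proof.
have [H HQ hH] := simplex_face (pred1 i).
rewrite /vertex /=; suff -> : [set simplexW i] = H by [].
case: HQ hH => u [a [ua ->]] hH; apply/seteqP; split=> [_ ->|x []].
  by have [_] := hH i; rewrite /= eqxx; apply.
have [u1 [u2 [u3 uE]]] := row3P u; have [x1 [x2 [x3 ->]]] := row3P x.
move=> /simplexE[h1 h2 h3 h4] /=; rewrite uE dot_row3 => e.
have val j : dot u (simplexW j) <= a /\ (dot u (simplexW j) = a <-> j = i).
  split; first by apply: ua; apply: simplexW_in.
  have [k1 k2] := hH j; split=> [e1|->].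
    by apply/eqP; apply: k1; split=> //; apply: simplexW_in.
  by have [_] := hH i; rewrite /= eqxx => /(_ isT)[].
have sval j : j != i -> dot u (simplexW j) < a.
  by move=> ji; have [l k] := val j; rewrite lt_neqAle l andbT; apply: contra ji => /eqP/k ->.
have ival : dot u (simplexW i) = a by apply: (val i).2.2.
move: (sval (false, false)) (sval (false, true)) (sval (true, false)) (sval (true, true)) ival.
rewrite uE /simplexW !dot_row3 /=.
case: i {hH val sval} => [[] []] /=.
- move=> /(_ isT) s0 /(_ isT) s1 /(_ isT) s2 _ si.
  have [||||t0 t1 t2 _] := @convex4_tight (1 - (x1 + x2 + x3)) x1 x2 x3 0 u1 u2 u3 a;
    [by split=> //; lra|by ring|by split; lra|by lra|].
  by have := t0 ltac:(lra); have -> := t1 ltac:(lra); have -> := t2 ltac:(lra) => ?; congr row3; lra.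
- move=> /(_ isT) s0 /(_ isT) s1 _ /(_ isT) s2 si.
  have [||||t0 t1 _ t2] := @convex4_tight (1 - (x1 + x2 + x3)) x1 x2 x3 0 u1 u2 u3 a;
    [by split=> //; lra|by ring|by split; lra|by lra|].
  by have := t0 ltac:(lra); have -> := t1 ltac:(lra); have -> := t2 ltac:(lra) => ?; congr row3; lra.
- move=> /(_ isT) s0 _ /(_ isT) s1 /(_ isT) s2 si.
  have [||||t0 _ t1 t2] := @convex4_tight (1 - (x1 + x2 + x3)) x1 x2 x3 0 u1 u2 u3 a;
    [by split=> //; lra|by ring|by split; lra|by lra|].
  by have := t0 ltac:(lra); have -> := t1 ltac:(lra); have -> := t2 ltac:(lra) => ?; congr row3; lra.
- move=> _ /(_ isT) s0 /(_ isT) s1 /(_ isT) s2 si.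
  have [||||_ t0 t1 t2] := @convex4_tight (1 - (x1 + x2 + x3)) x1 x2 x3 0 u1 u2 u3 a;
    [by split=> //; lra|by ring|by split; lra|by lra|].
  by have -> := t0 ltac:(lra); have -> := t1 ltac:(lra); have -> := t2 ltac:(lra).
Qed.

Lemma simplex_ex H x : face (@simplex R 3) H -> H x -> exists i, H (simplexW i).
Proof.
move=> [u [a [ua ->]]] []; have [x1 [x2 [x3 ->]]] := row3P x.
have [u1 [u2 [u3 uE]]] := row3P u.
move=> /simplexE[h1 h2 h3 h4] /=; rewrite uE dot_row3 => e.
apply: contrapT => hn.
have s i : dot u (simplexW i) < a.
  rewrite lt_neqAle ua ?andbT; last exact: simplexW_in.
  by apply/eqP => ei; apply: hn; exists i; split; [exact: simplexW_in|rewrite /= -uE].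
move: (s (false, false)) (s (false, true)) (s (true, false)) (s (true, true)).
rewrite uE /simplexW !dot_row3 /= => s1 s2 s3 s4.
have a0 : 0 < a by lra.
have [||||t0 t1 t2 t3] := @convex4_tight (1 - (x1 + x2 + x3)) x1 x2 x3 0 u1 u2 u3 a;
  [by split=> //; lra|by ring|by split; lra|by lra|].
have := t0 ltac:(lra); have := t1 ltac:(lra); have := t2 ltac:(lra); have := t3 ltac:(lra).
by lra.
Qed.

Definition crossW (i : 'I_3 * bool) : 'rV[R]_3 := orth_vertex 1 i.

Lemma cross_ex H x : face (@cross_polytope R 3) H -> H x -> exists i, H (crossW i).
Proof.
rewrite -[@cross_polytope R 3]/(@orth R 3 1) orth_hull //.
by move=> h1 h2; have [k hk] := hull_face_point h1 h2; exists (enum_val k).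
Qed.

Lemma cross_vertex i : vertex (@cross_polytope R 3) (crossW i).
Proof. by apply/(@orth_vertexP R 3 1) => //; exists i. Qed.

Lemma cross_edge (i j : 'I_3 * bool) : i.1 != j.1 ->
  exists2 H, face (@cross_polytope R 3) H & forall t, H (crossW t) <-> t = i \/ t = j.
Proof.
move=> ij; pose u := crossW i + crossW j.
have dE k x : dot (crossW k) x = sgb k.2 * x 0 k.1.
  by rewrite dotC dot_orth_vertexr mul1r.
have le1 (b : bool) (x : R) : sgb b * x <= `|x|.
  rewrite /sgb; case: b; last by rewrite mul1r ler_norm.
  by rewrite mulN1r -normrN ler_norm.
exists (@cross_polytope R 3 `&` [set x | dot u x = 1]).
  exists u, 1; split=> // x; rewrite /cross_polytope /= => hx.
  rewrite /u dotDl !dE; apply: le_trans hx.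
  rewrite (bigD1 i.1) //= (bigD1 j.1) /=; last by rewrite eq_sym.
  rewrite addrA -[leLHS]addr0; apply: lerD; last exact: sumr_ge0.
  by apply: lerD.
have dW k t : dot (crossW k) (crossW t) = if k.1 == t.1 then sgb k.2 * sgb t.2 else 0.
  rewrite dE /crossW /orth_vertex !mxE eqxx /= mul1r.
  by case: eqVneq; rewrite ?mulr1 ?mulr0.
move=> t; split=> [[_ /=]|].
  rewrite /u dotDl !dW; case: (i.1 =P t.1) => [it|_].
    rewrite -it eq_sym (negbTE ij) addr0 => /sgb_mul1 e; left.
    by case: t it e => /= ? ? <- ->; case: (i).
  case: (j.1 =P t.1) => [jt|_]; last by rewrite addr0 => h; exfalso; lra.
  rewrite add0r => /sgb_mul1 e; right.
  by case: t jt e => /= ? ? <- ->; case: (j).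
have Wt k : @cross_polytope R 3 (crossW k) by apply: vertex_in; apply: cross_vertex.
move=> [->|->]; split=> //=; rewrite /u dotDl !dW eqxx.
  by rewrite eq_sym (negbTE ij) addr0 sgb_sqr.
by rewrite (negbTE ij) add0r sgb_sqr.
Qed.

End Polytopes3.

(** * Rigidity of the Gram matrices *)

Section Gram.
Context {R : realType}.
Local Notation s2 := (Num.sqrt 2 : R).
Local Notation vec := ('rV[R]_(2 + 1 + 1)).

(** The space has dimension 4, so the orthogonal of [D1], [D2], [D3] is a line and the three sums
    are proportional. Both [S2] and [S3] are the same multiple [t] of [S1], and comparing
    [t * lor S1 S1] with [t ^+ 2 * lor S1 S1] gives [t = 1]. *)
Lemma octahedron_sums (D1 D2 D3 S1 S2 S3 : vec) :
  [/\ lor D1 D2 = 0, lor D1 D3 = 0 & lor D2 D3 = 0] ->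
  [/\ lor D1 D1 != 0, lor D2 D2 != 0 & lor D3 D3 != 0] ->
  [/\ lor D1 S1 = 0, lor D2 S1 = 0 & lor D3 S1 = 0] ->
  [/\ lor D1 S2 = 0, lor D2 S2 = 0 & lor D3 S2 = 0] ->
  [/\ lor D1 S3 = 0, lor D2 S3 = 0 & lor D3 S3 = 0] ->
  [/\ lor S1 S2 = -4, lor S1 S3 = -4 & lor S2 S3 = -4] ->
  [/\ S2 = S1, S3 = S1 & lor S1 S1 = -4].
Proof.
move=> [d12 d13 d23] [n1 n2 n3] [a1 a2 a3] [b1 b2 b3] [c1 c2 c3] [s12 s13 s23].
have S10 : S1 <> 0 by move=> e; move: s12; rewrite e lor0l; lra.
have perp : forall z, lor z D1 = 0 -> lor z D2 = 0 -> lor z D3 = 0 -> lor z S1 = 0 -> z = 0.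
  apply: free_perp => a b c d e.
  have a0 : a = 0.
    have := congr1 (lor D1) e; rewrite !lorr d12 d13 a1 !mulr0 !addr0 => /eqP.
    by rewrite mulf_eq0 (negbTE n1) orbF => /eqP.
  have b0 : b = 0.
    have := congr1 (lor D2) e; rewrite !lorr (lorC D2 D1) d12 d23 a2 !mulr0 !addr0 add0r => /eqP.
    by rewrite mulf_eq0 (negbTE n2) orbF => /eqP.
  have c0 : c = 0.
    have := congr1 (lor D3) e.
    rewrite !lorr (lorC D3 D1) (lorC D3 D2) d13 d23 a3 !mulr0 !addr0 !add0r => /eqP.
    by rewrite mulf_eq0 (negbTE n3) orbF => /eqP.
  move: e; rewrite a0 b0 c0 !scale0r !add0r => /eqP; rewrite scaler_eq0.
  by move=> /orP[/eqP->|/eqP].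
have nS : lor S1 S1 != 0.
  by apply/eqP => h; apply: S10; apply: perp; rewrite // lorC.
have key S : lor D1 S = 0 -> lor D2 S = 0 -> lor D3 S = 0 -> lor S1 S = -4 ->
    S = (-4 / lor S1 S1) *: S1.
  move=> h1 h2 h3 h4; apply/eqP; rewrite -subr_eq0; apply/eqP; apply: perp;
    rewrite !lorl ?(lorC S) ?(lorC S1 D1) ?(lorC S1 D2) ?(lorC S1 D3) ?h1 ?h2 ?h3 ?h4
      ?a1 ?a2 ?a3 ?mulr0 ?subrr ?oppr0 ?addr0 //.
  by rewrite divfK // subrr.
have e2 := key _ b1 b2 b3 s12; have e3 := key _ c1 c2 c3 s13.
set t := -4 / lor S1 S1 in e2 e3.
have tn : t * lor S1 S1 = -4 by rewrite /t divfK.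
have t1 : t = 1.
  move: s23; rewrite e2 e3 lorZl lorZr tn; lra.
by rewrite e2 e3 t1 scale1r; split=> //; move: tn; rewrite t1 mul1r.
Qed.

(** Take differences [D] and sums [S] of opposite vertices. All other products being -1, the
    differences are mutually orthogonal and orthogonal to every sum, and distinct sums have product
    -4. *)
Lemma octahedron_gram (V : 'I_3 * bool -> vec) :
  (forall i, lor (V i) (V i) = 1) ->
  (forall i j, i.1 != j.1 -> lor (V i) (V j) = -1) ->
  (forall D, (forall i, lor D (V i) = 0) -> D = 0) ->
  (forall k, V (k, false) <> V (k, true)) ->
  forall k l, V (k, false) + V (k, true) = V (l, false) + V (l, true) /\
     lor (V (k, false)) (V (k, true)) = -3.
Proof.
move=> V1 Vadj Vspan Vneq.
pose D k := V (k, false) - V (k, true); pose S k := V (k, false) + V (k, true).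
have DD k l : k != l -> lor (D k) (D l) = 0.
  by move=> kl; rewrite /D !lorl !lorr !Vadj //=; ring.
have DS k l : lor (D k) (S l) = 0.
  rewrite /D /S !lorl !lorr; have [->|kl] := eqVneq k l.
    by rewrite !V1 (lorC (V (l, true))); ring.
  by rewrite !Vadj //=; ring.
have SS k l : k != l -> lor (S k) (S l) = -4.
  by move=> kl; rewrite /S !lorl !lorr !Vadj //=; ring.
(* A null difference would be orthogonal to every vertex, hence zero. *)
have Dn k : lor (D k) (D k) != 0.
  apply/eqP => h; apply: (Vneq k); apply/eqP; rewrite -subr_eq0; apply/eqP.
  have x1 : lor (V (k, false)) (V (k, true)) = 1.
    by move: h; rewrite /D !lorl !lorr !V1 (lorC (V (k, true))); lra.
  apply: Vspan => -[l b]; rewrite !lorl; have [->|kl] := eqVneq l k.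
    by case: b; rewrite V1 ?(lorC (V (k, true))) x1; ring.
  by rewrite !Vadj //= 1?eq_sym //; ring.
have tri k l m : k != l -> k != m -> l != m -> S l = S k /\ lor (S k) (S k) = -4.
  move=> kl km lm.
  by have [||||||e1 _ e2] := @octahedron_sums (D k) (D l) (D m) (S k) (S l) (S m); do ?split; auto.
have other (k l : 'I_3) : k != l -> exists m : 'I_3, k != m /\ l != m.
  case: k l => [[|[|[|k]]] hk] [[|[|[|l]]] hl] // _.
  - by exists (@Ordinal 3 2 isT).
  - by exists (@Ordinal 3 1 isT).
  - by exists (@Ordinal 3 2 isT).
  - by exists (@Ordinal 3 0 isT).
  - by exists (@Ordinal 3 1 isT).
  - by exists (@Ordinal 3 0 isT).
move=> k l; rewrite -/(S k) -/(S l); split.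
  have [->//|kl] := eqVneq k l; have [m [km lm]] := other _ _ kl.
  by have [-> _] := tri _ _ _ kl km lm.
have [l' kl] : exists l', k != l'.
  by case: k => [[|[|[|k]]] hk] //; [exists (@Ordinal 3 1 isT)|exists (@Ordinal 3 0 isT)|exists (@Ordinal 3 0 isT)].
have [m [km lm]] := other _ _ kl; have [_] := tri _ _ _ kl km lm.
by rewrite /S !lorl !lorr !V1 (lorC (V (k, true))); lra.
Qed.

(** The vertices [a], [b], [c], [d] of a square face lie in the orthogonal of its normal [F]. The
    vector [a + c - k *: (b + d)], with [k] chosen to annihilate the product with [b], is orthogonal
    to [F], [a - c], [b] and [d]; the rest of the proof shows that these four are independent. *)
Lemma quadrilateral_diagonals (a b c d F : vec) :
  [/\ lor a a = 1, lor b b = 1, lor c c = 1 & lor d d = 1] ->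
  [/\ lor a b = -1, lor b c = -1, lor c d = -1 & lor a d = -1] ->
  [/\ lor F a = 0, lor F b = 0, lor F c = 0 & lor F d = 0] -> F <> 0 ->
  [/\ 0 < ltime a, 0 < ltime b, 0 < ltime c & 0 < ltime d] ->
  (forall t, a - c <> t *: (a + b)) -> (forall t, b - d <> t *: (b + c)) ->
  exists k, a + c = k *: (b + d).
Proof.
move=> [aa bb cc dd] [ab bc cd ad] [Fa Fb Fc Fd] F0 [ta tb tc td] n1 n2.
(* If [lor u w] were 1, then [u - w] and [u + v] would be null and orthogonal, hence parallel, which
   is excluded. *)
have not1 (u v w : vec) : lor u u = 1 -> lor v v = 1 -> lor w w = 1 -> lor u v = -1 -> lor v w = -1 ->
    0 < ltime u -> 0 < ltime v -> (forall t, u - w <> t *: (u + v)) -> lor u w != 1.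
  move=> uu vv ww uv vw tu tv h; apply/eqP => uw.
  have t0 : ltime (u + v) != 0 by rewrite ltimeD gt_eqF // addr_gt0.
  apply: (h (ltime (u - w) / ltime (u + v))).
  have : ltime (u + v) *: (u - w) = ltime (u - w) *: (u + v).
    apply: lor_null_parallel; rewrite !lorl !lorr ?(lorC w u) ?(lorC v u) ?(lorC w v) ?uu ?vv ?ww ?uv ?vw ?uw; ring.
  move=> e; apply: (scalerI t0); rewrite e scalerA; congr (_ *: _).
  by rewrite mulrC divfK.
have xn := not1 a b c aa bb cc ab bc ta tb n1.
have yn := not1 b c d bb cc dd bc cd tb tc n2.
set x := lor a c in xn; set y := lor b d in yn.
have [D DE] : exists D, D = a - c by exists (a - c).
have DD : lor D D != 0.
  rewrite DE !lorl !lorr aa cc (lorC c a) -/x.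
  by apply/eqP => h; move/eqP: xn; apply; lra.
have Db : lor D b = 0 by rewrite DE !lorl ab (lorC c b) bc; ring.
have Dd : lor D d = 0 by rewrite DE !lorl ad cd; ring.
have DF : lor D F = 0 by rewrite DE !lorl (lorC a) (lorC c) Fa Fc; ring.
have scal k (v : vec) : k *: v = 0 -> v <> 0 -> k = 0.
  by move=> /eqP; rewrite scaler_eq0 => /orP[/eqP//|/eqP].
(* If [y] were -1, then [b + d] would be orthogonal to [F], [a - c], [b - d] and itself, hence zero,
   although its product with [a] is -2. *)
have ym1 : y != -1.
  apply/eqP => ym; have [N NE] : exists N, N = b + d by exists (b + d).
  have DN : lor D N = 0 by rewrite NE lorDr Db Dd addr0.
  have bN : lor b N = 0 by rewrite NE lorDr bb -/y ym; ring.
  have dN : lor d N = 0 by rewrite NE lorDr dd (lorC d b) -/y ym; ring.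
  have Na : lor N a = -2 by rewrite NE !lorl (lorC b) (lorC d) ab ad; ring.
  have N0 : N = 0.
    apply: (@free_perp _ F D (b - d) N).
    - move=> p q r s e.
      have q0 : q = 0.
        have := congr1 (lor D) e; rewrite !lorr DF Db Dd DN => h.
        have /eqP : q * lor D D = 0 by lra.
        by rewrite mulf_eq0 (negbTE DD) orbF => /eqP.
      have r0 : r = 0.
        have := congr1 (lor (b - d)) e; rewrite !lorl !lorr.
        rewrite (lorC b F) (lorC d F) (lorC b D) (lorC d D) Fb Fd Db Dd bb dd.
        by rewrite bN dN (lorC d b) -/y ym; lra.
      move: e; rewrite q0 r0 !scale0r !addr0 => e.
      have s0 : s = 0.
        have := congr1 (lor a) e; rewrite !lorr (lorC a F) Fa (lorC a N) Na; lra.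
      by move: e; rewrite s0 scale0r addr0 => /scal/(_ F0) ->.
    - by rewrite NE !lorl (lorC b) (lorC d) Fb Fd; ring.
    - by rewrite NE !lorl (lorC b) (lorC d) Db Dd; ring.
    - by rewrite NE !lorl !lorr bb dd (lorC d b); ring.
    - by rewrite NE !lorl !lorr bb dd (lorC d b) -/y ym; ring.
  by move: Na; rewrite N0 lor0l; lra.
have y1 : 1 + y != 0.
  by apply/eqP => h; move/eqP: ym1; apply; lra.
exists (-2 / (1 + y)); apply/eqP; rewrite -subr_eq0; apply/eqP.
apply: (@free_perp _ F D b d).
- move=> p q r s e.
  have q0 : q = 0.
    have := congr1 (lor D) e; rewrite !lorr DF Db Dd => h.
    have /eqP : q * lor D D = 0 by lra.
    by rewrite mulf_eq0 (negbTE DD) orbF => /eqP.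
  have h1 : r + s * y = 0.
    have := congr1 (lor b) e; rewrite !lorr (lorC b F) Fb bb q0 -/y; lra.
  have h2 : r * y + s = 0.
    have := congr1 (lor d) e; rewrite !lorr (lorC d F) Fd dd q0 (lorC d b) -/y; lra.
  have y2 : 1 - y * y != 0.
    have -> : 1 - y * y = (1 + y) * (1 - y) by ring.
    by rewrite mulf_neq0 // subr_eq0 eq_sym.
  have r0 : r = 0.
    apply: (mulIf y2); rewrite mul0r.
    have -> : r * (1 - y * y) = (r + s * y) - y * (r * y + s) by ring.
    by rewrite h1 h2; ring.
  have s0 : s = 0 by move: h2; rewrite r0; lra.
  by move: e; rewrite q0 r0 s0 !scale0r !addr0 => /scal/(_ F0) ->.
- by rewrite !lorl (lorC a) (lorC b) (lorC c) (lorC d) Fa Fb Fc Fd; ring.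
- by rewrite !lorl (lorC b) (lorC d) Db Dd DE !lorr aa cc (lorC c a); ring.
- by rewrite !lorl ab (lorC c b) bc bb (lorC d b) -/y; field.
- by rewrite !lorl ad cd dd -/y; field.
Qed.

(* Comparing the three expressions of [E1 + E2 + E3 + E4] forces the six
   ratios to agree, and the Gram relations then force them to be 1. *)
Lemma cube_gram (E1 E2 E3 E4 O1 O2 O3 O4 : vec) k12 k13 k14 k23 k24 k34 :
  [/\ lor E1 E1 = 1, lor E2 E2 = 1, lor E3 E3 = 1 & lor E4 E4 = 1] ->
  [/\ lor O1 O1 = 1, lor O2 O2 = 1, lor O3 O3 = 1 & lor O4 O4 = 1] ->
  [/\ lor E1 O2 = -1, lor E1 O3 = -1 & lor E1 O4 = -1] ->
  [/\ lor E2 O1 = -1, lor E2 O3 = -1 & lor E2 O4 = -1] ->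
  [/\ lor E3 O1 = -1, lor E3 O2 = -1 & lor E3 O4 = -1] ->
  [/\ lor E4 O1 = -1, lor E4 O2 = -1 & lor E4 O3 = -1] ->
  [/\ E1 + E2 = k12 *: (O3 + O4), E1 + E3 = k13 *: (O2 + O4) &
      E1 + E4 = k14 *: (O2 + O3)] ->
  [/\ E3 + E4 = k34 *: (O1 + O2), E2 + E4 = k24 *: (O1 + O3) &
      E2 + E3 = k23 *: (O1 + O4)] ->
  [/\ 0 < ltime E1, 0 < ltime E2, 0 < ltime O3 & 0 < ltime O4] ->
  (forall z, [/\ lor z E1 = 0, lor z E2 = 0, lor z E3 = 0 & lor z E4 = 0] ->
     [/\ lor z O1 = 0, lor z O2 = 0, lor z O3 = 0 & lor z O4 = 0] -> z = 0) ->
  [/\ lor E1 E2 = -3, lor E1 E3 = -3, lor E1 E4 = -3 & lor E2 E3 = -3] /\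
  [/\ lor E2 E4 = -3, lor E3 E4 = -3 & [/\ E1 + E2 = O3 + O4, E1 + E3 = O2 + O4,
    E1 + E4 = O2 + O3 & E3 + E4 = O1 + O2]].
Proof.
move=> [e11 e22 e33 e44] [q11 q22 q33 q44] [g12 g13 g14] [g21 g23 g24].
move=> [g31 g32 g34] [g41 g42 g43] [r12 r13 r14] [r34 r24 r23] [t1 t2 t3 t4] span.
have free : forall a b c d, a *: O1 + b *: O2 + c *: O3 + d *: O4 = 0 ->
    [/\ a = 0, b = 0, c = 0 & d = 0].
  apply: perp_free => z z1 z2 z3 z4.
  have h12 : lor z E1 + lor z E2 = 0 by rewrite -lorDr r12 !lorr z3 z4; ring.
  have h13 : lor z E1 + lor z E3 = 0 by rewrite -lorDr r13 !lorr z2 z4; ring.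
  have h14 : lor z E1 + lor z E4 = 0 by rewrite -lorDr r14 !lorr z2 z3; ring.
  have h23 : lor z E2 + lor z E3 = 0 by rewrite -lorDr r23 !lorr z1 z4; ring.
  by apply: span; split=> //; lra.
have rel1 : (k34 - k24) *: O1 + (k34 - k13) *: O2 + (k12 - k24) *: O3 + (k12 - k13) *: O4 = 0.
  have e : k12 *: (O3 + O4) + k34 *: (O1 + O2) = k13 *: (O2 + O4) + k24 *: (O1 + O3).
    by rewrite -r12 -r34 -r13 -r24; apply/rowP => m; rewrite !mxE; ring.
  apply/rowP => m; have := congr1 (fun v : vec => v 0 m) e; rewrite !mxE; lra.
have rel2 : (k34 - k23) *: O1 + (k34 - k14) *: O2 + (k12 - k14) *: O3 + (k12 - k23) *: O4 = 0.
  have e : k12 *: (O3 + O4) + k34 *: (O1 + O2) = k14 *: (O2 + O3) + k23 *: (O1 + O4).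
    by rewrite -r12 -r34 -r14 -r23; apply/rowP => m; rewrite !mxE; ring.
  apply/rowP => m; have := congr1 (fun v : vec => v 0 m) e; rewrite !mxE; lra.
have [f1 f2 f3 f4] := free _ _ _ _ rel1; have [f5 f6 f7 f8] := free _ _ _ _ rel2.
have K13 : k13 = k12 by lra.
have K14 : k14 = k12 by lra.
have K23 : k23 = k12 by lra.
have K24 : k24 = k12 by lra.
have K34 : k34 = k12 by lra.
rewrite ?K13 ?K14 ?K23 ?K24 ?K34 in r13 r14 r23 r24 r34.
set k := k12 in r12 r13 r14 r23 r24 r34.
have k0 : 0 < k.
  have := congr1 ltime r12; rewrite ltimeZ !ltimeD => e.
  have h1 : 0 < ltime E1 + ltime E2 by lra.
  have h2 : 0 < ltime O3 + ltime O4 by lra.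
  by rewrite e pmulr_lgt0 in h1.
have x12 : lor E1 E2 = -1 - 2 * k.
  by have := congr1 (lor E1) r12; rewrite !lorr e11 g13 g14; lra.
have x13 : lor E1 E3 = -1 - 2 * k.
  by have := congr1 (lor E1) r13; rewrite !lorr e11 g12 g14; lra.
have x14 : lor E1 E4 = -1 - 2 * k.
  by have := congr1 (lor E1) r14; rewrite !lorr e11 g12 g13; lra.
have x23 : lor E2 E3 = -1 - 2 * k.
  by have := congr1 (lor E2) r23; rewrite !lorr e22 g21 g24; lra.
have x24 : lor E2 E4 = -1 - 2 * k.
  by have := congr1 (lor E2) r24; rewrite !lorr e22 g21 g23; lra.
have x34 : lor E3 E4 = -1 - 2 * k.
  by have := congr1 (lor E3) r34; rewrite !lorr e33 g31 g32; lra.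
have y34 : k * (1 + lor O3 O4) = -2.
  by have := congr1 (lor O3) r12; rewrite !lorr (lorC O3 E1) (lorC O3 E2) g13 g23 q33; lra.
have y24 : k * (1 + lor O2 O4) = -2.
  by have := congr1 (lor O4) r13; rewrite !lorr (lorC O4 E1) (lorC O4 E3) g14 g34 q44 (lorC O4 O2); lra.
have z4 : lor E4 O4 - 1 = k * (lor O3 O4 + lor O2 O4).
  have := congr1 (lor O4) r14; rewrite !lorr (lorC O4 E1) (lorC O4 E4) g14.
  by rewrite (lorC O4 O2) (lorC O4 O3); lra.
have z4' : -2 - 4 * k = k * (lor E4 O4 - 1).
  by have := congr1 (lor E4) r12; rewrite !lorr (lorC E4 E1) (lorC E4 E2) x14 x24 g43; lra.
have k1 : k = 1.
  have e : lor E4 O4 - 1 = -4 - 2 * k by rewrite z4; lra.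
  have : k * k = 1 by move: z4'; rewrite e; lra.
  by move=> kk; nra.
rewrite k1 !scale1r in r12 r13 r14 r34.
by rewrite x12 x13 x14 x23 x24 x34 k1; split; [split; ring|split; [ring|ring|split]].
Qed.

(** For four unit vectors with equal mutual products, the sign combinations given by a Hadamard
    matrix are orthogonal; the balanced ones have square [4 - 4 * g] and the full sum [4 + 12 * g].
    It serves with [g = -1] for the tetrahedron and [g = -3] for a tetrahedron inscribed in the
    cube. *)
Lemma four_vector_frame (V1 V2 V3 V4 : vec) g kA kT :
  [/\ lor V1 V1 = 1, lor V2 V2 = 1, lor V3 V3 = 1 & lor V4 V4 = 1] ->
  [/\ lor V1 V2 = g, lor V1 V3 = g & lor V1 V4 = g] ->
  [/\ lor V2 V3 = g, lor V2 V4 = g & lor V3 V4 = g] ->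
  kA * kA * (4 - 4 * g) = 1 -> kT * kT * (4 + 12 * g) = -1 ->
  lorentz (frame (kA *: (V1 + V2 - V3 - V4)) (kA *: (V1 - V2 + V3 - V4))
    (kA *: (V1 - V2 - V3 + V4)) (kT *: (V1 + V2 + V3 + V4))).
Proof.
move=> [h1 h2 h3 h4] [h12 h13 h14] [h23 h24 h34] hA hT.
pose G := (h1, h2, h3, h4, h12, h13, h14, h23, h24, h34, lorC V2 V1, lorC V3 V1,
  lorC V4 V1, lorC V3 V2, lorC V4 V2, lorC V4 V3).
apply: lorentz_frame; split; rewrite !lorl !lorr !G ?h12 ?h13 ?h14 ?h23 ?h24 ?h34; try ring;
  do ?[by rewrite -[RHS]hA; ring]; by rewrite -[RHS]hT; ring.
Qed.

End Gram.

(** * The three embeddings *)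

Section Embeddings.
Context {R : realType}.
Local Notation s2 := (Num.sqrt 2 : R).
Local Notation vec := ('rV[R]_(2 + 1 + 1)).

Lemma conformal_frame n (r1 r2 r3 r4 : 'rV[R]_(n + 1)) s :
  [/\ lor r1 r1 = s, lor r2 r2 = s, lor r3 r3 = s & lor r4 r4 = - s] ->
  [/\ lor r1 r2 = 0, lor r1 r3 = 0 & lor r2 r3 = 0] ->
  [/\ lor r1 r4 = 0, lor r2 r4 = 0 & lor r3 r4 = 0] ->
  forall x y, lor (x *m frame r1 r2 r3 r4) (y *m frame r1 r2 r3 r4) = s * lor x y.
Proof.
move=> [h11 h22 h33 htt] [h12 h13 h23] [h1 h2 h3] u v.
have [a [b [c [t ->]]]] := v4P u; have [a' [b' [c' [t' ->]]]] := v4P v.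
rewrite !mul_frame !lorl !lorr (lorC r2 r1) (lorC r3 r1) (lorC r3 r2).
rewrite (lorC r4 r1) (lorC r4 r2) (lorC r4 r3) h11 h22 h33 htt h12 h13 h23 h1 h2 h3.
by rewrite lor_v4; ring.
Qed.

Lemma orthogonal_frame n (r1 r2 r3 r4 w : 'rV[R]_(n + 1)) :
  [/\ lor r1 w = 0, lor r2 w = 0, lor r3 w = 0 & lor r4 w = 0] ->
  forall x, lor (x *m frame r1 r2 r3 r4) w = 0.
Proof.
move=> [h1 h2 h3 h4] u; have [a [b [c [t ->]]]] := v4P u.
by rewrite mul_frame !lorl h1 h2 h3 h4; ring.
Qed.

(** Two block factorisations of one matrix equate [\det (1 - u *m F)] with [1 - F *m u], which is
    [1 - 2]. *)
Lemma det_refl n (F : 'rV[R]_(n + 1)) : lor F F != 0 -> \det (refl F) = -1.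
Proof.
move=> F0; pose u : 'cV[R]_(n + 1) := (2 / lor F F) *: (leta *m F^T).
have -> : refl F = 1%:M - u *m F by rewrite /refl /u -scalemxAl.
have e1 : block_mx 1%:M u F 1%:M =
    block_mx 1%:M 0 F 1%:M *m block_mx 1%:M u 0 (1%:M - F *m u).
  rewrite mulmx_block !mul1mx !mulmx0 !mul0mx !addr0 !mulmx1.
  by rewrite addrC subrK.
have e2 : block_mx 1%:M u F 1%:M =
    block_mx 1%:M u 0 1%:M *m block_mx (1%:M - u *m F) 0 F 1%:M.
  by rewrite mulmx_block !mul1mx !mulmx0 !mul0mx !add0r !mulmx1 subrK.
have := congr1 determinant e2; rewrite {1}e1 !det_mulmx !det_lblock !det_ublock.
rewrite !det1 !mul1r !mulr1 => <-; rewrite det_mx11 !mxE.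
have -> : \sum_j F 0 j * u j 0 = (F *m u) 0 0 by rewrite mxE.
rewrite /u -scalemxAr mulmxA mxE -/(lor F F) divfK //=.
ring.
Qed.

Let s2s2 : s2 * s2 = 2 := sqrt2_sqr R.
Let s20 : 0 < s2 := sqrt2_gt0 R.

Definition v5E := (@v5Z R, @v5D R, @v5N R).

Definition oidx (a b : bool) : 'I_(3 + 1) :=
  if a then (if b then @Ordinal 4 3 isT else @Ordinal 4 2 isT)
  else (if b then @Ordinal 4 1 isT else @Ordinal 4 0 isT).

Lemma oidxP (i : 'I_(3 + 1)) : exists a b, i = oidx a b.
Proof.
case: i => [[|[|[|[|m]]]] hm] //.
- by exists false, false; apply: val_inj.
- by exists false, true; apply: val_inj.
- by exists true, false; apply: val_inj.
- by exists true, true; apply: val_inj.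
Qed.

Definition tetra_V (i : bool * bool) : vec :=
  v4 (s2 / 2 * sgb i.1) (s2 / 2 * sgb i.2) (s2 / 2 * (sgb i.1 * sgb i.2)) (s2 / 2).

(** The normal of the facet opposite to vertex [i]: for two distinct indices the three sign products
    add up to -1. *)
Definition tetra_F (i : bool * bool) : vec :=
  v4 (- sgb i.1) (- sgb i.2) (- (sgb i.1 * sgb i.2)) 1.

Definition tetra_J : 'M[R]_(2 + 1 + 1, 3 + 1 + 1) :=
  frame (v5 2^-1 2^-1 (- 2^-1) (- 2^-1) 0) (v5 2^-1 (- 2^-1) 2^-1 (- 2^-1) 0)
        (v5 2^-1 (- 2^-1) (- 2^-1) 2^-1 0) (v5 2^-1 2^-1 2^-1 2^-1 s2).

(** This is [fvec] with all signs positive, so the image of [tetra_J] is the mirror containing the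
    vertices of that facet. *)
Definition tetra_w : 'rV[R]_(3 + 1 + 1) := v5 (s2 / 2) (s2 / 2) (s2 / 2) (s2 / 2) 1.

Lemma tetrahedral_embedding (B : polytopal_packing R 2) :
  tetrahedral B -> has_orthoplicial_section B.
Proof.
move=> tB; have h2 := sqrt2_sqr R.
have [p [vP p1 pedge _ _]] := combinatorial_data tB (@simplexW_inj R)
  (@simplex_vertex R) (@simplex_ex R).
pose V i := uvec (p i).
have Vadj i j : i <> j -> lor (V i) (V j) = -1.
  move=> ij; have [H HQ hH] := @simplex_face R (pred2 i j).
  apply: pedge HQ _ => // t; rewrite hH /=.
  by split=> [/orP[/eqP|/eqP]|[->|->]]; rewrite ?eqxx ?orbT; [left|right|..].
pose S := V (false, false) + V (false, true) + V (true, false) + V (true, true).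
pose LP := frame
  (s2 / 4 *: (V (false, false) + V (false, true) - V (true, false) - V (true, true)))
  (s2 / 4 *: (V (false, false) - V (false, true) + V (true, false) - V (true, true)))
  (s2 / 4 *: (V (false, false) - V (false, true) - V (true, false) + V (true, true)))
  (s2 / 4 *: S).
have lLP : lorentz LP.
  apply: (@four_vector_frame R _ _ _ _ (-1)).
  - by split; apply: (p1 _).1.
  - by split; apply: Vadj.
  - by split; apply: Vadj.
  - by transitivity (s2 * s2 / 2); [field|rewrite s2s2; field].
  - by transitivity (- (s2 * s2 / 2)); [field|rewrite s2s2; field].
have LP0 : 0 < ltime (row_mx 0 1%:M *m LP).
  rewrite v4_time mul_frame !scale0r !add0r scale1r ltimeZ; apply: mulr_gt0; first by rewrite divr_gt0.
  by rewrite /S !ltimeD !addr_gt0 //; apply: (p1 _).2.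
have VE i : uvec (p i) = tetra_V i *m LP.
  rewrite -/(V i) mul_frame; case: i => [[] []]; rewrite /sgb /S /=;
    move: (V (false, false)) (V (false, true)) (V (true, false)) (V (true, true)) => X1 X2 X3 X4;
    apply/rowP => m; rewrite !mxE;
    move: (X1 _ _) (X2 _ _) (X3 _ _) (X4 _ _) => x1 x2 x3 x4;
    have e1 := congr1 (fun y => y * x1) s2s2; have e2 := congr1 (fun y => y * x2) s2s2;
    have e3 := congr1 (fun y => y * x3) s2s2; have e4 := congr1 (fun y => y * x4) s2s2;
    by rewrite /= in e1 e2 e3 e4; lra.
have F0 j : lor (tetra_F j) (tetra_F j) != 0.
  by rewrite lor_v4; case: j => [[] []]; rewrite /sgb /=; apply/eqP; lra.
have sel (z : vec) : z != 0 -> (forall i, lor z (tetra_V i) <= 0) ->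
    exists j, forall i, lor z (tetra_V i) = 0 -> lor (tetra_F j) (tetra_V i) = 0.
  move=> z0 zle.
  (* Some vertex is not orthogonal to [z]; the facet opposite to it contains all the others. *)
  have [j zj] : exists j, lor z (tetra_V j) != 0.
    apply: contrapT => hn; move/eqP: z0; apply.
    have h i : lor z (tetra_V i) = 0.
      by apply/eqP; apply: contrapT => hi; apply: hn; exists i; apply/negP.
    have [x [y [w [t zE]]]] := v4P z; rewrite zE in h *.
    have k i : sgb i.1 * x + sgb i.2 * y + sgb i.1 * sgb i.2 * w - t = 0.
      have := h i; rewrite lor_v4 => e; apply: (mulfI (sqrt2_neq0 R)); rewrite mulr0.
      by rewrite -[RHS](mulr0 2) -e; field.
    have := k (false, false); have := k (false, true); have := k (true, false).
    have := k (true, true); rewrite /sgb /= => k1 k2 k3 k4.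
    by apply/eqP; rewrite v4_eq0; apply/and4P; split; apply/eqP; lra.
  exists j => i zi; have ij : i <> j by move=> e; rewrite -e zi eqxx in zj.
  rewrite lor_v4; case: i j ij {zi zj} => [[] []] [[] []] // _; rewrite /sgb /=; lra.
have [L [nu [lL bE dE cE [nu0 nu1]]]] := std_model lLP LP0 vP VE F0 sel.
have JV i : ovec (oidx i.1 i.2, false) = tetra_V i *m tetra_J + 0 *: tetra_w.
  clear -h2; rewrite scale0r addr0 mul_frame !v5E ovecE; case: i => [[] []]; rewrite /sgb /=;
    by congr v5; lra.
have Jconf x y : lor (x *m tetra_J) (y *m tetra_J) = 1 * lor x y.
  by apply: conformal_frame; clear -h2; split; rewrite lor_v5; lra.
have Jorth x : lor (x *m tetra_J) tetra_w = 0.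
  by apply: orthogonal_frame; clear -h2; split; rewrite lor_v5; lra.
apply: (@assemble R B _ _ tetra_V tetra_F L nu lL bE dE cE nu0 nu1 _ F0 tetra_J 1 tetra_w
  ltr01 Jconf Jorth _ _ (fun=> 0) (fun i => (oidx i.1 i.2, false)) JV (fun=> 1) (fun=> True)).
- by move=> i; rewrite lor_v4; case: i => [[] []]; rewrite /sgb /=; lra.
- by rewrite lor_v5; apply/eqP; lra.
- move=> x; have [a [b [c [t ->]]]] := v4P x; rewrite ltime_v4 mul_frame !v5E ltime_v5.
  by move=> t0; have : 0 < t * s2 by [rewrite mulr_gt0]; lra.
- by [].
- by move=> *; rewrite mulr1.
- by [].
- by [].
- by [].
- by move=> *; rewrite mulr1.
- by [].
- move=> j; left; split=> //; exists s2.
  exists (sgf (j == (false, false)) (j == (false, true)) (j == (true, false)) (j == (true, true))).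
  split; first exact: sqrt2_neq0.
  clear -h2; rewrite fvecE mul_frame !v5E sqrt2V; case: j => [[] []]; rewrite /sgb /=;
    by congr v5; lra.
- move=> hz q; have hV i : exists z : int, - lor (tetra_V i *m tetra_J) (1^-1 *: (nu *m tetra_J)) = z%:~R.
    by have [z e] := hz i; exists z; rewrite invr1 scale1r Jconf mul1r.
  case: q => i []; have [a [b ->]] := oidxP i; last first.
    have [z e] := hV (a, b); exists z; rewrite -e; congr (- lor _ _).
    by have := JV (a, b); rewrite scale0r addr0.
  (* A vertex outside the section is an integer combination of the four in it modulo [tetra_w],
     which is orthogonal to the curvature vector. *)
  have oE : ovec (oidx a b, true) = tetra_V (false, false) *m tetra_J + tetra_V (false, true) *m tetra_J
    + tetra_V (true, false) *m tetra_J + tetra_V (true, true) *m tetra_J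
    - tetra_V (a, b) *m tetra_J - 2 *: tetra_w.
    clear -h2; rewrite !mul_frame !v5E ovecE; case: a; case: b; rewrite /sgb /=; by congr v5; lra.
  have [z1 e1] := hV (false, false); have [z2 e2] := hV (false, true).
  have [z3 e3] := hV (true, false); have [z4 e4] := hV (true, true); have [z5 e5] := hV (a, b).
  exists (z1 + z2 + z3 + z4 - z5).
  have w0 : lor tetra_w (1^-1 *: (nu *m tetra_J)) = 0 by rewrite lorZr lorC Jorth mulr0.
  rewrite oE !lorDl !lorNl lorZl w0 intrB !intrD -e1 -e2 -e3 -e4 -e5; ring.
Qed.

(* The vertices of the octahedron are also the facets of the cube. *)
Definition octa_V (i : 'I_3 * bool) : vec :=
  let s := s2 * sgb i.2 in
  v4 (if i.1 == 0 :> nat then s else 0) (if i.1 == 1 :> nat then s else 0)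
     (if i.1 == 2 :> nat then s else 0) 1.

(** Unit normals of the eight triangles. Adding or subtracting [octa_w] after [octa_J] supplies the
    fourth sign of a facet normal of the orthoplex, up to the factor [s2]. *)
Definition octa_F (i : bool * bool * bool) : vec :=
  v4 (sgb i.1.1) (sgb i.1.2) (sgb i.2) s2.

Definition octa_J : 'M[R]_(2 + 1 + 1, 3 + 1 + 1) :=
  frame (v5 1 0 0 0 0) (v5 0 1 0 0 0) (v5 0 0 1 0 0) (v5 0 0 0 0 1).

Definition octa_w : 'rV[R]_(3 + 1 + 1) := v5 0 0 0 1 0.

Lemma lor_octa_V i : lor (octa_V i) (octa_V i) = 1.
Proof.
have h2 := sqrt2_sqr R; rewrite lor_v4.
by case: i => [[[|[|[|m]]] hm] []] //; rewrite /sgb /=; lra.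
Qed.

(** Were [m] odd, the left side would be a sum of three odd squares, hence odd. *)
Lemma even_of_square_sum (m a b c : int) :
  (m - 2 * a) ^+ 2 + (m - 2 * b) ^+ 2 + (m - 2 * c) ^+ 2 = 2 * m ^+ 2 ->
  exists q : int, m = 2 * q.
Proof.
move=> e; have [q mq] : exists q : int, m = 2 * q \/ m = 2 * q + 1.
  exists (m %/ 2)%Z; have := divz_eq m 2; have := modz_ge0 m (isT : (2 : int) != 0).
  have := ltz_pmod m (isT : (0 : int) < 2); lia.
exists q; case: mq => // mq; exfalso; move: e; rewrite mq; nia.
Qed.

(** All components along [octa_w] are 0, so any sign there fixes the vertices. The determinant is
    the multiplicative sign that equals -1 on every inversion, as the splitting into two facet
    reflections requires. *)
Lemma octahedral_embedding (B : polytopal_packing R 2) :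
  octahedral B -> has_orthoplicial_section B.
Proof.
move=> tB; have h2 := sqrt2_sqr R.
have [p [vP p1 pedge _ [pspan pindep]]] := combinatorial_data tB (@orth_vertex_inj R 3 1 ltr01)
  (@cross_vertex R) (@cross_ex R).
pose o0 := @Ordinal 3 0 isT; pose o1 := @Ordinal 3 1 isT; pose o2 := @Ordinal 3 2 isT.
have [V VE] : exists V, V = fun i => uvec (p i) by eexists.
have V1 i : lor (V i) (V i) = 1 by rewrite VE; apply: (p1 _).1.
have Vt i : 0 < ltime (V i) by rewrite VE; apply: (p1 _).2.
have Vadj i j : i.1 != j.1 -> lor (V i) (V j) = -1.
  move=> ij; have [H HQ hH] := @cross_edge R i j ij; rewrite VE.
  by apply: pedge HQ hH => e; rewrite e eqxx in ij.
have Vneq k : V (k, false) <> V (k, true).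
  move=> e; have [l kl] : exists l, k != l.
    by have [->|h] := eqVneq k o0; [exists o1|exists o0].
  have := pindep (k, false) (l, false) (k, true) 1 0 (-1).
  rewrite -[uvec (p (k, false))]/((fun i => uvec (p i)) (k, false)).
  rewrite -[uvec (p (l, false))]/((fun i => uvec (p i)) (l, false)).
  rewrite -[uvec (p (k, true))]/((fun i => uvec (p i)) (k, true)) -VE.
  rewrite e scale1r scale0r addr0 scaleN1r subrr => h.
  have : (-1 : R) = 0.
    by apply: h => // -[h']; move: kl; rewrite h' eqxx.
  by lra.
have Vspan D : (forall i, lor D (V i) = 0) -> D = 0.
  by move=> h; apply: pspan => i; have := h i; rewrite VE.
have gram := octahedron_gram V1 Vadj Vspan Vneq.
pose T := 2^-1 *: (V (o0, false) + V (o0, true)).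
pose A k := s2 / 4 *: (V (k, false) - V (k, true)).
have Sk k : V (k, false) + V (k, true) = V (o0, false) + V (o0, true) by have [] := gram k o0.
have gk k : lor (V (k, false)) (V (k, true)) = -3 by have [] := gram k o0.
pose LP := frame (A o0) (A o1) (A o2) T.
have AA k : lor (A k) (A k) = 1.
  rewrite /A !lorl !lorr !V1 (lorC (V (k, true))) gk.
  by transitivity (s2 * s2 / 2); [field|rewrite h2; field].
have AB k l : k != l -> lor (A k) (A l) = 0.
  by move=> kl; rewrite /A !lorl !lorr !Vadj //=; ring.
have AT k : lor (A k) T = 0.
  rewrite /A /T -(Sk k) !lorl !lorr !V1 (lorC (V (k, true))) gk; ring.
have lLP : lorentz LP.
  apply: lorentz_frame; split; do ?[exact: AA|exact: AT|exact: AB].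
  by rewrite /T !lorl !lorr !V1 (lorC (V (o0, true))) gk; lra.
have LP0 : 0 < ltime (row_mx 0 1%:M *m LP).
  rewrite v4_time mul_frame !scale0r !add0r scale1r ltimeZ; apply: mulr_gt0 => //.
  by rewrite ltimeD addr_gt0.
have VLP i : uvec (p i) = octa_V i *m LP.
  rewrite -[LHS]/((fun i => uvec (p i)) i) -VE mul_frame.
  have key k b : V (k, b) = (s2 * sgb b) *: A k + T.
    rewrite /T -(Sk k) /A; case: b; rewrite /sgb; move: (V (k, false)) (V (k, true)) => X Y;
      apply/rowP => m; rewrite !mxE; move: (X _ _) (Y _ _) => x y;
      have e1 := congr1 (fun z => z * x) h2; have e2 := congr1 (fun z => z * y) h2;
      by rewrite /= in e1 e2; lra.
  case: i => [[[|[|[|m]]] hm] b] //; rewrite /octa_V /= !scale0r ?add0r ?addr0 scale1r.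
  - by rewrite (_ : Ordinal hm = o0) ?key //; apply: val_inj.
  - by rewrite (_ : Ordinal hm = o1) ?key //; apply: val_inj.
  - by rewrite (_ : Ordinal hm = o2) ?key //; apply: val_inj.
have F1 j : lor (octa_F j) (octa_F j) = 1 by rewrite lor_v4 !sgb_sqr h2; ring.
have F0 j : lor (octa_F j) (octa_F j) != 0 by rewrite F1 oner_eq0.
have sel (z : vec) : z != 0 -> (forall i, lor z (octa_V i) <= 0) ->
    exists j, forall i, lor z (octa_V i) = 0 -> lor (octa_F j) (octa_V i) = 0.
  move=> z0 zle; have [x [y [w [t zE]]]] := v4P z; rewrite zE in z0 zle *.
  have le0 b : x * (s2 * sgb b) - t <= 0.
    by have := zle (o0, b); rewrite lor_v4 /=; lra.
  have le1 b : y * (s2 * sgb b) - t <= 0.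
    by have := zle (o1, b); rewrite lor_v4 /=; lra.
  have le2 b : w * (s2 * sgb b) - t <= 0.
    by have := zle (o2, b); rewrite lor_v4 /=; lra.
  have l0f := le0 false; have l0t := le0 true; have l1f := le1 false; have l1t := le1 true.
  have l2f := le2 false; have l2t := le2 true.
  rewrite /sgb in l0f l0t l1f l1t l2f l2t.
  have t0 : 0 < t.
    rewrite lt_neqAle; apply/andP; split; last by lra.
    apply/eqP => t0; move/negP: z0; apply; rewrite v4_eq0 -t0 eqxx.
    have zz x' : x' * s2 = 0 -> x' == 0.
      by move/eqP; rewrite mulf_eq0 (negbTE (sqrt2_neq0 R)) orbF.
    by rewrite !zz //; lra.
  have pick x' b : x' * (s2 * sgb b) - t = 0 -> b = (x' < 0).
    have [xn|xp] := ltP x' 0.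
      have : x' * s2 < 0 by rewrite pmulr_llt0.
      by case: b => //; rewrite /sgb => ? ?; exfalso; lra.
    have : 0 <= x' * s2 by rewrite pmulr_lge0.
    by case: b => //; rewrite /sgb => ? ?; exfalso; lra.
  have ss b : sgb b * (s2 * sgb b) = s2.
    by rewrite mulrCA sgb_sqr mulr1.
  exists (x < 0, y < 0, w < 0) => -[[[|[|[|m]]] hm] b] //; rewrite !lor_v4 /= => h.
  - by rewrite -(@pick x b); [rewrite ss; ring|lra].
  - by rewrite -(@pick y b); [rewrite ss; ring|lra].
  - by rewrite -(@pick w b); [rewrite ss; ring|lra].
have [L [nu [lL bE dE cE [nu0 nu1]]]] := std_model lLP LP0 vP VLP F0 sel.
pose vi (i : 'I_3 * bool) := (widen_ord (isT : (3 <= 3 + 1)%N) i.1, i.2).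
have JV i : ovec (vi i) = octa_V i *m octa_J + 0 *: octa_w.
  clear -h2; rewrite scale0r addr0 mul_frame !v5E ovecE; case: i => [[[|[|[|m]]] hm] b] //=;
    by congr v5; lra.
have Jconf x y : lor (x *m octa_J) (y *m octa_J) = 1 * lor x y.
  by apply: conformal_frame; clear -h2; split; rewrite lor_v5; lra.
have Jorth x : lor (x *m octa_J) octa_w = 0.
  by apply: orthogonal_frame; clear -h2; split; rewrite lor_v5; lra.
apply: (@assemble R B _ _ octa_V octa_F L nu lL bE dE cE nu0 nu1 _ F0 octa_J 1 octa_w
  ltr01 Jconf Jorth _ _ (fun=> 0) vi JV determinant (fun=> True)).
- exact: lor_octa_V.
- by rewrite lor_v5; apply/eqP; lra.
- move=> x; have [a [b [c [t ->]]]] := v4P x; rewrite ltime_v4 mul_frame !v5E ltime_v5.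
  by move=> t0; lra.
- exact: det1.
- by move=> M M'; rewrite det_mulmx.
- by [].
- by [].
- by [].
- by move=> *; rewrite mul0r.
- by [].
- move=> [[a b] c]; right; split; first exact: det_refl.
  split; first by rewrite Jconf mul1r F1 lor_v5; ring.
  exists s2, (sgf a b c false), (sgf a b c true); split; first exact: sqrt2_neq0.
  + clear -h2; rewrite !fvecE mul_frame !v5E sqrt2V /sgb; case: a; case: b; case: c => /=; by congr v5; lra.
  + clear -h2; rewrite !fvecE mul_frame !v5E sqrt2V /sgb; case: a; case: b; case: c => /=; by congr v5; lra.
- move=> hz; rewrite invr1 scale1r.
  have hV i : exists z : int, - lor (ovec (vi i)) (nu *m octa_J) = z%:~R.
    by have [z e] := hz i; exists z; rewrite JV scale0r addr0 Jconf mul1r.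
  move=> [[[|[|[|[|m]]]] hm] b] //.
  + by have := hV (o0, b); rewrite /vi (_ : widen_ord _ _ = Ordinal hm) //; apply: val_inj.
  + by have := hV (o1, b); rewrite /vi (_ : widen_ord _ _ = Ordinal hm) //; apply: val_inj.
  + by have := hV (o2, b); rewrite /vi (_ : widen_ord _ _ = Ordinal hm) //; apply: val_inj.
  (* Both vertices outside the hyperplane have curvature [t], half the sum of the curvatures [a0]
     and [b0] of an opposite pair. Nullity of [nu] becomes the equation of [even_of_square_sum], so
     this sum is even. *)
  have [n1 [n2 [n3 [t nuE]]]] := v4P nu.
  have [a0 ea0] := hz (o0, false); have [a1 ea1] := hz (o1, false).
  have [a2 ea2] := hz (o2, false); have [b0 eb0] := hz (o0, true).
  rewrite nuE !lor_v4 /= /sgb in ea0 ea1 ea2 eb0.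
  have nn : n1 * n1 + n2 * n2 + n3 * n3 = t * t by move: nu0; rewrite nuE lor_v4; lra.
  have mE : (a0 + b0)%:~R = 2 * t :> R by rewrite intrD -ea0 -eb0; lra.
  have sqE (a : int) n : - (s2 * n - t) = a%:~R -> ((a0 + b0 - 2 * a) ^+ 2)%:~R = 8 * (n * n) :> R.
    move=> e; rewrite rmorphXn /= intrB intrM mE -e.
    by transitivity (4 * (s2 * s2) * (n * n)); [ring|rewrite h2; ring].
  have [q eq] : exists q : int, a0 + b0 = 2 * q.
    apply: (@even_of_square_sum _ a0 a1 a2); apply: (@intr_inj R).
    have q0 := @sqE a0 n1 ltac:(rewrite -ea0; ring).
    have q1 := @sqE a1 n2 ltac:(rewrite -ea1; ring).
    have q2 := @sqE a2 n3 ltac:(rewrite -ea2; ring).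
    rewrite 2!intrD q0 q1 q2 intrM rmorphXn /= mE.
    by transitivity (8 * (n1 * n1 + n2 * n2 + n3 * n3)); [ring|rewrite nn; ring].
  exists q; rewrite nuE mul_frame !v5E ovecE /= lor_v5.
  by move: mE; rewrite eq intrM; lra.
Qed.

End Embeddings.

(** * The cubical packing inside the orthoplicial one *)

Lemma v4Z (R : realType) (k a b c t : R) : k *: v4 a b c t = v4 (k * a) (k * b) (k * c) (k * t).
Proof.
rewrite /v4 scale_row_mx scale_scalar_mx; congr row_mx.
by apply/rowP => -[[|[|[|m]]] hm] //; rewrite !mxE.
Qed.

Lemma v4B (R : realType) (a b c t a' b' c' t' : R) :
  v4 a b c t - v4 a' b' c' t' = v4 (a - a') (b - b') (c - c') (t - t').
Proof.
rewrite /v4 opp_row_mx add_row_mx -raddfB; congr row_mx.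
by apply/rowP => -[[|[|[|m]]] hm] //; rewrite !mxE.
Qed.

Lemma v4_inj (R : realType) (a b c t a' b' c' t' : R) :
  v4 a b c t = v4 a' b' c' t' -> [/\ a = a', b = b' & c = c'].
Proof. by move=> /eq_row_mx[/row3_inj]. Qed.

Section CubicalEmbedding.
Context {R : realType}.
Local Notation s2 := (Num.sqrt 2 : R).
Local Notation vec := ('rV[R]_(2 + 1 + 1)).
Local Notation idx := (bool * bool * bool)%type.

Definition cube_V (i : idx) : vec := v4 (sgb i.1.1) (sgb i.1.2) (sgb i.2) s2.

(** The factor is 1/2: a unit vertex of the orthoplex loses the square 1/2 of its component along
    the unit vector [cube_w]. *)
Definition cube_J : 'M[R]_(2 + 1 + 1, 3 + 1 + 1) :=
  frame (v5 (s2 / 4) (s2 / 4) (- (s2 / 4)) (- (s2 / 4)) 0)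
        (v5 (s2 / 4) (- (s2 / 4)) (s2 / 4) (- (s2 / 4)) 0)
        (v5 (s2 / 4) (- (s2 / 4)) (- (s2 / 4)) (s2 / 4) 0)
        (v5 0 0 0 0 (s2 / 2)).

Definition cube_w : 'rV[R]_(3 + 1 + 1) := v5 2^-1 2^-1 2^-1 2^-1 0.

(** Selects one of the two tetrahedra inscribed in the cube; its vertices correspond to the positive
    vertices of the orthoplex. *)
Definition cube_even (i : idx) : bool := i.2 == i.1.1 (+) i.1.2.

Definition cube_om (i : idx) : R := if cube_even i then s2 / 2 else - (s2 / 2).

(** An odd vertex is the antipode of an even one, and antipodes are matched with antipodes. *)
Definition cube_vi (i : idx) : 'I_(3 + 1) * bool :=
  if cube_even i then (oidx i.1.1 i.1.2, false) else (oidx (~~ i.1.1) (~~ i.1.2), true).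

(* The residues modulo 4 of the spatial coordinates separate the orbits of the
   eight vertices. *)
Definition cube_class (i : idx) (x : vec) : Prop :=
  exists m1 m2 m3 y : int, x = v4 (sgb i.1.1 + 4 * m1%:~R) (sgb i.1.2 + 4 * m2%:~R)
    (sgb i.2 + 4 * m3%:~R) (s2 * y%:~R).

Lemma cube_class_V i : cube_class i (cube_V i).
Proof.
exists 0, 0, 0, 1; rewrite /cube_V; congr v4; by rewrite ?mulr0 ?addr0 ?mulr1.
Qed.

Lemma cube_class_inj i j x : cube_class i x -> cube_class j x -> i = j.
Proof.
have key (a b : bool) (m m' : int) : sgb a + 4 * m%:~R = sgb b + 4 * m'%:~R :> R -> a = b.
  move=> e; have h : ((4 * (m - m'))%:~R : R) = sgb b - sgb a by rewrite intrM intrB; lra.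
  move: h; rewrite /sgb; case: a {e}; case: b => // h; exfalso.
    have : 4 * (m - m') = 2 :> int by apply: (@intr_inj R); rewrite h; lra.
    lia.
  have : 4 * (m - m') = -2 :> int by apply: (@intr_inj R); rewrite h; lra.
  lia.
move=> [m1 [m2 [m3 [y ->]]]] [m1' [m2' [m3' [y' /v4_inj[e1 e2 e3]]]]].
case: i j e1 e2 e3 => [[a b] c] [[a' b'] c'] /=.
by move=> /key-> /key-> /key->.
Qed.

Definition szb (b : bool) : int := if b then -1 else 1.

Lemma szbE b : (szb b)%:~R = sgb b :> R.
Proof. by case: b. Qed.

(** A facet reflection changes one spatial coordinate [x] into [x - 4 * x + 4 * y * b], with [b] the
    sign of the facet and [s2 * y] the time. The two factors [s2] have combined, so the residue
    modulo 4 is kept. *)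
Lemma cube_class_refl i j x : cube_class i x -> cube_class i (x *m refl (octa_V j)).
Proof.
have h2 := sqrt2_sqr R.
have co (a b : bool) (m y : int) (Y : R) : Y = (sgb a + 4 * m%:~R) * (s2 * sgb b) - s2 * y%:~R * 1 ->
  sgb a + 4 * m%:~R - 2 * Y / 1 * (s2 * sgb b) =
    sgb a + 4 * (m - szb a - 4 * m + y * szb b)%:~R :> R /\
  s2 * y%:~R - 2 * Y / 1 * 1 = s2 * (3 * y - 2 * szb b * (szb a + 4 * m))%:~R :> R.
  move=> ->; rewrite !(intrD, mulrNz, intrM) !szbE divr1; split; last by ring.
  transitivity (sgb a + 4 * m%:~R - 2 * (s2 * s2) * (sgb b * sgb b) * (sgb a + 4 * m%:~R)
    + 2 * (s2 * s2) * sgb b * y%:~R); first by ring.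
  by rewrite h2 sgb_sqr; ring.
move=> [m1 [m2 [m3 [y ->]]]]; rewrite mul_refl lor_octa_V.
case: j => [[[|[|[|m]]] hm] b] //; rewrite /octa_V /= lor_v4 v4Z v4B; set Y := (X in _ * X / _).
- have [e1 e2] := @co i.1.1 b m1 y Y ltac:(rewrite /Y; ring).
  do 4 eexists; rewrite e1 e2; congr v4; by rewrite mulr0 subr0.
- have [e1 e2] := @co i.1.2 b m2 y Y ltac:(rewrite /Y; ring).
  do 4 eexists; rewrite e1 e2; congr v4; by rewrite mulr0 subr0.
- have [e1 e2] := @co i.2 b m3 y Y ltac:(rewrite /Y; ring).
  do 4 eexists; rewrite e1 e2; congr v4; by rewrite mulr0 subr0.
Qed.

Lemma cube_J_conf : forall x y, lor (x *m cube_J) (y *m cube_J) = 2^-1 * lor x y.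
Proof. by have h2 := sqrt2_sqr R; apply: conformal_frame; split; rewrite lor_v5; lra. Qed.

Lemma cube_J_orth : forall x, lor (x *m cube_J) cube_w = 0.
Proof. by apply: orthogonal_frame; split; rewrite lor_v5; lra. Qed.

Lemma cube_JV i : ovec (cube_vi i) = cube_V i *m cube_J + cube_om i *: cube_w.
Proof.
have h2 := sqrt2_sqr R.
rewrite mul_frame !v5E; case: i => [[[] []] []];
  rewrite /cube_vi /cube_om /cube_even /sgb /= ovecE /sgb /=; by congr v5; lra.
Qed.

(** At a vertex where [z] attains its maximum 0, passing to the neighbour across one axis cannot
    increase the product. A nonzero coordinate of [z] on that axis thus fixes the sign of the vertex
    there, and all such vertices lie in one facet. *)
Lemma cube_facet_select (z : vec) : z != 0 -> (forall i, lor z (cube_V i) <= 0) ->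
  exists j, forall i, lor z (cube_V i) = 0 -> lor (octa_V j) (cube_V i) = 0.
Proof.
have h2 := sqrt2_sqr R.
move=> z0 zle; have [x [y [w [t zE]]]] := v4P z; rewrite zE in z0 zle *.
have pick (x' : R) a : x' != 0 -> 0 <= sgb a * x' -> a = (x' < 0).
  move=> x0; rewrite /sgb; case: a; rewrite ?mulN1r ?mul1r.
    by rewrite oppr_ge0 lt_neqAle x0 => ->.
  by rewrite leNgt => /negbTE ->.
have ss b : s2 * sgb b * sgb b = s2 by rewrite -mulrA sgb_sqr mulr1.
have sgN b : sgb (~~ b) = - sgb b :> R by case: b; rewrite /sgb //= opprK.
have [x0|x0] := eqVneq x 0; last first.
  exists (@Ordinal 3 0 isT, x < 0) => -[[a b] c] h; rewrite lor_v4 /=.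
  rewrite -(@pick x a) ?ss //; first by ring.
  by have := zle (~~ a, b, c); move: h; rewrite !lor_v4 /= sgN; lra.
have [y0|y0] := eqVneq y 0; last first.
  exists (@Ordinal 3 1 isT, y < 0) => -[[a b] c] h; rewrite lor_v4 /=.
  rewrite -(@pick y b) ?ss //; first by ring.
  by have := zle (a, ~~ b, c); move: h; rewrite !lor_v4 /= sgN; lra.
have [w0|w0] := eqVneq w 0; last first.
  exists (@Ordinal 3 2 isT, w < 0) => -[[a b] c] h; rewrite lor_v4 /=.
  rewrite -(@pick w c) ?ss //; first by ring.
  by have := zle (a, b, ~~ c); move: h; rewrite !lor_v4 /= sgN; lra.
exists (@Ordinal 3 0 isT, false) => i; rewrite lor_v4 x0 y0 w0 => h; exfalso.
move/negP: z0; apply; rewrite x0 y0 w0 v4_eq0 !eqxx /=.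
have /eqP : t * s2 = 0 by lra.
by rewrite mulf_eq0 (negbTE (sqrt2_neq0 R)) orbF.
Qed.

(** Each of the six squares relates its two diagonal sums by [quadrilateral_diagonals], and
    [cube_gram] evaluates the ratios. The even vertices then provide a Lorentz frame, in which the
    odd ones are half sums. *)
Lemma cube_rigid (V : idx -> vec) :
  (forall i, lor (V i) (V i) = 1) -> (forall i, 0 < ltime (V i)) ->
  (forall b c, lor (V (false, b, c)) (V (true, b, c)) = -1) ->
  (forall a c, lor (V (a, false, c)) (V (a, true, c)) = -1) ->
  (forall a b, lor (V (a, b, false)) (V (a, b, true)) = -1) ->
  (forall D, (forall i, lor D (V i) = 0) -> D = 0) ->
  (forall i j l a b c, i <> j -> j <> l -> l <> i ->
    a *: V i + b *: V j + c *: V l = 0 -> c = 0) ->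
  (forall H, face (@cube R 3) H -> exists F, forall t,
    lor F (V t) <= 0 /\ (lor F (V t) = 0 <-> H (cubeW t))) ->
  exists LP, [/\ lorentz LP, 0 < ltime (row_mx 0 1%:M *m LP) &
    forall i, V i = cube_V i *m LP].
Proof.
move=> V1 Vt adj1 adj2 adj3 Vspan indep facetF; have h2 := sqrt2_sqr R.
(* The vertices [i], [k], [j], [l] follow one another around the face; [t] lies outside it and shows
   that the supporting vector is nonzero. *)
have quad (i k j l : idx) (m1 m2 m3 a b c : bool) (t : idx) :
    let Q (x : idx) := [/\ m1 -> x.1.1 = a, m2 -> x.1.2 = b & m3 -> x.2 = c] in
    Q i -> Q k -> Q j -> Q l -> ~ Q t ->
    [/\ lor (V i) (V k) = -1, lor (V k) (V j) = -1, lor (V j) (V l) = -1 &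
        lor (V i) (V l) = -1] -> i <> k -> k <> j -> j <> i -> j <> l -> l <> k ->
    exists r, V i + V j = r *: (V k + V l).
  move=> Q Qi Qk Qj Ql Qt adj ik kj ji jl lk.
  have [H HQ hH] := @cube_face R m1 m2 m3 a b c.
  have hH' x : H (cubeW x) <-> Q x by case: x => [[x1 x2] x3]; apply: hH.
  have [F hF] := facetF H HQ.
  apply: (@quadrilateral_diagonals R (V i) (V k) (V j) (V l) F) => //.
  - by split; apply: (hF _).2.2; apply/hH'.
  - by move=> F0; apply: Qt; apply/hH'; apply: (hF _).2.1; rewrite F0 lor0l.
  - move=> r e; have : (-1 : R) = 0; last by lra.
    apply: (@indep i k j (1 - r) (- r)) => //.
    apply/rowP => m; have := congr1 (fun v : vec => v 0 m) e; rewrite !mxE; lra.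
  - move=> r e; have : (-1 : R) = 0; last by lra.
    apply: (@indep k j l (1 - r) (- r)) => //.
    apply/rowP => m; have := congr1 (fun v : vec => v 0 m) e; rewrite !mxE; lra.
have adj : forall i j : idx, [|| (i.1.2 == j.1.2) && (i.2 == j.2) && (i.1.1 != j.1.1),
    (i.1.1 == j.1.1) && (i.2 == j.2) && (i.1.2 != j.1.2) |
    (i.1.1 == j.1.1) && (i.1.2 == j.1.2) && (i.2 != j.2)] -> lor (V i) (V j) = -1.
  by move=> [[[] []] []] [[[] []] []] //= _; do ?[by rewrite ?adj1 ?adj2 ?adj3];
    rewrite lorC ?adj1 ?adj2 ?adj3.
(* The [E] are the even vertices, and each [O] is the antipode of the [E] with the same number. *)
pose E1 := V (false, false, false); pose E2 := V (false, true, true).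
pose E3 := V (true, false, true); pose E4 := V (true, true, false).
pose O1 := V (true, true, true); pose O2 := V (true, false, false).
pose O3 := V (false, true, false); pose O4 := V (false, false, true).
have [k12 r12] : exists k, E1 + E2 = k *: (O3 + O4).
  apply: (@quad _ _ _ _ true false false false false false (true, true, true)) => //=.
  - by move=> [/(_ isT)].
  - by split; apply: adj.
have [k13 r13] : exists k, E1 + E3 = k *: (O2 + O4).
  apply: (@quad _ _ _ _ false true false false false false (true, true, true)) => //=.
  - by move=> [_ /(_ isT)].
  - by split; apply: adj.
have [k14 r14] : exists k, E1 + E4 = k *: (O2 + O3).
  apply: (@quad _ _ _ _ false false true false false false (true, true, true)) => //=.
  - by move=> [_ _ /(_ isT)].
  - by split; apply: adj.
have [k34 r34] : exists k, E3 + E4 = k *: (O1 + O2).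
  apply: (@quad _ _ _ _ true false false true false false (false, true, true)) => //=.
  - by move=> [/(_ isT)].
  - by split; apply: adj.
have [k24 r24] : exists k, E2 + E4 = k *: (O1 + O3).
  apply: (@quad _ _ _ _ false true false false true false (true, false, true)) => //=.
  - by move=> [_ /(_ isT)].
  - by split; apply: adj.
have [k23 r23] : exists k, E2 + E3 = k *: (O1 + O4).
  apply: (@quad _ _ _ _ false false true false false true (true, true, false)) => //=.
  - by move=> [_ _ /(_ isT)].
  - by split; apply: adj.
have := @cube_gram R E1 E2 E3 E4 O1 O2 O3 O4 k12 k13 k14 k23 k24 k34.
case; do ?[by split; apply: adj | by split; apply: V1 | by split; apply: Vt | by split].
  by move=> z [z1 z2 z3 z4] [w1 w2 w3 w4]; apply: Vspan => -[[[] []] []].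
move=> [x12 x13 x14 x23] [x24 x34 [R12 R13 R14 R34]].
have O4E : O4 = 2^-1 *: (E1 + E2 + E3 - E4).
  have -> : E1 + E2 + E3 - E4 = (E1 + E2) + (E1 + E3) - (E1 + E4).
    by apply/rowP => m; rewrite !mxE; ring.
  by rewrite R12 R13 R14; apply/rowP => m; rewrite !mxE; field.
have O3E : O3 = 2^-1 *: (E1 + E2 - E3 + E4).
  have -> : E1 + E2 - E3 + E4 = (E1 + E2) - (E1 + E3) + (E1 + E4).
    by apply/rowP => m; rewrite !mxE; ring.
  by rewrite R12 R13 R14; apply/rowP => m; rewrite !mxE; field.
have O2E : O2 = 2^-1 *: (E1 - E2 + E3 + E4).
  have -> : E1 - E2 + E3 + E4 = - (E1 + E2) + (E1 + E3) + (E1 + E4).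
    by apply/rowP => m; rewrite !mxE; ring.
  by rewrite R12 R13 R14; apply/rowP => m; rewrite !mxE; field.
have O1E : O1 = 2^-1 *: (- E1 + E2 + E3 + E4).
  have -> : - E1 + E2 + E3 + E4 = 2 *: (E3 + E4) - (E1 - E2 + E3 + E4).
    by apply/rowP => m; rewrite !mxE; ring.
  have -> : E1 - E2 + E3 + E4 = 2 *: O2 by rewrite O2E scalerA divff ?scale1r // pnatr_eq0.
  by rewrite R34; apply/rowP => m; rewrite !mxE; field.
exists (frame (4^-1 *: (E1 + E2 - E3 - E4)) (4^-1 *: (E1 - E2 + E3 - E4))
    (4^-1 *: (E1 - E2 - E3 + E4)) (s2 / 8 *: (E1 + E2 + E3 + E4))); split.
- apply: (@four_vector_frame R _ _ _ _ (-3)) => //.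
  + by split; apply: V1.
  + by field.
  + by transitivity (- (s2 * s2 / 2)); [field|rewrite h2; field].
- rewrite v4_time mul_frame !scale0r !add0r scale1r ltimeZ; apply: mulr_gt0.
    by rewrite divr_gt0 // sqrt2_gt0.
  by rewrite !ltimeD !addr_gt0 // Vt.
- move=> i; rewrite mul_frame.
  have -> : V i = (if i.1.1 then if i.1.2 then if i.2 then O1 else E4 else if i.2 then E3 else O2
     else if i.1.2 then if i.2 then E2 else O3 else if i.2 then O4 else E1).
    by case: i => [[[] []] []].
  rewrite O1E O2E O3E O4E.
  move: E1 E2 E3 E4 {r12 r13 r14 r34 r24 r23 x12 x13 x14 x23 x24 x34 R12 R13 R14 R34 O1E O2E O3E O4E}
    => X1 X2 X3 X4.
  case: i => [[[] []] []]; rewrite /sgb /=; apply/rowP => m; rewrite !mxE;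
    move: (X1 _ _) (X2 _ _) (X3 _ _) (X4 _ _) => x1 x2 x3 x4;
    have e1 := congr1 (fun y => y * x1) h2; have e2 := congr1 (fun y => y * x2) h2;
    have e3 := congr1 (fun y => y * x3) h2; have e4 := congr1 (fun y => y * x4) h2;
    by rewrite /= in e1 e2 e3 e4; lra.
Qed.

Lemma cubical_embedding (B : polytopal_packing R 2) :
  cubical B -> has_orthoplicial_section B.
Proof.
move=> tB; have h2 := sqrt2_sqr R.
have [p [vP p1 pedge pfacet [pspan pindep]]] := combinatorial_data tB (@cubeW_inj R)
  (@cube_vertex R) (@cube_ex R).
have edge (m1 m2 m3 a b c : bool) (i j : idx) : i <> j ->
    (forall x, [/\ m1 -> x.1.1 = a, m2 -> x.1.2 = b & m3 -> x.2 = c] <-> x = i \/ x = j) ->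
    lor (uvec (p i)) (uvec (p j)) = -1.
  move=> ij h; have [H HQ hH] := @cube_face R m1 m2 m3 a b c.
  apply: pedge HQ _ => // x; apply: iff_trans (h x); case: x => [[x1 x2] x3].
  exact: hH.
have [LP [lLP LP0 VLP]] : exists LP, [/\ lorentz LP, 0 < ltime (row_mx 0 1%:M *m LP) &
    forall i, uvec (p i) = cube_V i *m LP].
  apply: cube_rigid.
  - by move=> i; apply: (p1 _).1.
  - by move=> i; apply: (p1 _).2.
  - move=> b c; apply: (@edge false true true false b c) => // -[[x1 x2] x3] /=.
    split=> [[_ /(_ isT)-> /(_ isT)->]|[[_ -> ->]|[_ -> ->]]] //.
    by case: x1; [right|left].
  - move=> a c; apply: (@edge true false true a false c) => // -[[x1 x2] x3] /=.
    split=> [[/(_ isT)-> _ /(_ isT)->]|[[-> _ ->]|[-> _ ->]]] //.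
    by case: x2; [right|left].
  - move=> a b; apply: (@edge true true false a b false) => // -[[x1 x2] x3] /=.
    split=> [[/(_ isT)-> /(_ isT)-> _]|[[-> -> _]|[-> -> _]]] //.
    by case: x3; [right|left].
  - exact: pspan.
  - exact: pindep.
  - exact: pfacet.
have F0 j : lor (octa_V j : vec) (octa_V j) != 0 by rewrite lor_octa_V oner_eq0.
have [L [nu [lL bE dE cE [nu0 nu1]]]] := std_model lLP LP0 vP VLP F0 cube_facet_select.
have half0 : (0 : R) < 2^-1 by rewrite invr_gt0.
(* [Pm] asks a matrix to preserve every residue class. These classes separate the vertices, so they
   also separate the two values of [cube_om]. *)
apply: (@assemble R B _ _ cube_V octa_V L nu lL bE dE cE nu0 nu1 _ F0 cube_J 2^-1 cube_w
  half0 cube_J_conf cube_J_orth _ _ cube_om cube_vi cube_JV (fun=> 1)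
  (fun M => forall i x, cube_class i x -> cube_class i (x *m M))).
- by move=> i; rewrite lor_v4 !sgb_sqr h2; ring.
- by rewrite lor_v5; apply/eqP; lra.
- move=> x; have [a [b [c [t ->]]]] := v4P x; rewrite ltime_v4 mul_frame !v5E ltime_v5.
  have := sqrt2_gt0 R => s20 t0.
  by have : 0 < t * (s2 / 2) by [rewrite mulr_gt0 // divr_gt0]; lra.
- by [].
- by move=> *; rewrite mulr1.
- by move=> i x; rewrite mulmx1.
- by move=> M M' hM hM' i x hx; rewrite mulmxA; apply: hM'; apply: hM.
- by move=> j i x; apply: cube_class_refl.
- by move=> *; rewrite mulr1.
- move=> M M' i j hM hM' e; congr cube_om.
  have h1 := hM i _ (cube_class_V i); have h3 := hM' j _ (cube_class_V j).
  by rewrite e in h1; apply: cube_class_inj h1 h3.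
- move=> [[[|[|[|m]]] hm] b] //; left; split=> //; exists (s2 / 2).
  + exists (sgf b b (~~ b) (~~ b)); split; first by rewrite mulf_neq0 ?sqrt2_neq0 // invr_eq0 pnatr_eq0.
    by rewrite fvecE mul_frame !v5E sqrt2V; case: b; rewrite /sgb /=; congr v5; lra.
  + exists (sgf b (~~ b) b (~~ b)); split; first by rewrite mulf_neq0 ?sqrt2_neq0 // invr_eq0 pnatr_eq0.
    by rewrite fvecE mul_frame !v5E sqrt2V; case: b; rewrite /sgb /=; congr v5; lra.
  + exists (sgf b (~~ b) (~~ b) b); split; first by rewrite mulf_neq0 ?sqrt2_neq0 // invr_eq0 pnatr_eq0.
    by rewrite fvecE mul_frame !v5E sqrt2V; case: b; rewrite /sgb /=; congr v5; lra.
- move=> hz.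
  (* Here the embedding hits all eight vertices of the orthoplex, so their curvatures are exactly
     those of the eight disks. *)
  have hV i : exists z : int, - lor (ovec (cube_vi i)) ((2^-1)^-1 *: (nu *m cube_J)) = z%:~R.
    have [z e] := hz i; exists z; rewrite -e cube_JV lorZr lorDl lorZl cube_J_conf.
    by rewrite (lorC cube_w) cube_J_orth; field.
  move=> [i c]; have [a [b ->]] := oidxP i; case: c.
    by have := hV (~~ a, ~~ b, ~~ (a (+) b)); case: a; case: b.
  by have := hV (a, b, a (+) b); case: a; case: b.
Qed.

End CubicalEmbedding.

Theorem theorem1 (R : realType) (B : polytopal_packing R 2) :
  tetrahedral B \/ octahedral B \/ cubical B ->
  exists B' : polytopal_packing R 3,
    [/\ orthoplicial B',
        exists (G : set (hatR R 3 -> hatR R 3)) (X : set (set (hatR R 3))),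
          is_apollonian_section B' G X /\
          arithmetically_equivalent (apollonian_group B) (balls B) G X &
        integral_packing (apollonian_packing B) <->
        integral_packing (apollonian_packing B')].
Proof.
move=> [|[|]].
- exact: tetrahedral_embedding.
- exact: octahedral_embedding.
- exact: cubical_embedding.
Qed.
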